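(* Let $d\ge4$. A planar $d$-web is linearizable if and only if the web is geodesic and the Liouville tensor of one of its $4$-subwebs vanishes.
   Context: Everything is local, real and $C^\infty$. A planar $d$-web is a collection of $d$ one-dimensional foliations of a plane domain whose directions are pairwise distinct at each point; a $4$-subweb consists of four of these foliations. Two webs are (locally) equivalent if a local diffeomorphism maps one to the other. A web is linearizable if it is locally equivalent to a web all of whose leaves are (pieces of) straight lines in the affine plane. A web is geodesic if there is a torsion-free affine connection for which all leaves of all its foliations are (unparametrized) geodesics. A projective structure is an equivalence class of torsion-free affine connections having the same unparametrized geodesics. With every planar $4$-web there is associated a unique projective structure with respect to which the leaves of all four foliations are geodesics (the canonical projective structure of the $4$-web). Liouville tensor: for a torsion-free affine connection $\nabla$ on the plane domain with curvature tensor $R$ and Ricci tensor $Ric(X,Y)=\operatorname{tr}\{Z\mapsto R(Z,X)Y\}$, put $$\mathfrak{P}(X,Y)=\tfrac23Ric(X,Y)+\tfrac13Ric(Y,X),\qquad \mathfrak{L}(X,Y,Z)=(\nabla_X\mathfrak{P})(Y,Z)-(\nabla_Y\mathfrak{P})(X,Z)$$ for vector fields $X,Y,Z$. The tensor $\mathfrak{L}$ depends only on the projective structure of $\nabla$. The Liouville tensor of a $4$-web is the tensor $\mathfrak{L}$ of any representative $\nabla$ of its canonical projective structure. *)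

(* Defs.v *)
From HB Require Import structures.
From mathcomp Require Export all_boot all_order all_algebra perm.
From mathcomp Require Export all_classical all_reals all_analysis.
Export numFieldNormedType.Exports.
#[export] Set Implicit Arguments.
#[export] Unset Strict Implicit.
#[export] Unset Printing Implicit Defensive.
Export Order.TTheory GRing.Theory Num.Theory.
#[global] Open Scope classical_set_scope.
#[global] Open Scope ring_scope.

Section Smooth.
Context {R : realType} {V V' : normedModType R}.

(* Meant for open [U] only: the derivatives are two-sided. *)
Fixpoint Ck (n : nat) (U : set V) (f : V -> V') : Prop :=
  if n is n'.+1 then
    (forall p, U p -> differentiable f p) /\
    (forall v : V, Ck n' U (fun p => 'D_v f p))
  else forall p, U p -> {for p, continuous f}.

Definition smooth (U : set V) (f : V -> V') : Prop := forall n, Ck n U f.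

End Smooth.

Section PlanarWebs.
Context {R : realType}.
Local Notation plane := 'rV[R]_2.

Definition plane_domain (U : set plane) : Prop :=
  [/\ open U, connected U & U !=set0].

Definition diffeomorphism (V V' : set plane) (phi : plane -> plane) : Prop :=
  [/\ open V, open V' & exists psi : plane -> plane,
    [/\ smooth V phi, smooth V' psi,
        forall p, V p -> V' (phi p) /\ psi (phi p) = p &
        forall q, V' q -> V (psi q) /\ phi (psi q) = q]].

(* A foliation is encoded by its field of tangent directions: [T p] is the
   tangent line at [p] of the leaf through [p], irrelevant for [p] outside [U].
   Locally the leaves are the level curves of a submersion [u]. *)
Definition foliation (U : set plane) (T : plane -> set plane) : Prop :=
  forall p, U p -> exists (V : set plane) (u : plane -> R),
    [/\ open_nbhs p V, V `<=` U, smooth V u &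
        forall q, V q -> (exists v, 'D_v u q != 0) /\
                         T q = [set v | 'D_v u q = 0]].

Definition regular_curve (U : set plane) (a b : R) (gamma : R -> plane) : Prop :=
  smooth `]a, b[ gamma /\
  forall t, t \in `]a, b[ -> U (gamma t) /\ derive1 gamma t != 0.

(* The regular parametrizations of the open arcs of leaves. *)
Definition leaf_curve (U : set plane) (T : plane -> set plane)
    (a b : R) (gamma : R -> plane) : Prop :=
  regular_curve U a b gamma /\
  forall t, t \in `]a, b[ -> T (gamma t) (derive1 gamma t).

Definition leaf (U : set plane) (T : plane -> set plane) (p : plane) : set plane :=
  [set q | exists (a b : R) (gamma : R -> plane) (s t : R),
    [/\ leaf_curve U T a b gamma, s \in `]a, b[, t \in `]a, b[,
        gamma s = p & gamma t = q]].

Definition straight_leaves (U : set plane) (T : plane -> set plane) : Prop :=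
  forall p, U p -> exists2 v : plane, v != 0 &
    leaf U T p `<=` [set p + c *: v | c in [set: R]].

Definition web (d : nat) := 'I_d -> plane -> set plane.

Definition is_web d (U : set plane) (W : web d) : Prop :=
  (forall i, foliation U (W i)) /\
  (forall i j p, i != j -> U p -> W i p <> W j p).

(* The permutation accounts for webs being unordered collections. *)
Definition maps_web d (V : set plane) (W W' : web d) (phi : plane -> plane) : Prop :=
  exists s : {perm 'I_d}, forall i p, V p ->
    [set 'D_v phi p | v in W i p] = W' (s i) (phi p).

Definition linearizable d (U : set plane) (W : web d) : Prop :=
  forall p, U p -> exists (V V' : set plane) (phi : plane -> plane) (W' : web d),
    [/\ V p /\ V `<=` U, diffeomorphism V V' phi, is_web V' W',
        forall i, straight_leaves V' (W' i) & maps_web V W W' phi].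

(* A connection on a plane domain is given by the vector fields
   [G i j = nabla_(e_i) e_j = \sum_k Gamma^k_ij e_k], where (e_0, e_1) is the
   standard frame. *)
Definition connection := 'I_2 -> 'I_2 -> plane -> plane.

Definition nabla (G : connection) (X Y : plane -> plane) : plane -> plane :=
  fun p => 'D_(X p) Y p + \sum_i \sum_j (X p 0 i * Y p 0 j) *: G i j p.

Definition lie_bracket (X Y : plane -> plane) : plane -> plane :=
  fun p => 'D_(X p) Y p - 'D_(Y p) X p.

Definition torsion_free_connection (U : set plane) (G : connection) : Prop :=
  (forall i j, smooth U (G i j)) /\
  (forall X Y : plane -> plane, smooth U X -> smooth U Y -> forall p, U p ->
     nabla G X Y p - nabla G Y X p = lie_bracket X Y p).

(* The covariant derivative of the velocity of [gamma] along [gamma]. *)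
Definition acceleration (G : connection) (gamma : R -> plane) (t : R) : plane :=
  derive1 (derive1 gamma) t +
  \sum_i \sum_j (derive1 gamma t 0 i * derive1 gamma t 0 j) *: G i j (gamma t).

Definition unparam_geodesic (G : connection) (a b : R) (gamma : R -> plane) : Prop :=
  forall t, t \in `]a, b[ ->
    exists c : R, acceleration G gamma t = c *: derive1 gamma t.

Definition geodesic_for d (U : set plane) (W : web d) (G : connection) : Prop :=
  forall i a b gamma, leaf_curve U (W i) a b gamma -> unparam_geodesic G a b gamma.

Definition geodesic_web d (U : set plane) (W : web d) : Prop :=
  exists2 G, torsion_free_connection U G & geodesic_for U W G.

Definition same_geodesics (U : set plane) (G G' : connection) : Prop :=
  forall a b gamma, regular_curve U a b gamma ->
    (unparam_geodesic G a b gamma <-> unparam_geodesic G' a b gamma).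

Definition projective_structure (U : set plane) (Pi : set connection) : Prop :=
  exists2 G, torsion_free_connection U G &
    Pi = [set G' | torsion_free_connection U G' /\ same_geodesics U G G'].

Definition canonical_projective_structure (U : set plane) (W : web 4)
    (Pi : set connection) : Prop :=
  projective_structure U Pi /\ forall G, Pi G -> geodesic_for U W G.

Definition curvature (G : connection) (X Y Z : plane -> plane) : plane -> plane :=
  fun p => nabla G X (nabla G Y Z) p - nabla G Y (nabla G X Z) p
           - nabla G (lie_bracket X Y) Z p.

(* The trace is computed by extending tangent vectors [z] to constant fields;
   this is harmless as the curvature is tensorial. *)
Definition ricci (G : connection) (X Y : plane -> plane) : plane -> R :=
  fun p => \tr (lin1_mx (fun z : plane => curvature G (cst z) X Y p)).

Definition schouten (G : connection) (X Y : plane -> plane) : plane -> R :=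
  fun p => 2 / 3 * ricci G X Y p + 1 / 3 * ricci G Y X p.

Definition nabla_schouten (G : connection) (X Y Z : plane -> plane) : plane -> R :=
  fun p => 'D_(X p) (schouten G Y Z) p
           - schouten G (nabla G X Y) Z p - schouten G Y (nabla G X Z) p.

Definition liouville (G : connection) (X Y Z : plane -> plane) : plane -> R :=
  fun p => nabla_schouten G X Y Z p - nabla_schouten G Y X Z p.

Definition liouville_tensor_vanishes (U : set plane) (W : web 4) : Prop :=
  exists Pi G, [/\ canonical_projective_structure U W Pi, Pi G &
    forall X Y Z : plane -> plane, smooth U X -> smooth U Y -> smooth U Z ->
      forall p, U p -> liouville G X Y Z p = 0].

Definition subweb d (W : web d) (s : 'I_4 -> 'I_d) : web 4 := fun k => W (s k).

End PlanarWebs.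

Arguments web R d : clear implicits.
Arguments connection R : clear implicits.

(* Main.v *)
From HB Require Import structures.
Require Import Defs.
From mathcomp Require Import ring lra.

(** In the affine coordinates of the plane let [pi] be the trace-free
    (Thomas) part of the Christoffel symbols of a connection; it depends only on
    the projective structure, and so does the Liouville tensor, which is therefore
    computed from [pi].  A vector [v] satisfies the geodesic equation of [pi] up to
    reparametrization iff a binary cubic form with coefficients [pi] takes a
    prescribed value at [v], so four directions in a point determine [pi]: any two
    connections for which a 4-web is geodesic have the same [pi].

    If the Liouville tensor vanishes, the linear system
    [d_i d_j s = pi_ij^k d_k s - Ric_ij s] is completely integrable and has a
    three-dimensional space of local solutions.  Along a geodesic every solution
    satisfies one and the same equation [s'' = c s' - r s], so the quotients
    [(s1 / s0, s2 / s0)] map geodesics to straight lines.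

    Conversely a local linearization [phi] yields the flat connection
    [(D phi)^-1 D^2 phi] for which the leaves are geodesics.  Its trace-free part is
    determined by four of the foliations, so these local trace-free parts agree on
    overlaps and define a global connection with vanishing Liouville tensor. *)

(** * Calculus of C^k maps *)

Section CkCalculus.
Context {R : realType}.
Implicit Types V W : normedModType R.

(** Fixed affine coordinates turn a projective structure into plain functions: the trace-free
    symbols are common to all its connections, so local representatives glue by mere equality on
    overlaps. Trace-freeness also makes the Ricci tensor symmetric, hence [Sch] equal to [Ric] and
    the system for [s] symmetric in its two indices. As the curvature in dimension two is algebraic
    in the Ricci tensor, the Liouville tensor is then the only obstruction to integrability. The
    linear system is solved along the rays from the base point. Flatness cancels the first order
    discrepancy between solutions on neighbouring rays, and a Gronwall estimate leaves a quadratic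
    error, which gives differentiability and the value of the derivative at once. Geodesic
    conditions are quantified over parametrized leaf curves. To compare two connections at a point,
    a leaf curve through that point with nonzero velocity must first be produced; the inverse
    function theorem supplies it. *)

Lemma differentiable_epsP V W (f : V -> W) p : differentiable f p <->
  exists2 L : {linear V -> W}, continuous L & forall e, 0 < e ->
    \forall h \near (0 : V), `|f (h + p) - f p - L h| <= e * `|h|.
Proof.
split=> [df|[L cL fL]].
  exists ('d f p); first by have /diff_locallyP[] := df.
  have /diff_locallyP[_ /eqaddoP H] := df => e e0.
  apply: filterS (H e e0) => h /=; congr (_ <= _).
  by rewrite -[RHS]/(`|_|) [in LHS]opprD addrA.
have E : f \o shift p = cst (f p) + L +o_ (0 : V) id.
  apply/eqaddoP => e e0; apply: filterS (fL e e0) => h /=.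
  by rewrite !fctE /= opprD addrA.
have dE : 'd f p = L :> (V -> W) by apply: diff_unique.
by apply/diff_locallyP; rewrite dE.
Qed.

Lemma open_near V (U : set V) p : open U -> U p -> \forall q \near p, U q.
Proof. by move=> oU Up; exact: open_nbhs_nbhs. Qed.

Lemma differentiable_eq_near V W (f g : V -> W) p :
  (\near p, f p = g p) -> differentiable f p -> differentiable g p.
Proof.
move=> fg /differentiable_epsP[L cL fL]; apply/differentiable_epsP.
exists L => // e e0; have := fL _ e0.
have -> : g p = f p by rewrite (nbhs_singleton fg).
have fg' : \forall h \near (0 : V), f (h + p) = g (h + p).
  move: fg; rewrite (near_shift 0)/=.
  by apply: filterS => h /=; rewrite subr0.
by apply: filterS2 fg' => h ->.
Qed.

Lemma Ck_eq V W n (U : set V) (f g : V -> W) : open U ->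
  (forall p, U p -> f p = g p) -> Ck n U f -> Ck n U g.
Proof.
elim: n f g => [|n IH] f g oU fg /=.
  move=> cf p Up; move: (cf p Up); rewrite /prop_for /continuous_at -fg//.
  apply: cvg_trans; apply: near_eq_cvg.
  by apply: filterS (open_near oU Up) => q /fg.
have fgn p : U p -> \near p, f p = g p.
  by move=> Up; apply: filterS (open_near oU Up) => q /fg.
case=> df cdf; split=> [p Up|v]; first exact: differentiable_eq_near (fgn p Up) (df p Up).
apply: IH (cdf v) => // p Up; exact: near_eq_derive (fgn p Up).
Qed.

Lemma sub_Ck V W n (U U' : set V) (f : V -> W) : U' `<=` U -> Ck n U f -> Ck n U' f.
Proof.
move=> UU; elim: n f => [|n IH] f /=; first by move=> cf p /UU/cf.
by case=> df cdf; split=> [p /UU/df//|v]; exact: IH.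
Qed.

Lemma CkS V W n (U : set V) (f : V -> W) : Ck n.+1 U f -> Ck n U f.
Proof.
elim: n f => [|n IH] f.
  by case=> df _ p Up; exact/differentiable_continuous/df.
by case=> df cdf; split=> // v; exact: IH.
Qed.

Lemma Ck_cst V W n (U : set V) (c : W) : Ck n U (fun=> c).
Proof.
elim: n c => [|n IH] c /=; first by move=> p _; exact: cvg_cst.
split=> [p _|v]; first exact: differentiable_cst.
by rewrite (_ : 'D_v _ = fun=> 0)//; apply/funext => p; rewrite derive_cst.
Qed.

Lemma CkD V W n (U : set V) (f g : V -> W) : open U ->
  Ck n U f -> Ck n U g -> Ck n U (fun p => f p + g p).
Proof.
move=> oU; elim: n f g => [|n IH] f g.
  by move=> cf cg p Up; apply: cvgD; [exact: cf|exact: cg].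
move=> [df cf] [dg cg]; split=> [p Up|v].
  by apply: differentiableD; [exact: df|exact: dg].
apply: Ck_eq (IH _ _ (cf v) (cg v)) => // p Up.
by rewrite -[RHS]/('D_v (f + g) p) deriveD; [by []|exact/diff_derivable/df|exact/diff_derivable/dg].
Qed.

Lemma CkN V W n (U : set V) (f : V -> W) : open U ->
  Ck n U f -> Ck n U (fun p => - f p).
Proof.
move=> oU; elim: n f => [|n IH] f.
  by move=> cf p Up; apply: cvgN; exact: cf.
move=> [df cf]; split=> [p Up|v].
  by apply: differentiableN; exact: df.
apply: Ck_eq (IH _ (cf v)) => // p Up.
by rewrite -[RHS]/('D_v (- f) p) deriveN//; exact/diff_derivable/df.
Qed.


Lemma CkB V W n (U : set V) (f g : V -> W) : open U ->
  Ck n U f -> Ck n U g -> Ck n U (fun p => f p - g p).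
Proof. by move=> oU cf cg; apply: CkD => //; exact: CkN. Qed.

Lemma CkM V n (U : set V) (f g : V -> R) : open U ->
  Ck n U f -> Ck n U g -> Ck n U (fun p => f p * g p).
Proof.
move=> oU; elim: n f g => [|n IH] f g.
  by move=> cf cg p Up; apply: cvgM; [exact: cf|exact: cg].
move=> Cf Cg; have [df cf] := Cf; have [dg cg] := Cg; split=> [p Up|v].
  by apply: differentiableM; [exact: df|exact: dg].
have := CkD oU (IH _ _ (CkS Cf) (cg v)) (IH _ _ (CkS Cg) (cf v)).
apply: Ck_eq => // p Up.
by rewrite -[RHS]/('D_v (f * g) p) deriveM; [by []|exact/diff_derivable/df|exact/diff_derivable/dg].
Qed.

Lemma Ck_sum V W n (U : set V) (I : Type) (r : seq I) (f : I -> V -> W) : open U ->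
  (forall i, Ck n U (f i)) -> Ck n U (fun p => \sum_(i <- r) f i p).
Proof.
move=> oU cf; elim: r => [|i r IH].
  by apply: Ck_eq (Ck_cst n U 0) => // p _; rewrite big_nil.
by apply: Ck_eq (CkD oU (cf i) IH) => // p _; rewrite big_cons.
Qed.

Lemma CkV V n (U : set V) (f : V -> R) : open U -> (forall p, U p -> f p != 0) ->
  Ck n U f -> Ck n U (fun p => (f p)^-1).
Proof.
move=> oU f0; elim: n => [|n IH].
  by move=> cf p Up; apply: cvgV; [exact: f0|exact: cf].
move=> Cf; have [df cf] := Cf; split=> [p Up|v].
  by apply: differentiableV; [exact: df|exact: f0].
have Cn := IH (CkS Cf).
have := CkN oU (CkM oU (CkM oU Cn Cn) (cf v)).
apply: Ck_eq => // p Up.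
rewrite deriveV//; [|exact: f0|exact/diff_derivable/df].
by rewrite scaleNr /GRing.scale/= expr2 invfM.
Qed.

Lemma derive_lin V W (L : {linear V -> W}) p v : continuous L -> 'D_v L p = L v.
Proof.
by move=> cL; rewrite deriveE ?diff_lin//; exact: linear_differentiable.
Qed.

Lemma Ck_lin V W n (U : set V) (L : {linear V -> W}) : continuous L -> Ck n U L.
Proof.
move=> cL; case: n => [|n]; first by move=> p _; exact: cL.
split=> [p _|v]; first exact: linear_differentiable.
rewrite (_ : 'D_v L = fun=> L v); first exact: Ck_cst.
by apply/funext => p; exact: derive_lin.
Qed.

Lemma derive_coord V m n (f : V -> 'M[R]_(m, n)) p v i j :
  derivable f p v -> 'D_v f p i j = 'D_v (fun q => f q i j) p.
Proof. by move=> df; rewrite derive_mx// mxE. Qed.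

Lemma differentiable_coord_fun V m n (f : V -> 'M[R]_(m, n)) p i j :
  differentiable f p -> differentiable (fun q => f q i j) p.
Proof.
move=> df; have -> : (fun q => f q i j) = (fun M : 'M[R]_(m, n) => M i j) \o f by [].
by apply: differentiable_comp => //; exact: differentiable_coord.
Qed.

Lemma differentiable_mxP V m n (f : V -> 'M[R]_(m, n)) p :
  differentiable f p <-> forall i j, differentiable (fun q => f q i j) p.
Proof.
split=> [df i j|df]; first exact: differentiable_coord_fun.
have -> : f = \sum_k (fun q => f q k.1 k.2 *: delta_mx k.1 k.2).
  apply/funext => q; rewrite fct_sumE [LHS]matrix_sum_delta.
  by rewrite pair_big.
apply: (big_ind (fun h : V -> _ => differentiable h p)) => [|g h dg dh|k _].
    exact: differentiable_cst.
  exact: differentiableD.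
by apply: differentiableZl; exact: df.
Qed.

Lemma Ck_mxP V k m n (U : set V) (f : V -> 'M[R]_(m, n)) : open U ->
  Ck k U f <-> forall i j, Ck k U (fun q => f q i j).
Proof.
move=> oU; elim: k f => [|k IH] f.
  split=> [cf i j p Up|cf p Up].
    have -> : (fun q => f q i j) = (fun M : 'M[R]_(m, n) => M i j) \o f by [].
    by apply: continuous_comp; [exact: cf|exact: coord_continuous].
  apply/cvgrPdist_le => e e0.
  have H : \forall q \near p, forall ij : 'I_m * 'I_n, `|f p ij.1 ij.2 - f q ij.1 ij.2| <= e.
    by apply: filter_forall => -[i j] /=; have /cvgrPdist_le := cf i j p Up; exact.
  apply: filterS H => q H.
  rewrite /Num.Def.normr/= mx_normrE (bigmax_le _ (ltW e0))//= => -[i j] _.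
  by rewrite !mxE; exact: (H (i, j)).
split=> [[df cf] i j|cf].
  split=> [p Up|v]; first exact/differentiable_coord_fun/df.
  have /IH := cf v => /(_ i j); apply: Ck_eq => // p Up.
  by rewrite derive_coord//; exact/diff_derivable/df.
have df p : U p -> differentiable f p.
  by move=> Up; apply/differentiable_mxP => i j; exact: (cf i j).1.
split=> // v; apply/IH => i j; have [_ /(_ v)] := cf i j.
by apply: Ck_eq => // p Up; rewrite derive_coord//; exact/diff_derivable/df.
Qed.

Lemma derive_sum_delta W m (f : 'rV[R]_m -> W) p v : differentiable f p ->
  'D_v f p = \sum_i v 0 i *: 'D_(delta_mx 0 i) f p.
Proof.
move=> df; rewrite deriveE// {1}[v]row_sum_delta linear_sum/=.
by apply: eq_bigr => i _; rewrite linearZ/= deriveE.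
Qed.

Lemma derive_comp_diff V V' W (f : V -> V') (g : V' -> W) p v :
  differentiable f p -> differentiable g (f p) ->
  'D_v (g \o f) p = 'D_('D_v f p) g (f p).
Proof.
move=> df dg; rewrite deriveE; last exact: differentiable_comp.
by rewrite diff_comp//= [in RHS]deriveE// deriveE.
Qed.

(** With row vectors in the middle, the chain rule writes a derivative of [g \o f] as a finite sum
    of products of coordinates of ['D_v f] and partial derivatives of [g] composed with [f]; the
    induction hypothesis applies to the latter. *)
Lemma Ck_comp_row V m n (U : set V) (U' : set 'rV[R]_m) (f : V -> 'rV[R]_m)
    (g : 'rV[R]_m -> R) : open U -> open U' -> (forall p, U p -> U' (f p)) ->
  Ck n U f -> Ck n U' g -> Ck n U (g \o f).
Proof.
move=> oU oU' UU'; elim: n g => [|n IH] g.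
  by move=> cf cg p Up; apply: continuous_comp; [exact: cf|exact/cg/UU'].
move=> Cf [dg cg]; have [df cf] := Cf; split=> [p Up|v].
  by apply: differentiable_comp; [exact: df|exact/dg/UU'].
have /(Ck_mxP _ _ oU) cfv := cf v.
have H i : Ck n U (fun p => 'D_v f p 0 i * 'D_(delta_mx 0 i) g (f p)).
  by apply: CkM => //; exact: IH (CkS Cf) (cg _).
apply: Ck_eq (Ck_sum (index_enum _) oU H) => // p Up.
have dgp : differentiable g (f p) by exact/dg/UU'.
have dfp : differentiable f p by exact: df.
by rewrite [RHS]derive_comp_diff// derive_sum_delta.
Qed.

End CkCalculus.

(** * Mean value theorem and symmetry of second derivatives *)

Section Schwarz.
Context {R : realType}.
Implicit Types V W : normedModType R.

Lemma nbhs_norm_ex V (A : set V) p : nbhs p A ->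
  exists2 r : R, 0 < r & forall q, `|q - p| < r -> A q.
Proof.
move=> /nbhs_normP[r /= r0 rA]; exists r => // q qr; apply: rA => /=.
by rewrite /= distrC.
Qed.

Lemma is_derive_line V W (f : V -> W) x v (t : R) :
  differentiable f (x + t *: v) ->
  is_derive t 1 (fun s => f (x + s *: v)) ('D_v f (x + t *: v)).
Proof.
move=> df.
have dz : differentiable (fun s : R => s *: v) t by exact: differentiableZl.
have dl : differentiable (fun s : R => x + s *: v) t by exact: differentiableD.
have -> : (fun s => f (x + s *: v)) = f \o (fun s => x + s *: v) by [].
apply: DeriveDef; first exact/diff_derivable/differentiable_comp.
rewrite derive_comp_diff//; congr ('D__ f _).
rewrite deriveE// (_ : (fun s => _) = cst x + (fun s : R => s *: v))//.
by rewrite diffD//= diff_cst add0r diffZl//= diff_val scale1r.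
Qed.

Lemma is_derive_continuous (f : R -> R) (df t : R) : is_derive t 1 f df -> {for t, continuous f}.
Proof.
by case=> d _; apply: differentiable_continuous; exact/derivable1_diffP.
Qed.

Lemma within_continuous_is_derive (f df : R -> R) a b :
  (forall t : R, t \in `[a, b] -> is_derive t 1 f (df t)) -> {within `[a, b], continuous f}.
Proof.
move=> d; apply: derivable_within_continuous => t tab.
by case: (d t tab).
Qed.

Lemma MVT_cc (f df : R -> R) (a b : R) : a < b ->
  (forall t : R, t \in `[a, b] -> is_derive t 1 f (df t)) ->
  exists2 c, c \in `]a, b[ & f b - f a = df c * (b - a).
Proof.
move=> ab D. pose proof (within_continuous_is_derive D) as C.
have D' : forall x, x \in `]a, b[%R -> is_derive x 1 f (df x).
 move=> t th; apply: D. exact: subset_itv_oo_cc.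
exact: (MVT ab D' C).
Qed.

Lemma MVT_line V (f : V -> R) x v h : 0 < h ->
  (forall t, t \in `[0, h] -> differentiable f (x + t *: v)) ->
  exists2 t, t \in `]0, h[ & f (x + h *: v) - f x = h * 'D_v f (x + t *: v).
Proof.
move=> h0 df.
have D t : t \in `[0, h] -> is_derive t 1 (fun s => f (x + s *: v)) ('D_v f (x + t *: v)).
  by move=> /df; exact: is_derive_line.
have [t th E] := MVT_cc h0 D.
by exists t => //; rewrite -[X in _ - f X = _]addr0 -(scale0r v) E subr0 mulrC.
Qed.


Lemma continuous_eps V W (f : V -> W) p e : {for p, continuous f} -> 0 < e ->
  \forall q \near p, `|f q - f p| < e.
Proof. by move=> /cvgrPdistC_lt; apply. Qed.

Lemma norm_sub_le (e x y z : R) : `|x - y| < e / 2 -> `|x - z| < e / 2 -> `|z - y| <= e.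
Proof.
by move=> /ltr_normlP[A1 A2] /ltr_normlP[B1 B2]; apply/ler_normlP; split; lra.
Qed.

(** The second difference of [f] over a small parallelogram is symmetric in its two sides. Two
    applications of the mean value theorem, in either order, express it by a mixed derivative at a
    nearby point; continuity then makes the two values at [p] arbitrarily close. *)
Lemma derive2C V (U : set V) (f : V -> R) p v w : open U -> U p -> Ck 2 U f ->
  'D_v ('D_w f) p = 'D_w ('D_v f) p.
Proof.
move=> oU Up Cf; apply/eqP; rewrite -subr_eq0 -normr_le0; apply/ler_addgt0Pr => e e0.
rewrite add0r.
have [df /[dup] /(_ v)[dv cv] /(_ w)[dw cw]] := Cf.
have e2 : 0 < e / 2 by rewrite divr_gt0.
have N : \forall q \near p, [/\ U q, `|'D_w ('D_v f) q - 'D_w ('D_v f) p| < e / 2 &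
    `|'D_v ('D_w f) q - 'D_v ('D_w f) p| < e / 2].
  have N1 := continuous_eps (cv w p Up) e2.
  have N2 := continuous_eps (cw v p Up) e2.
  by apply: filterS3 (open_near oU Up) N1 N2 => q a b c; exact: And3 a b c.
have [r r0 {}N] := nbhs_norm_ex N.
(* The parallelogram with sides [h *: v] and [h *: w] at [p] stays in the ball of radius [r]; the
   summand 1 keeps the denominator positive. *)
pose h := r / (`|v| + `|w| + 1).
have K0 : 0 < `|v| + `|w| + 1 by rewrite ltr_wpDl// addr_ge0.
have h0 : 0 < h by rewrite divr_gt0.
have hr : h * (`|v| + `|w|) < r.
  by rewrite /h mulrAC ltr_pdivrMr// ltr_pM2l// ltrDl.
have B s t : s \in `[0, h] -> t \in `[0, h] -> `|p + s *: v + t *: w - p| < r.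
  rewrite !in_itv/= => /andP[s0 sh] /andP[t0 th].
  rewrite -(addrA p) addrAC subrr add0r; apply: le_lt_trans hr.
  rewrite (le_trans (ler_normD _ _))// !normrZ !ger0_norm// mulrDr.
  by rewrite lerD// ler_wpM2r.
have I0 : 0 \in `[0, h] by rewrite in_itv/= lexx ltW.
have Ih : h \in `[0, h] by rewrite in_itv/= lexx ltW.
have key (a b : V) : (forall s t, s \in `[0, h] -> t \in `[0, h] ->
    U (p + s *: a + t *: b)) -> exists s, exists2 t, s \in `[0, h] /\ t \in `[0, h] &
    f (p + h *: a + h *: b) - f (p + h *: a) - (f (p + h *: b) - f p)
    = h * (h * 'D_b ('D_a f) (p + s *: a + t *: b)).
  move=> UB.
  have [da ca] := (Cf.2 a).
  pose g (t : R) := f (p + t *: a + h *: b) - f (p + t *: a).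
  have Dg t : t \in `[0, h] -> is_derive t 1 g
     ('D_a f (p + t *: a + h *: b) - 'D_a f (p + t *: a)).
    move=> th; apply: is_deriveB.
      have -> : (fun t => f (p + t *: a + h *: b)) = (fun t => f ((p + h *: b) + t *: a)).
        by apply/funext => s; rewrite addrAC.
      by rewrite addrAC; apply: is_derive_line; rewrite addrAC; apply/df/UB.
    by apply: is_derive_line; apply/df; rewrite -[_ + _]addr0 -(scale0r b); exact: UB.
  have [s sh Es] := MVT_cc h0 Dg.
  have {}sh := subset_itv_oo_cc sh.
  have [|t th Et] := @MVT_line V ('D_a f) (p + s *: a) b h h0.
    by move=> t th; exact/da/UB.
  exists s, t; first by split=> //; exact: subset_itv_oo_cc th.
  by rewrite -Et; move: Es; rewrite subr0 mulrC => <-; rewrite /g scale0r addr0.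
have [|s1 [t1 [s1h t1h] E1]] := key v w.
  by move=> s t sh th; have [] := N _ (B s t sh th).
have [|s2 [t2 [s2h t2h] E2]] := key w v.
  by move=> s t sh th; rewrite addrAC; have [] := N _ (B t s th sh).
have [_ N1 _] := N _ (B _ _ s1h t1h).
have [_ _ N2] := N _ (B _ _ t2h s2h).
have hn0 : h != 0 by rewrite gt_eqF.
have E2' : f (p + h *: v + h *: w) - f (p + h *: v) - (f (p + h *: w) - f p) =
    h * (h * 'D_v ('D_w f) (p + t2 *: v + s2 *: w)).
  rewrite (addrAC p (t2 *: v)) -E2 (addrAC p (h *: w)).
  move: (f (p + h *: v + h *: w)) (f (p + h *: v)) (f (p + h *: w)) (f p).
  move=> a b c d; ring.
have E := mulfI hn0 (mulfI hn0 (etrans (esym E1) E2')).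
move: N1 N2; rewrite {}E.
move: ('D_v ('D_w f) (p + t2 *: v + s2 *: w)) ('D_w ('D_v f) p) ('D_v ('D_w f) p).
exact: norm_sub_le.
Qed.
End Schwarz.

(** * Partial derivatives in the plane *)

Notation i0 := (@ord0 1).
Notation i1 := (@lift 2 ord0 ord0).

Lemma ord2P (i : 'I_2) : i = i0 \/ i = i1.
Proof. by case: (unliftP ord0 i) => [j ->|->]; [right; rewrite (ord1 j)|left]. Qed.

Lemma sum2 (V : nmodType) (F : 'I_2 -> V) : \sum_i F i = F i0 + F i1.
Proof. by rewrite !big_ord_recl big_ord0 addr0. Qed.

(** Locked, so that partial derivatives are atoms in the large polynomial identities below. *)
HB.lock Definition pd (R : realType) (i : 'I_2) (f : 'rV[R]_2 -> R) (p : 'rV[R]_2) : R :=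
  'D_(delta_mx 0 i) f p.

Section Plane.
Context {R : realType}.
Local Notation plane := 'rV[R]_2.
Implicit Types (f g : plane -> R).

Lemma pdE i f p : 'D_(delta_mx 0 i) f p = pd i f p.
Proof. by rewrite pd.unlock. Qed.

Lemma derive_pd f p v : differentiable f p ->
  'D_v f p = v 0 i0 * pd i0 f p + v 0 i1 * pd i1 f p.
Proof. by move=> df; rewrite derive_sum_delta// sum2 !pdE. Qed.

Lemma pd_eq_near i f g p : (\near p, f p = g p) -> pd i f p = pd i g p.
Proof. by rewrite -!pdE; exact: near_eq_derive. Qed.

Lemma pd_eq U i f g p : open U -> U p -> (forall q, U q -> f q = g q) ->
  pd i f p = pd i g p.
Proof.
move=> oU Up fg; apply: pd_eq_near; apply: filterS (open_near oU Up) => q; exact: fg.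
Qed.

Lemma smooth_diff (V W : normedModType R) (U : set V) (f : V -> W) (p : V) :
  smooth U f -> U p -> differentiable f p.
Proof. by move=> sf; exact: (sf 1%N).1. Qed.

Lemma smooth_derive (V W : normedModType R) (U : set V) (f : V -> W) v :
  smooth U f -> smooth U ('D_v f).
Proof. by move=> sf n; exact: (sf n.+1).2. Qed.

Lemma smooth_pd U f i : smooth U f -> smooth U (pd i f).
Proof. by rewrite pd.unlock; exact: smooth_derive. Qed.

Lemma pdC U f p i j : open U -> U p -> smooth U f -> pd i (pd j f) p = pd j (pd i f) p.
Proof. by rewrite pd.unlock => oU Up sf; exact: (derive2C _ _ oU Up (sf 2%N)). Qed.

Lemma smooth_eq (V W : normedModType R) (U : set V) (f g : V -> W) : open U ->
  (forall p, U p -> f p = g p) -> smooth U f -> smooth U g.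
Proof. by move=> oU fg sf n; exact: Ck_eq fg (sf n). Qed.

Lemma sub_smooth (V W : normedModType R) (U U' : set V) (f : V -> W) : U' `<=` U ->
  smooth U f -> smooth U' f.
Proof. by move=> UU sf n; exact: sub_Ck UU (sf n). Qed.

Lemma smooth_cst (V W : normedModType R) (U : set V) (c : W) : smooth U (fun=> c).
Proof. by move=> n; exact: Ck_cst. Qed.

Lemma smoothD (V W : normedModType R) (U : set V) (f g : V -> W) : open U ->
  smooth U f -> smooth U g -> smooth U (fun p => f p + g p).
Proof. by move=> oU sf sg n; exact: CkD. Qed.

Lemma smoothB (V W : normedModType R) (U : set V) (f g : V -> W) : open U ->
  smooth U f -> smooth U g -> smooth U (fun p => f p - g p).
Proof. by move=> oU sf sg n; exact: CkB. Qed.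

Lemma smoothN (V W : normedModType R) (U : set V) (f : V -> W) : open U ->
  smooth U f -> smooth U (fun p => - f p).
Proof. by move=> oU sf n; exact: CkN. Qed.

Lemma smoothM (V : normedModType R) (U : set V) (f g : V -> R) : open U ->
  smooth U f -> smooth U g -> smooth U (fun p => f p * g p).
Proof. by move=> oU sf sg n; exact: CkM. Qed.

Lemma smoothV (V : normedModType R) (U : set V) (f : V -> R) : open U ->
  (forall p, U p -> f p != 0) -> smooth U f -> smooth U (fun p => (f p)^-1).
Proof. by move=> oU f0 sf n; exact: CkV. Qed.

Lemma smooth_sum (V W : normedModType R) (U : set V) n (f : 'I_n -> V -> W) : open U ->
  (forall i, smooth U (f i)) -> smooth U (fun p => \sum_i f i p).
Proof. by move=> oU sf k; apply: Ck_sum => // i; exact: sf. Qed.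

Lemma smooth_mxP (V : normedModType R) (U : set V) m n (f : V -> 'M[R]_(m, n)) : open U ->
  smooth U f <-> forall i j, smooth U (fun q => f q i j).
Proof.
move=> oU; split=> [sf i j k|sf k]; first by have /Ck_mxP := sf k; exact.
by apply/Ck_mxP => // i j; exact: sf.
Qed.

Lemma smooth_row (V : normedModType R) (U : set V) n (f : V -> 'rV[R]_n) : open U ->
  (forall j, smooth U (fun q => f q 0 j)) -> smooth U f.
Proof. by move=> oU sf; apply/smooth_mxP => // i j; rewrite (ord1 i). Qed.

Lemma smooth_coord (V : normedModType R) (U : set V) n (f : V -> 'rV[R]_n) j : open U ->
  smooth U f -> smooth U (fun q => f q 0 j).
Proof. by move=> oU /smooth_mxP; exact. Qed.

Lemma smooth_id (V : normedModType R) (U : set V) : smooth U (id : V -> V).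
Proof. by move=> n; apply: (@Ck_lin R V V n U idfun) => x; exact: cvg_id. Qed.

Lemma smooth_comp_row (V : normedModType R) m n (U : set V) (U' : set 'rV[R]_m)
    (f : V -> 'rV[R]_m) (g : 'rV[R]_m -> 'rV[R]_n) : open U -> open U' ->
  (forall p, U p -> U' (f p)) ->
  smooth U f -> smooth U' g -> smooth U (g \o f).
Proof.
move=> oU oU' UU' sf sg; apply: smooth_row => // j k.
by apply: (@Ck_comp_row _ _ _ k _ U' f (fun q => g q 0 j)) => //; exact: smooth_coord.
Qed.

Lemma smooth_comp (V : normedModType R) m (U : set V) (U' : set 'rV[R]_m)
    (f : V -> 'rV[R]_m) (g : 'rV[R]_m -> R) : open U -> open U' ->
  (forall p, U p -> U' (f p)) ->
  smooth U f -> smooth U' g -> smooth U (g \o f).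
Proof. by move=> oU oU' UU' sf sg k; exact: Ck_comp_row (sf k) (sg k). Qed.

(** Differentiability and value travel together, so that the rules below differentiate an expression
    by its syntax. In [pdt] the value [l] starts as an unknown and is filled in by these rules. *)
Definition is_pd i p f l := differentiable f p /\ pd i f p = l.

Lemma is_pd_val i p f l : is_pd i p f l -> pd i f p = l.
Proof. by case. Qed.

Lemma is_pd_cst i p (c : R) : is_pd i p (fun=> c) 0.
Proof. by split; [exact: differentiable_cst|rewrite -pdE; exact: derive_cst]. Qed.

Lemma is_pdD i p f g a b : is_pd i p f a -> is_pd i p g b ->
  is_pd i p (fun q => f q + g q) (a + b).
Proof.
move=> [df <-] [dg <-]; split; first exact: differentiableD.
by rewrite -!pdE -[LHS]/('D_(delta_mx 0 i) (f + g) p) deriveD//; exact/diff_derivable.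
Qed.

Lemma is_pdN i p f a : is_pd i p f a -> is_pd i p (fun q => - f q) (- a).
Proof.
move=> [df <-]; split; first exact: differentiableN.
by rewrite -!pdE -[LHS]/('D_(delta_mx 0 i) (- f) p) deriveN//; exact/diff_derivable.
Qed.

Lemma is_pdM i p f g a b : is_pd i p f a -> is_pd i p g b ->
  is_pd i p (fun q => f q * g q) (a * g p + f p * b).
Proof.
move=> [df <-] [dg <-]; split; first exact: differentiableM.
have E := @deriveM _ _ f g p (delta_mx 0 i) (diff_derivable df) (diff_derivable dg).
by move: E; rewrite !pdE => ->; rewrite addrC mulrC.
Qed.

Lemma is_pd_sum i p (F : 'I_2 -> plane -> R) a b : is_pd i p (F i0) a ->
  is_pd i p (F i1) b -> is_pd i p (fun q => \sum_m F m q) (a + b).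
Proof.
move=> Fa Fb; rewrite (_ : (fun q => _) = (fun q => F i0 q + F i1 q)); first exact: is_pdD.
by apply/funext => q; rewrite sum2.
Qed.

Lemma is_pd_smooth U i p f : U p -> smooth U f -> is_pd i p f (pd i f p).
Proof. by move=> Up sf; split=> //; exact: smooth_diff sf Up. Qed.

End Plane.

Ltac smt := repeat first
  [ assumption
  | match goal with
    | H : forall _, smooth _ _ |- _ => apply: H
    | H : forall _ _, smooth _ _ |- _ => apply: H
    | H : forall _ _ _, smooth _ _ |- _ => apply: H
    end
  | apply: smooth_cst | apply: smoothD | apply: smoothB | apply: smoothN
  | apply: smoothM | apply: smooth_pd | (apply: smooth_sum => // ? ) ].

Ltac pdt := repeat first
  [ apply: is_pd_cst | apply: is_pdD | apply: is_pdN | apply: is_pdM | apply: is_pd_sum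
  | (try match goal with |- is_pd ?i ?p (fun q => ?h q) ?l => change (is_pd i p h l) end;
     apply: is_pd_smooth; [eassumption|smt]) ].

(** * Connections in coordinates *)

Section Symbols.
Context {R : realType}.
Local Notation plane := 'rV[R]_2.
Definition symbols := 'I_2 -> 'I_2 -> 'I_2 -> plane -> R.
Implicit Types g : symbols.

(** The component of [R(e_i, e_j) e_l] along [e_k]. *)
Definition Rm g i j l k q := pd i (g j l k) q - pd j (g i l k) q +
  \sum_m (g j l m q * g i m k q - g i l m q * g j m k q).

Definition Ric g j l q := \sum_i Rm g i j l i q.

Definition Sch g j l q := 2 / 3 * Ric g j l q + 1 / 3 * Ric g l j q.

(** The component of the Liouville tensor at [(e_0, e_1, e_l)]; antisymmetry in the first two
    arguments leaves no others. The terms in [Gamma_01^m] and [Gamma_10^m] are absent because they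
    cancel for symmetric symbols. *)
Definition Lv g l q := pd i0 (Sch g i1 l) q - pd i1 (Sch g i0 l) q
  - \sum_m g i0 l m q * Sch g i1 m q + \sum_m g i1 l m q * Sch g i0 m q.

Definition tr_symbols g j q := \sum_l g l j l q.

(** The factor is [1 / (n + 1)] for dimension [n = 2]: the trace of the bracket is three times the
    trace of [g]. *)
Definition thomas g : symbols := fun i j k q => g i j k q
  - 1 / 3 * ((i == k)%:R * tr_symbols g j q + (j == k)%:R * tr_symbols g i q).

Variables (U : set plane) (g : symbols).
Hypotheses (oU : open U) (sg : forall i j k, smooth U (g i j k)).
Hypothesis symg : forall i j k q, U q -> g i j k q = g j i k q.

Lemma smooth_thomas i j k : smooth U (thomas g i j k).
Proof. rewrite /thomas /tr_symbols; smt. Qed.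

Lemma pd_thomas a i j k p : U p -> pd a (thomas g i j k) p =
  pd a (g i j k) p - 1 / 3 * ((i == k)%:R * (pd a (g i0 j i0) p + pd a (g i1 j i1) p)
     + (j == k)%:R * (pd a (g i0 i i0) p + pd a (g i1 i i1) p)).
Proof.
move=> Up; rewrite /thomas /tr_symbols; erewrite is_pd_val; last (by pdt); cbv beta.
ring.
Qed.

Lemma pd2_thomas b a i j k p : U p -> pd b (pd a (thomas g i j k)) p =
  pd b (pd a (g i j k)) p - 1 / 3 * ((i == k)%:R * (pd b (pd a (g i0 j i0)) p + pd b (pd a (g i1 j i1)) p)
     + (j == k)%:R * (pd b (pd a (g i0 i i0)) p + pd b (pd a (g i1 i i1)) p)).
Proof.
move=> Up; rewrite (pd_eq _ oU Up (fun q => @pd_thomas a i j k q)).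
erewrite is_pd_val; last (by pdt); cbv beta.
ring.
Qed.

End Symbols.

Section Jets.
Context {R : realType}.
Local Notation plane := 'rV[R]_2.
Variables (U : set plane) (g : symbols (R := R)) (p : plane).
Hypotheses (oU : open U) (Up : U p) (sg : forall i j k, smooth U (g i j k)).

Lemma pd_Sch a j l : pd a (Sch g j l) p =
  let DRm i j l k := pd a (pd i (g j l k)) p - pd a (pd j (g i l k)) p +
    \sum_m (pd a (g j l m) p * g i m k p + g j l m p * pd a (g i m k) p
          - pd a (g i l m) p * g j m k p - g i l m p * pd a (g j m k) p) in
  2 / 3 * (\sum_i DRm i j l i) + 1 / 3 * (\sum_i DRm i l j i).
Proof.
rewrite /Sch /Ric /Rm /=; erewrite is_pd_val; last (by pdt); cbv beta.
rewrite !sum2; ring.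
Qed.
End Jets.

(** * Projective invariance of the Liouville tensor *)

Section Invariance.
Context {R : realType}.
Local Notation plane := 'rV[R]_2.
Variables (U : set plane) (g : symbols (R := R)) (p : plane).
Hypotheses (oU : open U) (Up : U p) (sg : forall i j k, smooth U (g i j k)).
Hypothesis symg : forall i j k q, U q -> g i j k q = g j i k q.

(** Both sides are polynomials in the second order jet of [g] at [p]. Once the symmetry of the
    symbols is carried over to their derivatives and mixed derivatives are put in one order, the
    identity is purely algebraic. *)
Lemma Lv_thomas l : Lv (thomas g) l p = Lv g l p.
Proof.
have st := smooth_thomas oU sg.
have S0 k : g i1 i0 k p = g i0 i1 k p by exact: symg.
have S1 a k : pd a (g i1 i0 k) p = pd a (g i0 i1 k) p.
  by apply: pd_eq (oU) (Up) _ => q Uq; exact: symg.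
have S2 b a k : pd b (pd a (g i1 i0 k)) p = pd b (pd a (g i0 i1 k)) p.
  apply: pd_eq (oU) (Up) _ => q Uq; apply: pd_eq (oU) (Uq) _ => r Ur; exact: symg.
have C i j k : pd i1 (pd i0 (g i j k)) p = pd i0 (pd i1 (g i j k)) p.
  exact: pdC oU Up _.
rewrite /Lv !(pd_Sch Up sg) !(pd_Sch Up st) /Sch /Ric /Rm !sum2 /=.
rewrite !(pd2_thomas oU sg)// !(pd_thomas sg _ _ _ _ Up) /thomas /tr_symbols !sum2.
case: (ord2P l) => -> /=.
  rewrite ?S2 ?S1 ?S0 ?C.
  ring.
rewrite ?S2 ?S1 ?S0 ?C.
ring.
Qed.
End Invariance.

(** * Coordinate formulas for curvature, Ricci and Liouville tensors *)

Section Tensor.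
Context {R : realType}.
Local Notation plane := 'rV[R]_2.
Variables (U : set plane) (oU : open U) (G : connection R).
Hypothesis sG : forall i j, smooth U (G i j).

Definition christoffel (H : connection R) : symbols := fun i j k q => H i j q 0 k.
Local Notation g := (christoffel G).
Implicit Types X Y Z : plane -> plane.

Definition nab (x y : 'I_2 -> plane -> R) k q :=
  \sum_i x i q * pd i (y k) q + \sum_i \sum_j x i q * y j q * g i j k q.

Lemma rowB (u v : plane) k : (u - v) 0 k = u 0 k - v 0 k.
Proof. by rewrite !mxE. Qed.

Lemma nabE x y k q : nab x y k q =
  \sum_i x i q * pd i (y k) q + \sum_i \sum_j x i q * y j q * g i j k q.
Proof. by []. Qed.

Local Notation co X := (fun i q => X q 0 i).

Lemma smooth_christoffel i j k : smooth U (g i j k).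
Proof. exact: smooth_coord. Qed.

Lemma smooth_nab (x y : 'I_2 -> plane -> R) k : (forall i, smooth U (x i)) ->
  (forall i, smooth U (y i)) -> smooth U (nab x y k).
Proof.
move=> sx sy; have sg := smooth_christoffel; rewrite /nab; smt.
Qed.

Lemma derive_row X p v k : differentiable X p ->
  'D_v X p 0 k = \sum_i v 0 i * pd i (co X k) p.
Proof.
move=> dX; rewrite derive_coord ?sum2 ?derive_pd//; last exact: diff_derivable.
exact: differentiable_coord_fun.
Qed.

Lemma nablaE X Y p k : differentiable Y p ->
  nabla G X Y p 0 k = nab (co X) (co Y) k p.
Proof.
move=> dY; rewrite /nabla mxE derive_row// /nab; congr (_ + _).
by rewrite summxE; apply: eq_bigr => i _; rewrite summxE; apply: eq_bigr => j _; rewrite mxE.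
Qed.

Lemma smooth_nabla X Y : smooth U X -> smooth U Y -> smooth U (nabla G X Y).
Proof.
move=> sX sY; apply: smooth_row => // k.
apply: (smooth_eq oU (f := nab (co X) (co Y) k)).
  by move=> p Up; rewrite nablaE//; exact: smooth_diff sY Up.
by apply: smooth_nab => i; exact: smooth_coord.
Qed.

Lemma lie_bracketE X Y p k : differentiable X p -> differentiable Y p ->
  lie_bracket X Y p 0 k = \sum_i (X p 0 i * pd i (co Y k) p - Y p 0 i * pd i (co X k) p).
Proof. by move=> dX dY; rewrite /lie_bracket !mxE !derive_row// sumrB. Qed.

Lemma eq_nab x x' y y' k p : U p -> (forall i, x i p = x' i p) ->
  (forall i q, U q -> y i q = y' i q) -> nab x y k p = nab x' y' k p.
Proof.
move=> Up ex ey; rewrite /nab; congr (_ + _); apply: eq_bigr => i _; rewrite ex.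
  by congr (_ * _); exact: pd_eq oU Up (ey k).
by apply: eq_bigr => j _; rewrite ey.
Qed.

Lemma pd_nab x y a k p : U p -> (forall i, smooth U (x i)) -> (forall i, smooth U (y i)) ->
  pd a (nab x y k) p = \sum_i (pd a (x i) p * pd i (y k) p + x i p * pd a (pd i (y k)) p)
   + \sum_i \sum_j (pd a (x i) p * y j p * g i j k p + x i p * pd a (y j) p * g i j k p
      + x i p * y j p * pd a (g i j k) p).
Proof.
move=> Up sx sy; have sg := smooth_christoffel.
rewrite /nab; erewrite is_pd_val; last (by pdt); cbv beta.
rewrite !sum2; ring.
Qed.

(** This is where tensoriality appears: the second derivatives of [Z] cancel by symmetry, and the
    first derivatives of [X] and [Y] are absorbed by the Lie bracket. *)
Lemma curvatureE X Y Z p k : U p -> smooth U X -> smooth U Y -> smooth U Z ->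
  curvature G X Y Z p 0 k =
  \sum_i \sum_j \sum_l X p 0 i * Y p 0 j * Z p 0 l * Rm g i j l k p.
Proof.
move=> Up sX sY sZ.
have cs (W : plane -> plane) : smooth U W -> forall i, smooth U (co W i) by move=> sW i; exact: smooth_coord.
have dW (W : plane -> plane) q : smooth U W -> U q -> differentiable W q by exact: smooth_diff.
have E X' Y' Z' : smooth U X' -> smooth U Y' -> smooth U Z' ->
    nabla G X' (nabla G Y' Z') p 0 k = nab (co X') (nab (co Y') (co Z')) k p.
  move=> sX' sY' sZ'; rewrite nablaE; last by apply: dW => //; exact: smooth_nabla.
  by apply: eq_nab => // i q Uq; rewrite nablaE//; exact: dW.
rewrite /curvature !rowB (E X Y Z sX sY sZ) (E Y X Z sY sX sZ) nablaE; last exact: dW.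
have C i j : pd i (pd j (co Z k)) p = pd j (pd i (co Z k)) p by apply: (pdC _ _ oU Up); exact: cs.
rewrite (nabE (co (lie_bracket X Y))); cbv beta.
rewrite !sum2 !lie_bracketE; try exact: dW.
rewrite !nabE !sum2 !pd_nab; try exact: cs; try exact: Up.
rewrite !nabE !sum2 /Rm (C i1 i0) !sum2.
ring.
Qed.
Lemma pd_bilinear (y z : 'I_2 -> plane -> R) (S : 'I_2 -> 'I_2 -> plane -> R) i p :
  U p -> (forall j, smooth U (y j)) -> (forall j, smooth U (z j)) ->
  (forall j l, smooth U (S j l)) ->
  pd i (fun q => \sum_j \sum_l y j q * z l q * S j l q) p =
  \sum_j \sum_l (pd i (y j) p * z l p * S j l p +
    y j p * pd i (z l) p * S j l p + y j p * z l p * pd i (S j l) p).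
Proof.
move=> Up sy sz sS; erewrite is_pd_val; last (by pdt); cbv beta; rewrite !sum2; ring.
Qed.

Lemma trace_lin1 (f : plane -> plane) : \tr (lin1_mx f) = \sum_i f (delta_mx 0 i) 0 i.
Proof. by apply: eq_bigr => i _; rewrite mxE. Qed.

Lemma ricciE X Y p : U p -> smooth U X -> smooth U Y ->
  ricci G X Y p = \sum_j \sum_l X p 0 j * Y p 0 l * Ric g j l p.
Proof.
move=> Up sX sY; rewrite /ricci trace_lin1.
have se i : smooth U (cst (delta_mx 0 i) : plane -> plane) by exact: smooth_cst.
rewrite (eq_bigr _ (fun i _ => curvatureE i Up (se i) sX sY)) !sum2.
rewrite /Ric !sum2 !mxE/=; ring.
Qed.

Lemma schoutenE X Y p : U p -> smooth U X -> smooth U Y ->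
  schouten G X Y p = \sum_j \sum_l X p 0 j * Y p 0 l * Sch g j l p.
Proof.
move=> Up sX sY; rewrite /schouten (ricciE Up sX sY) (ricciE Up sY sX) /Sch !sum2; ring.
Qed.

Lemma smooth_Sch j l : smooth U (Sch g j l).
Proof. have sg := smooth_christoffel; rewrite /Sch /Ric /Rm; smt. Qed.

Lemma nabla_schoutenE X Y Z p : U p -> smooth U X -> smooth U Y -> smooth U Z ->
  nabla_schouten G X Y Z p = \sum_i \sum_j \sum_l X p 0 i * Y p 0 j * Z p 0 l *
    (pd i (Sch g j l) p - \sum_m (g i j m p * Sch g m l p + g i l m p * Sch g j m p)).
Proof.
move=> Up sX sY sZ; rewrite /nabla_schouten.
have sS := smooth_Sch.
have cY i : smooth U (co Y i) by exact: smooth_coord.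
have cZ i : smooth U (co Z i) by exact: smooth_coord.
rewrite (schoutenE Up (smooth_nabla sX sY) sZ) (schoutenE Up sY (smooth_nabla sX sZ)).
pose F q := \sum_j \sum_l Y q 0 j * Z q 0 l * Sch g j l q.
have sF : smooth U F by rewrite /F; smt.
rewrite (near_eq_derive (g := F)); last first.
  by apply: filterS (open_near oU Up) => q Uq; exact: schoutenE.
rewrite (derive_pd _ (smooth_diff sF Up)).
have dF i : pd i F p = \sum_j \sum_l (pd i (co Y j) p * Z p 0 l * Sch g j l p +
    Y p 0 j * pd i (co Z l) p * Sch g j l p + Y p 0 j * Z p 0 l * pd i (Sch g j l) p).
  exact: (pd_bilinear (S := Sch g)).
rewrite !dF !sum2 !nablaE; try by apply: smooth_diff Up.
rewrite !nabE !sum2; cbv beta; ring.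
Qed.

Lemma liouvilleE X Y Z p : (forall i j k q, U q -> g i j k q = g j i k q) ->
  U p -> smooth U X -> smooth U Y -> smooth U Z ->
  liouville G X Y Z p = (X p 0 i0 * Y p 0 i1 - X p 0 i1 * Y p 0 i0) *
    \sum_l Z p 0 l * Lv g l p.
Proof.
move=> symg Up sX sY sZ; rewrite /liouville (nabla_schoutenE Up sX sY sZ) (nabla_schoutenE Up sY sX sZ) /Lv !sum2.
rewrite !(symg i1 i0 _ p)//; ring.
Qed.

End Tensor.

(** * The inverse function theorem in the plane *)

Section Norm.
Context {R : realType}.
Local Notation plane := 'rV[R]_2.

Lemma norm_coord n (u : 'rV[R]_n) i : `|u 0 i| <= `|u|.
Proof. by rewrite [leRHS]/Num.norm/= mx_normrE; exact: (le_bigmax _ _ (ord0, i)). Qed.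

Lemma norm_row_le n (u : 'rV[R]_n) c : 0 <= c -> (forall i, `|u 0 i| <= c) -> `|u| <= c.
Proof.
move=> c0 H; rewrite [leLHS]/Num.norm/= mx_normrE bigmax_le//= => -[i j] _.
by rewrite (ord1 i); exact: H.
Qed.

Definition lin2 (a b : R) (h : plane) : R := h 0 i0 * a + h 0 i1 * b.

Lemma lin2_is_linear a b : linear (lin2 a b).
Proof. by move=> k u v; rewrite /lin2 !mxE /GRing.scale/=; ring. Qed.

HB.instance Definition _ a b := GRing.isLinear.Build R plane R _ (lin2 a b) (lin2_is_linear a b).

Lemma lin2_continuous a b : continuous (lin2 a b).
Proof.
have sc i : smooth setT (fun h : plane => h 0 i).
  exact: (smooth_coord i openT (@smooth_id R plane setT)).
have sl : smooth setT (lin2 a b).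
  by apply: smoothD openT _ _; apply: smoothM openT _ _ => //; exact: smooth_cst.
by move=> p; exact: (sl 0%N p I).
Qed.

Lemma diff_eps (V W : normedModType R) (f : V -> W) p (L : {linear V -> W}) : continuous L ->
  (forall e, 0 < e -> \forall h \near (0 : V), `|f (h + p) - f p - L h| <= e * `|h|) ->
  differentiable f p /\ forall v, 'D_v f p = L v.
Proof.
move=> cL fL.
have df : differentiable f p by apply/differentiable_epsP; exists L.
split=> // v; rewrite deriveE//.
have -> // : 'd f p = L :> (V -> W).
apply: diff_unique => //.
apply/eqaddoP => e e0; apply: filterS (fL e e0) => h /=.
by rewrite !fctE /= opprD addrA.
Qed.

Lemma diff_eps2 (f : plane -> R) p a b :
  (forall e, 0 < e -> \forall h \near (0 : plane),
     `|f (h + p) - f p - (h 0 i0 * a + h 0 i1 * b)| <= e * `|h|) ->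
  differentiable f p /\ forall v, 'D_v f p = v 0 i0 * a + v 0 i1 * b.
Proof. by move=> H; apply: (@diff_eps _ _ f p (lin2 a b)) => //; exact: lin2_continuous. Qed.

Lemma diff2_eps (f : plane -> R) p : differentiable f p -> forall e, 0 < e ->
  exists2 d : R, 0 < d & forall s : plane, `|s| < d ->
    `|f (p + s) - f p - (s 0 i0 * pd i0 f p + s 0 i1 * pd i1 f p)| <= e * `|s|.
Proof.
move=> df e e0; have [L cL fL] := (differentiable_epsP f p).1 df.
have [_ DL] := diff_eps cL fL.
have [d d0 H] := nbhs_norm_ex (fL e e0).
exists d => // s sd; rewrite -derive_pd// DL [p + s]addrC; apply: H.
by rewrite subr0.
Qed.

Lemma ball_convex (V : normedModType R) (p x y : V) (r t : R) : t \in `[0, 1] ->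
  `|x - p| < r -> `|y - p| < r -> `|y + t *: (x - y) - p| < r.
Proof.
rewrite in_itv/= => /andP[t0 t1] xr yr.
have -> : y + t *: (x - y) - p = (1 - t) *: (y - p) + t *: (x - p).
  have -> : x - y = (x - p) - (y - p) by rewrite opprB addrA subrK.
  by rewrite addrAC [in LHS]scalerBr scalerBl scale1r addrA addrAC.
apply: le_lt_trans (ler_normD _ _) _; rewrite !normrZ !ger0_norm ?subr_ge0//.
have [->|tn0] := eqVneq t 0; first by rewrite subr0 mul1r mul0r addr0.
have t0' : 0 < t by rewrite lt_def tn0.
have -> : r = (1 - t) * r + t * r by ring.
rewrite ler_ltD ?ltr_pM2l//.
by rewrite ler_wpM2l ?subr_ge0// ltW.
Qed.

(** The norm of the plane is the maximum norm, so each of the two coordinates contributes [K] times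
    the norm of [x - y]. The constants of the later estimates arise in the same way. *)
Lemma mvt_ball (f : plane -> R) p (r K : R) :
  (forall q, `|q - p| < r -> differentiable f q) ->
  (forall q i, `|q - p| < r -> `|pd i f q| <= K) ->
  forall x y, `|x - p| < r -> `|y - p| < r -> `|f x - f y| <= 2 * K * `|x - y|.
Proof.
move=> df dK x y xr yr.
have [|t t01] := @MVT_line _ _ f y (x - y) 1 ltr01.
  by move=> t t01; apply: df; exact: ball_convex.
rewrite scale1r mul1r [y + (x - y)]addrC subrK => ->.
have B : `|y + t *: (x - y) - p| < r by apply: ball_convex => //; exact: subset_itv_oo_cc t01.
rewrite derive_pd; last exact: df.
apply: le_trans (ler_normD _ _) _; rewrite !normrM.
have -> : 2 * K * `|x - y| = `|x - y| * K + `|x - y| * K by ring.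
by apply: lerD; apply: ler_pM => //; try exact: norm_coord; exact: dK.
Qed.

End Norm.

Section PlaneMaps.
Context {R : realType}.
Local Notation plane := 'rV[R]_2.

Definition mk2 (a b : R) : plane := \row_j (if j == i0 then a else b).

Lemma mk2_0 a b : mk2 a b 0 i0 = a. Proof. by rewrite mxE. Qed.
Lemma mk2_1 a b : mk2 a b 0 i1 = b. Proof. by rewrite mxE. Qed.

Lemma plane_eqP (u v : plane) : u 0 i0 = v 0 i0 -> u 0 i1 = v 0 i1 -> u = v.
Proof. by move=> e0 e1; apply/rowP => i; case: (ord2P i) => ->. Qed.

Lemma norm_plane_le (u : plane) c : `|u 0 i0| <= c -> `|u 0 i1| <= c -> `|u| <= c.
Proof.
move=> u0 u1; apply: norm_row_le; first exact: le_trans u0.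
by move=> i; case: (ord2P i) => ->.
Qed.

Lemma open_normP (V : normedModType R) (A : set V) :
  (forall x, A x -> exists2 d : R, 0 < d & forall y, `|y - x| < d -> A y) -> open A.
Proof.
move=> H; rewrite openE => x /H[d d0 dA]; apply/nbhs_normP; exists d => // y /= xy.
by apply: dA; rewrite distrC.
Qed.

Lemma smooth_coordinate (U : set plane) i : open U -> smooth U (fun q : plane => q 0 i).
Proof. by move=> oU; exact: (smooth_coord i oU (@smooth_id R plane U)). Qed.

Lemma pd_coordinate (p : plane) i j : pd j (fun q : plane => q 0 i) p = (i == j)%:R.
Proof.
rewrite -pdE; have -> : (fun q : plane => q 0 i) = lin2 (i == i0)%:R (i == i1)%:R.
  by apply/funext => q; rewrite /lin2; case: (ord2P i) => ->; rewrite ?mulr1 ?mulr0 ?addr0 ?add0r.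
rewrite derive_lin; last exact: lin2_continuous.
rewrite /= /lin2 !mxE; case: (ord2P i) => ->; case: (ord2P j) => -> /=;
by rewrite ?mulr1 ?mulr0 ?addr0 ?add0r.
Qed.

Definition jac (f h : plane -> R) q := pd i0 f q * pd i1 h q - pd i1 f q * pd i0 h q.

Lemma smooth_jac (U : set plane) f h : open U -> smooth U f -> smooth U h -> smooth U (jac f h).
Proof. by move=> oU sf sh; rewrite /jac; smt. Qed.

End PlaneMaps.

Section InverseFunction.
Context {R : realType}.
Local Notation plane := 'rV[R]_2.
Variables (phi : plane -> plane) (p : plane).
Let f q := phi q 0 i0.
Let h q := phi q 0 i1.
Let a := pd i0 f p.
Let b := pd i1 f p.
Let c := pd i0 h p.
Let d := pd i1 h p.
Let D := a * d - b * c.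
(** The inverse of the differential of [phi] at [p], by Cramer's rule. Composed with it, [phi]
    becomes the map [T], a small perturbation of the identity, and [e] collects the coordinates of
    the perturbation. *)
Let L (y : plane) : plane :=
  mk2 ((d * y 0 i0 - b * y 0 i1) / D) ((a * y 0 i1 - c * y 0 i0) / D).
Let T q := L (phi q).
Let e i q := T q 0 i - q 0 i.

Variable (r : R).
Hypotheses (r0 : 0 < r) (Jp : D != 0).
Let B := [set q : plane | `|q - p| < r].
Hypotheses (sphi : smooth B phi) (de : forall q i j, B q -> `|pd j (e i) q| <= 1 / 8).
Hypothesis (Jn0 : forall q, B q -> jac f h q != 0).

Let oB : open B.
Proof.
apply: open_normP => x Bx; exists (r - `|x - p|); first by rewrite subr_gt0.
move=> y xy; rewrite /B/= -(subrK x y) -addrA; apply: le_lt_trans (ler_normD _ _) _.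
by rewrite -ltrBrDr.
Qed.

Let sf : smooth B f. Proof. exact: smooth_coord. Qed.
Let sh : smooth B h. Proof. exact: smooth_coord. Qed.
Let se i : smooth B (e i).
Proof.
have sx j : smooth B (fun q : plane => q 0 j) by exact: smooth_coordinate.
rewrite /e; apply: smoothB => //.
case: (ord2P i) => ->.
  apply: (smooth_eq oB (f := fun q => (d * f q - b * h q) * D^-1)); last by smt.
  by move=> q _; rewrite /T /L mk2_0.
apply: (smooth_eq oB (f := fun q => (a * h q - c * f q) * D^-1)); last by smt.
by move=> q _; rewrite /T /L mk2_1.
Qed.

Let E (q : plane) : plane := T q - q.

(** The factor 2 of [mvt_ball] turns the bound [1 / 8] into the Lipschitz constant [1 / 4]. Hence
    [T] shrinks distances at most by the factor [3 / 4], which is injectivity and the Lipschitz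
    bound for the inverse. *)
Let E_lip x y : B x -> B y -> `|E x - E y| <= 1 / 4 * `|x - y|.
Proof.
move=> Bx By.
have H i : `|e i x - e i y| <= 1 / 4 * `|x - y|.
  have -> : 1 / 4 = 2 * (1 / 8) :> R by field.
  apply: (@mvt_ball _ (e i) p r) => // q.
    by move=> Bq; exact: smooth_diff (se i) _.
  by move=> j Bq; exact: de.
have C i : (E x - E y) 0 i = e i x - e i y by rewrite /E /e !mxE.
by apply: norm_plane_le; rewrite C.
Qed.

Let T_expand x y : B x -> B y -> `|x - y| <= 4 / 3 * `|T x - T y|.
Proof.
move=> Bx By; have := E_lip Bx By.
have : `|x - y| <= `|T x - T y| + `|E x - E y|.
  have -> : x - y = (T x - T y) - (E x - E y).
    rewrite /E; apply/rowP => i; rewrite !mxE; ring.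
  exact: ler_normB.
lra.
Qed.

Let T_lip x y : B x -> B y -> `|T x - T y| <= 2 * `|x - y|.
Proof.
move=> Bx By; have := E_lip Bx By; have := normr_ge0 (x - y).
have : `|T x - T y| <= `|x - y| + `|E x - E y|.
  have -> : T x - T y = (x - y) + (E x - E y).
    rewrite /E; apply/rowP => i; rewrite !mxE; ring.
  exact: ler_normD.
lra.
Qed.

Let L_inj y z : L y = L z -> y = z.
Proof.
move=> /rowP Lyz; have := Lyz i0; have := Lyz i1; rewrite /L !mk2_0 !mk2_1.
have Dinv : D^-1 != 0 by rewrite invr_eq0.
move=> /(mulIf Dinv) E1 /(mulIf Dinv) E0.
apply: plane_eqP; apply: (mulfI Jp).
  have -> : D * y 0 i0 = a * (d * y 0 i0 - b * y 0 i1) + b * (a * y 0 i1 - c * y 0 i0).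
    by rewrite /D; ring.
  by rewrite E1 E0 /D; ring.
have -> : D * y 0 i1 = c * (d * y 0 i0 - b * y 0 i1) + d * (a * y 0 i1 - c * y 0 i0).
  by rewrite /D; ring.
by rewrite E1 E0 /D; ring.
Qed.

Let Lc := (`|a| + `|b| + `|c| + `|d|) / `|D|.

Let Lc_ge0 : 0 <= Lc. Proof. by rewrite divr_ge0// !addr_ge0. Qed.

Let L_lip y z : `|L y - L z| <= Lc * `|y - z|.
Proof.
have H (k l : R) i j : `|k| + `|l| <= `|a| + `|b| + `|c| + `|d| ->
    `|(k * (y - z) 0 i - l * (y - z) 0 j) / D| <= Lc * `|y - z|.
  move=> kl; rewrite normrM normfV /Lc mulrAC ler_wpM2r ?invr_ge0//.
  apply: le_trans (ler_normB _ _) _; rewrite !normrM.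
  apply: le_trans (_ : (`|k| + `|l|) * `|y - z| <= _); last by rewrite ler_wpM2r.
  by rewrite mulrDl lerD// ler_wpM2l// norm_coord.
have := (normr_ge0 a, normr_ge0 b, normr_ge0 c, normr_ge0 d) => -[[[na nb] nc] nd].
apply: norm_plane_le.
  have -> : (L y - L z) 0 i0 = (d * (y - z) 0 i0 - b * (y - z) 0 i1) / D.
    by rewrite /L !mxE/=; ring.
  apply: H; lra.
have -> : (L y - L z) 0 i1 = (a * (y - z) 0 i1 - c * (y - z) 0 i0) / D.
  by rewrite /L !mxE/=; ring.
apply: H; lra.
Qed.

Let Bp : B p. Proof. by rewrite /B/= subrr normr0. Qed.

Let T_surj z : `|z - T p| < r / 4 -> exists2 x, `|x - p| < r / 2 & T x = z.
Proof.
move=> zr.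
pose K := [set x : plane | `|p - x| <= r / 2].
have KB x : K x -> B x by move: r0; rewrite /K /B/= [`|p - x|]distrC; lra.
have cK : compact K.
  apply: bounded_closed_compact; last exact: closed_closed_ball_.
  exists (`|p| + r / 2); split; first exact: num_real.
  move=> M pM x /= Kx; apply: le_trans (ltW pM).
  have -> : x = p - (p - x) by rewrite opprB addrC subrK.
  by apply: le_trans (ler_normB _ _) _; rewrite lerD2l.
have Kp : K p by rewrite /K/= subrr normr0 divr_ge0// ltW.
have sT : smooth B T.
  apply: smooth_row => // j; apply: (smooth_eq oB (f := fun q => e j q + q 0 j)).
    by move=> q _; rewrite /e subrK.
  by apply: smoothD => //; exact: smooth_coordinate.
have cT : {within K, continuous (fun x => `|T x - z|)}.
  apply: continuous_in_subspaceT => x; rewrite inE => /KB Bx.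
  apply: (@continuous_comp _ _ _ (fun x => T x - z) Num.norm); last exact: norm_continuous.
  exact: (smoothB oB sT (smooth_cst B z) 0%N x Bx).
(* At a minimum [x] of [|T x - z|] the contraction step [x - (T x - z)] cannot
   decrease the distance, hence [T x = z]. *)
have [x xK xmin] := EVT_min_rV (ex_intro _ p Kp) cK cT.
rewrite inE in xK.
pose w := T x - z.
have Bx := KB _ xK.
have Kg : K (x - w).
  have := E_lip Bx Bp => Exp.
  have -> : x - w = p + ((z - T p) - (E x - E p)).
    rewrite /E /w; apply/rowP => i; rewrite !mxE; ring.
  rewrite /K/= opprD addrA subrr add0r normrN.
  have := ler_normB (z - T p) (E x - E p).
  have : `|x - p| <= r / 2 by rewrite distrC.
  move: zr r0 Exp; lra.
have := xmin _ (mem_set Kg).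
have -> : T (x - w) - z = E (x - w) - E x.
  by rewrite /E /w; apply/rowP => i; rewrite !mxE; ring.
have := E_lip (KB _ Kg) Bx; have -> : x - w - x = - w by rewrite addrAC subrr add0r.
rewrite normrN -/w => H1 H2.
have w0 : w = 0 by apply/eqP; rewrite -normr_le0; have := normr_ge0 w; lra.
have Tx : T x = z by apply/eqP; rewrite -subr_eq0 -/w w0.
exists x => //; have := T_expand Bx Bp; rewrite Tx; move: zr r0; lra.
Qed.

(** A preimage chosen in the half ball, with the arbitrary value 0 where there is none. [V'] is the
    set on which [T_surj] applies to [L y], and injectivity of [L] turns [T x = L y] into
    [phi x = y]. *)
Let psi (y : plane) : plane := xget 0 [set x | `|x - p| < r / 2 /\ phi x = y].
Let V' := [set y | `|L y - T p| < r / 4].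
Let V := [set x | `|x - p| < r / 2 /\ `|T x - T p| < r / 4].

Let half_B x : `|x - p| < r / 2 -> B x.
Proof. by rewrite /B/=; move: r0; lra. Qed.

Let psiP y : V' y -> `|psi y - p| < r / 2 /\ phi (psi y) = y.
Proof.
move=> /T_surj[x xr /L_inj Tx].
by have := @xgetPex _ 0 [set x | `|x - p| < r / 2 /\ phi x = y]; apply; exists x.
Qed.

Let psi_B y : V' y -> B (psi y).
Proof. by move=> /psiP[/half_B]. Qed.

Let psiK x : V x -> V' (phi x) /\ psi (phi x) = x.
Proof.
move=> [xr Tx]; have V'x : V' (phi x) by [].
split=> //; have [pr E1] := psiP V'x.
have := T_expand (half_B pr) (half_B xr); rewrite {1}/T E1 subrr normr0 mulr0.
by rewrite normr_le0 subr_eq0 => /eqP.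
Qed.

Let psiV y : V' y -> V (psi y) /\ phi (psi y) = y.
Proof. by move=> V'y; have [pr E1] := psiP V'y; split=> //; split=> //; rewrite /T E1. Qed.

Let oV' : open V'.
Proof.
apply: open_normP => y yV; pose q := `|L y - T p|; pose K := Lc + 1.
have K0 : 0 < K by rewrite /K ltr_wpDl.
exists ((r / 4 - q) / K); first by rewrite divr_gt0// subr_gt0.
move=> z; rewrite ltr_pdivlMr// => zy; rewrite /V'/=.
have -> : L z - T p = (L z - L y) + (L y - T p) by rewrite addrA subrK.
have := ler_normD (L z - L y) (L y - T p); have := L_lip z y.
have : Lc * `|z - y| <= `|z - y| * K by rewrite mulrC ler_wpM2l// /K lerDl.
move: zy; rewrite /q; lra.
Qed.

Let oV : open V.
Proof.
apply: open_normP => x [xr Tx]; have Bx := half_B xr.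
exists (Num.min (r / 2 - `|x - p|) ((r / 4 - `|T x - T p|) / 2)).
  by rewrite lt_min subr_gt0 xr divr_gt0// subr_gt0.
move=> y; rewrite lt_min => /andP[y1 y2].
have yr : `|y - p| < r / 2.
  have -> : y - p = (y - x) + (x - p) by rewrite addrA subrK.
  by have := ler_normD (y - x) (x - p); lra.
split=> //; have := T_lip (half_B yr) Bx.
have -> : T y - T p = (T y - T x) + (T x - T p) by rewrite addrA subrK.
have := ler_normD (T y - T x) (T x - T p); lra.
Qed.

Let psi_lip y z : V' y -> V' z -> `|psi y - psi z| <= 4 / 3 * Lc * `|y - z|.
Proof.
move=> yV zV; have := T_expand (psi_B yV) (psi_B zV).
have [_ E1] := psiP yV; have [_ E2] := psiP zV; rewrite /T E1 E2.
have := L_lip y z; lra.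
Qed.

(** The derivative is the inverse Jacobian matrix at [psi y]. Cramer's rule, applied to the first
    order expansions of [f] and [h], expresses the error for a coordinate of [psi] as a combination
    of their two remainders; [al] and [be] are the coefficients. The Lipschitz bound on [psi] makes
    it small against the increment of [y]. *)
Let psi_diff y : V' y ->
  let x := psi y in let j := jac f h x in
  (differentiable (fun z => psi z 0 i0) y /\
   forall v, 'D_v (fun z => psi z 0 i0) y = v 0 i0 * (pd i1 h x / j) + v 0 i1 * (- pd i1 f x / j)) /\
  (differentiable (fun z => psi z 0 i1) y /\
   forall v, 'D_v (fun z => psi z 0 i1) y = v 0 i0 * (- pd i0 h x / j) + v 0 i1 * (pd i0 f x / j)).
Proof.
move=> yV x j; have Bx : B x := psi_B yV.
have j0 : j != 0 by exact: Jn0.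
have df := smooth_diff sf Bx; have dh := smooth_diff sh Bx.
have [phix_r phix] := psiP yV; rewrite -/x in phix.
have main al be ep : 0 < ep -> \forall k \near (0 : plane), let s := psi (k + y) - x in
   `|((k 0 i0 - (s 0 i0 * pd i0 f x + s 0 i1 * pd i1 f x)) * al
     - (k 0 i1 - (s 0 i0 * pd i0 h x + s 0 i1 * pd i1 h x)) * be) / j| <= ep * `|k|.
  (* [M] absorbs the size of the coefficients [al / j], [be / j] and the Lipschitz constant of
     [psi]; the summand 1 makes it positive. *)
  move=> ep0; pose M := (`|al| + `|be|) / `|j| * (4 / 3 * Lc) + 1.
  have M0 : 0 < M.
    by rewrite /M ltr_wpDl// mulr_ge0 ?divr_ge0 ?addr_ge0// mulr_ge0.
  have e'0 : 0 < ep / M by rewrite divr_gt0.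
  have [d1 d10 H1] := diff2_eps df e'0.
  have [d2 d20 H2] := diff2_eps dh e'0.
  have [d3 d30 H3] := nbhs_norm_ex (open_near oV' yV).
  pose C := 4 / 3 * Lc + 1.
  have C0 : 0 < C by rewrite /C ltr_wpDl// mulr_ge0.
  apply/nbhs_normP; exists (Num.min d3 (Num.min d1 d2 / C)).
    by rewrite /= lt_min d30 divr_gt0// lt_min d10.
  move=> k /=; rewrite sub0r normrN lt_min => /andP[k3 kC]; set s := psi (k + y) - x.
  have V'k : V' (k + y) by apply: H3; rewrite addrK.
  have sk : `|s| <= 4 / 3 * Lc * `|k|.
    by have := psi_lip V'k yV; rewrite addrK.
  have sk' : `|s| < Num.min d1 d2.
    apply: le_lt_trans sk _; rewrite ltr_pdivlMr// mulrC in kC.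
    by apply: le_lt_trans kC; rewrite ler_wpM2r// /C lerDl.
  move: sk'; rewrite lt_min => /andP[sd1 sd2].
  have xs : x + s = psi (k + y) by rewrite /s addrC subrK.
  have [_ phixs] := psiP V'k.
  have := H1 _ sd1; have := H2 _ sd2; rewrite xs.
  have -> : f (psi (k + y)) - f x = k 0 i0 by rewrite /f phixs phix mxE addrK.
  have -> : h (psi (k + y)) - h x = k 0 i1 by rewrite /h phixs phix mxE addrK.
  move: (k 0 i0 - _) (k 0 i1 - _) => o1 o2 o2s o1s.
  rewrite normrM normfV ler_pdivrMr ?normr_gt0//.
  apply: le_trans (ler_normB _ _) _; rewrite !normrM.
  apply: le_trans (_ : ep / M * `|s| * (`|al| + `|be|) <= _).
    by rewrite mulrDr lerD// ler_wpM2r.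
  have -> : ep * `|k| * `|j| = ep / M * (M * `|j| * `|k|).
    by field; rewrite gt_eqF.
  rewrite -mulrA ler_wpM2l//; first exact: ltW.
  have -> : M * `|j| * `|k| = (4 / 3 * Lc * `|k|) * (`|al| + `|be|) + `|j| * `|k|.
    by rewrite /M; field; rewrite normr_eq0.
  apply: le_trans (_ : 4 / 3 * Lc * `|k| * (`|al| + `|be|) <= _); last by rewrite lerDl mulr_ge0.
  by rewrite ler_wpM2r// addr_ge0.
split; apply: diff_eps2 => ep ep0.
  apply: filterS (main (pd i1 h x) (pd i1 f x) ep ep0) => k /=.
  rewrite -(normrN (_ / j)); congr (`|_| <= _).
  by rewrite !mxE -/x /j /jac; field.
apply: filterS (main (- pd i0 h x) (- pd i0 f x) ep ep0) => k /=.
rewrite -(normrN (_ / j)); congr (`|_| <= _).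
by rewrite !mxE -/x /j /jac; field.
Qed.

(** Bootstrapping: the derivatives of [psi] are smooth functions of [psi] itself, so each class of
    differentiability implies the next. *)
Let psi_Ck n : Ck n V' psi.
Proof.
have dpsi y : V' y -> differentiable psi y.
  move=> /psi_diff[[d0 _] [d1 _]]; apply/differentiable_mxP => i j; rewrite (ord1 i).
  by case: (ord2P j) => ->.
elim: n => [|n IH]; first by move=> y /dpsi; exact: differentiable_continuous.
split=> // v; apply/(Ck_mxP _ _ oV') => i j; rewrite (ord1 i).
have sj : smooth B (fun q => (jac f h q)^-1).
  by apply: smoothV => //; exact: smooth_jac.
have mapB y : V' y -> B (psi y) by exact: psi_B.
case: (ord2P j) => ->.
  have sG : smooth B (fun q => v 0 i0 * (pd i1 h q * (jac f h q)^-1) + v 0 i1 * (- pd i1 f q * (jac f h q)^-1)).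
    smt.
  apply: Ck_eq (Ck_comp_row oV' oB mapB IH (sG n)) => // y yV.
  have [[d0 D0] _] := psi_diff yV.
  by rewrite derive_coord ?D0//; exact/diff_derivable/dpsi.
have sG : smooth B (fun q => v 0 i0 * (- pd i0 h q * (jac f h q)^-1) + v 0 i1 * (pd i0 f q * (jac f h q)^-1)).
  smt.
apply: Ck_eq (Ck_comp_row oV' oB mapB IH (sG n)) => // y yV.
have [_ [d0 D0]] := psi_diff yV.
by rewrite derive_coord ?D0//; exact/diff_derivable/dpsi.
Qed.

Lemma inverse_function_ball : exists V V' : set plane,
  [/\ V p, V `<=` B & diffeomorphism V V' phi].
Proof.
exists V, V'; split.
- by split; rewrite subrr normr0 divr_gt0.
- by move=> x [/half_B].
split=> //; exists psi; split.
- by apply: sub_smooth sphi => x [/half_B].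
- by move=> n; exact: psi_Ck.
- exact: psiK.
- exact: psiV.
Qed.

End InverseFunction.

Section InverseFunctionTheorem.
Context {R : realType}.
Local Notation plane := 'rV[R]_2.

Theorem inverse_function (U : set plane) (phi : plane -> plane) p :
  open U -> U p -> smooth U phi ->
  jac (fun q => phi q 0 i0) (fun q => phi q 0 i1) p != 0 ->
  exists V V' : set plane, [/\ V p, V `<=` U & diffeomorphism V V' phi].
Proof.
move=> oU Up sphi.
set f := fun q => phi q 0 i0; set h := fun q => phi q 0 i1 => J0.
have sf : smooth U f by exact: smooth_coord.
have sh : smooth U h by exact: smooth_coord.
have sJ := smooth_jac oU sf sh.
pose D := pd i0 f p * pd i1 h p - pd i1 f p * pd i0 h p.
pose T q := mk2 ((pd i1 h p * f q - pd i1 f p * h q) / D)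
  ((pd i0 f p * h q - pd i0 h p * f q) / D).
pose e i (q : plane) := T q 0 i - q 0 i.
have se i : smooth U (e i).
  have sx j : smooth U (fun q : plane => q 0 j) by exact: smooth_coordinate.
  rewrite /e; apply: smoothB => //.
  case: (ord2P i) => ->.
    apply: (smooth_eq oU (f := fun q => (pd i1 h p * f q - pd i1 f p * h q) * D^-1)); last by smt.
    by move=> q _; rewrite /T mk2_0.
  apply: (smooth_eq oU (f := fun q => (pd i0 f p * h q - pd i0 h p * f q) * D^-1)); last by smt.
  by move=> q _; rewrite /T mk2_1.
(* [T] has the identity as its differential at [p], so the bound [1 / 8] holds near [p] by
   continuity. *)
have e0 i j : pd j (e i) p = 0.
  have sx l : smooth U (fun q : plane => q 0 l) by exact: smooth_coordinate.
  have Dn : pd i0 f p * pd i1 h p - pd i1 f p * pd i0 h p != 0 by [].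
  case: (ord2P i) => ->.
    transitivity (pd j (fun q => (pd i1 h p * f q - pd i1 f p * h q) * D^-1 - q 0 i0) p).
      by apply: pd_eq oU Up _ => q _; rewrite /e /T mk2_0.
    have is_x : is_pd j p (fun q : plane => q 0 i0) ((i0 == j)%:R).
      by split; [exact: smooth_diff (sx i0) Up|exact: pd_coordinate].
    erewrite is_pd_val; last first.
      apply: is_pdD; last by apply: is_pdN; exact: is_x.
      apply: is_pdM; last exact: is_pd_cst.
      by apply: is_pdD; [|apply: is_pdN]; apply: is_pdM; try exact: is_pd_cst;
        apply: is_pd_smooth Up _.
    by cbv beta; rewrite /D; case: (ord2P j) => -> /=; field.
  transitivity (pd j (fun q => (pd i0 f p * h q - pd i0 h p * f q) * D^-1 - q 0 i1) p).
    by apply: pd_eq oU Up _ => q _; rewrite /e /T mk2_1.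
  have is_x : is_pd j p (fun q : plane => q 0 i1) ((i1 == j)%:R).
    by split; [exact: smooth_diff (sx i1) Up|exact: pd_coordinate].
  erewrite is_pd_val; last first.
    apply: is_pdD; last by apply: is_pdN; exact: is_x.
    apply: is_pdM; last exact: is_pd_cst.
    by apply: is_pdD; [|apply: is_pdN]; apply: is_pdM; try exact: is_pd_cst;
      apply: is_pd_smooth Up _.
  by cbv beta; rewrite /D; case: (ord2P j) => -> /=; field.
have N1' i j : \forall q \near p, `|pd j (e i) q| <= 1 / 8.
  have e8 : 0 < 1 / 8 :> R by [].
  have := continuous_eps (smooth_pd j (se i) 0%N p Up) e8.
  by apply: filterS => q; rewrite e0 subr0 => /ltW.
have N1 : \forall q \near p, forall i j, `|pd j (e i) q| <= 1 / 8.
  apply: filterS (filterI (filterI (N1' i0 i0) (N1' i0 i1)) (filterI (N1' i1 i0) (N1' i1 i1))).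
  by move=> q [[? ?] [? ?]] i j; case: (ord2P i) => ->; case: (ord2P j) => ->.
have J1 : 0 < `|jac f h p| by rewrite normr_gt0.
have N2 := continuous_eps (sJ 0%N p Up) J1.
have [r r0 H] := nbhs_norm_ex (filterI N1 (filterI N2 (open_near oU Up))).
have BU : [set q : plane | `|q - p| < r] `<=` U by move=> q /H[_ []].
have [V [V' [Vp VB dV]]] : exists V V' : set plane,
    [/\ V p, V `<=` [set q : plane | `|q - p| < r] & diffeomorphism V V' phi].
  apply: (@inverse_function_ball R phi p r r0 J0 (sub_smooth BU sphi)).
    move=> q i j /H[A _]. by have := A i j; rewrite /e /T /D /f /h; exact.
  move=> q /H[_ [Jq _]]; apply/eqP => Jq0.
  by move: Jq; rewrite Jq0 sub0r normrN ltxx.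
by exists V, V'; split=> //; exact: subset_trans BU.
Qed.

End InverseFunctionTheorem.

(** * Linear differential equations *)

Section ODE.
Context {R : realType}.

Lemma antiderivative (f : R -> R) (a b : R) : continuous f ->
  exists F : R -> R, forall t, t \in `]a, b[ -> is_derive t (1 : R) F (f t).
Proof.
move=> cf.
exists (fun x => \int[@lebesgue_measure R]_(t in [set` `[a, x]]) (f t)) => t.
rewrite in_itv/= => /andP[ta tb].
have [|d D] := @continuous_FTC1_closed R f a t b tb _ ta (cf t).
  apply: continuous_compact_integrable; first exact: segment_compact.
  exact: continuous_subspaceT.
exact: DeriveDef d (etrans (esym (derive1E _ t)) D).
Qed.

(** Composition with this retraction extends functions on the unit interval continuously to the
    line, which keeps primitives and two-sided derivatives available at the end points. *)
Definition clamp (t : R) : R := Num.max 0 (Num.min t 1).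

Lemma clamp_in t : clamp t \in `[0, 1].
Proof.
rewrite in_itv/= /clamp le_max lexx/= ge_max ler01/= ge_min lexx orbT//.
Qed.

Lemma clamp_id t : t \in `[0, 1] -> clamp t = t.
Proof.
rewrite in_itv/= /clamp => /andP[t0 t1].
by rewrite (min_idPl t1) (max_idPr t0).
Qed.

Lemma clamp_continuous : continuous clamp.
Proof.
move=> t; rewrite (_ : clamp = ((cst 0 : R -> R^o) \max ((id : R -> R^o) \min (cst 1 : R -> R^o))))//.
have c0 : {for t, continuous (cst 0 : R -> R^o)} by exact: cvg_cst.
have c1 : {for t, continuous (cst 1 : R -> R^o)} by exact: cvg_cst.
have ci : {for t, continuous (id : R -> R^o)} by exact: cvg_id.
exact: continuous_max c0 (continuous_min ci c1).
Qed.

Lemma le_half_pow (x y B : R) : (forall k, x <= y + B / 2 ^+ k) -> x <= y.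
Proof.
move=> H; rewrite leNgt; apply/negP => yx.
have e0 : 0 < x - y by rewrite subr_gt0.
have [B0|B0] := leP B 0.
  by have := H 0%N; rewrite expr0 divr1; lra.
pose k := Num.bound (B / (x - y)).
have : B / (x - y) < 2 ^+ k.
  apply: lt_le_trans (archi_boundP _) _; first by rewrite divr_ge0// ltW.
  rewrite -natrX ler_nat; exact: ltnW (ltn_expl _ _).
have p0 : 0 < 2 ^+ k :> R by rewrite exprn_gt0.
rewrite ltr_pdivrMr// mulrC -ltr_pdivrMr// => H1.
by have := H k; move: H1; lra.
Qed.

Lemma mvt_unit (f df : R -> R) (B : R) : 
  (forall t : R, t \in `[0, 1] -> is_derive t (1 : R) f (df t)) ->
  (forall t, t \in `[0, 1] -> `|df t| <= B) ->
  forall t, t \in `[0, 1] -> `|f t - f 0| <= B.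
Proof.
move=> D dB t; rewrite in_itv/= => /andP[t0 t1].
have B0 : 0 <= B by apply: le_trans (dB 0 _); rewrite ?normr_ge0// in_itv/= lexx ler01.
have [->|tn0] := eqVneq t 0; first by rewrite subrr normr0.
have t0' : 0 < t by rewrite lt_def tn0.
have sub s : s \in `[0, t] -> s \in `[0, 1].
  by rewrite !in_itv/= => /andP[-> /le_trans]; apply.
have [s st ->] := MVT_cc t0' (fun s st => D s (sub s st)).
rewrite subr0 normrM (ger0_norm t0); apply: le_trans (ler_piMr _ t1) _ => //.
by apply: dB; apply: sub; exact: subset_itv_oo_cc st.
Qed.

Lemma is_derive_sum_fun n (f : 'I_n -> R -> R) (df : 'I_n -> R) (t : R) :
  (forall i, is_derive t (1 : R) (f i) (df i)) ->
  is_derive t (1 : R) (fun s => \sum_i f i s) (\sum_i df i).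
Proof.
move=> D; rewrite (_ : (fun s => _) = \sum_i f i); first exact: is_derive_sum.
by apply/funext => s; rewrite fct_sumE.
Qed.

Lemma continuous_sum_fun n (f : 'I_n -> R -> R) :
  (forall i, continuous (f i)) -> continuous (fun s => \sum_i f i s).
Proof.
move=> cf t; have := @Ck_sum R R R 0 setT _ (index_enum _) f openT.
by apply => // i s _; exact: cf.
Qed.

Lemma continuous_mul_fun (f g : R -> R) :
  continuous f -> continuous g -> continuous (fun s => f s * g s).
Proof. by move=> cf cg t; apply: cvgM; [exact: cf|exact: cg]. Qed.

Lemma in01_0 : (0 : R) \in `[0, 1]. Proof. by rewrite in_itv/= lexx ler01. Qed.
Lemma in01_1 : (1 : R) \in `[0, 1]. Proof. by rewrite in_itv/= lexx ler01. Qed.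

Section Picard.
Variables (n : nat) (M : 'I_n -> 'I_n -> R -> R) (c : 'I_n -> R).
Hypothesis cM : forall i j, continuous (M i j).
Hypothesis M_le : forall i t, \sum_j `|M i j t| <= 1 / 2.

(** The row sums at most [1 / 2] make the Picard operator a contraction by one half on the whole
    unit interval. Later this smallness is obtained from short rays. *)
Lemma Mu_le (u : 'I_n -> R) B i t : (forall j, `|u j| <= B) -> `|\sum_j M i j t * u j| <= B / 2.
Proof.
move=> uB; have [B0|B0] := leP 0 B; last first.
  have u0 j : u j = 0.
    by have := le_trans (normr_ge0 (u j)) (uB j); rewrite leNgt B0.
  have Bi := le_trans (normr_ge0 (u i)) (uB i); by move: B0; rewrite ltNge Bi.
apply: le_trans (ler_norm_sum _ _ _) _.
apply: le_trans (_ : \sum_j `|M i j t| * B <= _).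
  by apply: ler_sum => j _; rewrite normrM ler_wpM2l.
by rewrite -mulr_suml; have := ler_wpM2r B0 (M_le i t); lra.
Qed.

(** [v] is a Picard iterate of [u]. The function [w] carries the derivatives, including those at 0
    and 1, while [v] is [w] frozen outside the unit interval and hence continuous everywhere. *)
Definition picard_spec (u v : 'I_n -> R -> R) := (forall i, continuous (v i)) /\
  exists w : 'I_n -> R -> R, [/\ forall i t, v i t = w i (clamp t), forall i, w i 0 = c i &
   forall i (t : R), t \in `[0, 1] -> is_derive t (1 : R) (w i) (\sum_j M i j t * u j t)].

Lemma picard_step (u : 'I_n -> R -> R) : (forall i, continuous (u i)) -> exists v, picard_spec u v.
Proof.
move=> cu.
(* The larger open interval makes 0 and 1 interior points, where the primitive has a two-sided
   derivative. *)
have H i : exists F : R -> R, forall t : R, t \in `](-1), 2[ ->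
    is_derive t (1 : R) F (\sum_j M i j t * u j t).
  apply: (@antiderivative (fun t => \sum_j M i j t * u j t)).
  by apply: continuous_sum_fun => j; exact: continuous_mul_fun.
have [F HF] := choice H.
have sub (t : R) : t \in `[0, 1] -> t \in `](-1), 2[ by rewrite !in_itv/=; lra.
pose w i t := F i t - (F i 0 - c i).
have Dw i (t : R) : t \in `[0, 1] -> is_derive t (1 : R) (w i) (\sum_j M i j t * u j t).
  move=> /sub t01; rewrite -[X in is_derive _ _ _ X]subr0.
  by apply: is_deriveB; exact: HF.
exists (fun i t => w i (clamp t)); split; last first.
  by exists w; split=> // i; rewrite /w opprB addrCA subrr addr0.
move=> i t; apply: continuous_comp; first exact: clamp_continuous.
exact: is_derive_continuous (Dw i _ (clamp_in t)).
Qed.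

Lemma picard_contract u u' v v' B : picard_spec u v -> picard_spec u' v' ->
  (forall i t, `|u i t - u' i t| <= B) -> forall i t, `|v i t - v' i t| <= B / 2.
Proof.
move=> [_ [w [vw w0 dw]]] [_ [w' [vw' w0' dw']]] uB i t; rewrite vw vw'.
have D (s : R) : s \in `[0, 1] -> is_derive s (1 : R) (fun s => w i s - w' i s)
    (\sum_j M i j s * u j s - \sum_j M i j s * u' j s).
  by move=> s01; apply: is_deriveB; [exact: dw|exact: dw'].
have := mvt_unit D _ (clamp_in t); rewrite w0 w0' subrr subr0; apply.
move=> s _; rewrite -sumrB.
under eq_bigr do rewrite -mulrBr.
exact: Mu_le.
Qed.

Lemma linear_ode_unit : exists y : 'I_n -> R -> R, (forall i, y i 0 = c i) /\
  forall i (t : R), t \in `[0, 1] -> is_derive t (1 : R) (y i) (\sum_j M i j t * y j t).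
Proof.
pose nextP (u : {u : 'I_n -> R -> R | forall i, continuous (u i)}) :=
  cid (picard_step (svalP u)).
pose next u : {u : 'I_n -> R -> R | forall i, continuous (u i)} :=
  exist _ (sval (nextP u)) (svalP (nextP u)).1.
have cc (i : 'I_n) : continuous (fun _ : R => c i) by move=> t; exact: cvg_cst.
pose u0 : {u : 'I_n -> R -> R | forall i, continuous (u i)} := exist _ (fun i _ => c i) cc.
pose U k := sval (iter k next u0).
have US k : picard_spec (U k) (U k.+1) by exact: (svalP (nextP (iter k next u0))).
have cU k i : continuous (U k i) by exact: (svalP (iter k next u0)).
pose C := \sum_j `|c j|.
have C_ge j : `|c j| <= C by rewrite /C (bigD1 j)//= lerDl sumr_ge0.
have dU k i t : `|U k.+1 i t - U k i t| <= C / 2 ^+ k.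
  elim: k i t => [|k IH] i t.
    have [_ [w [vw w0 dw]]] := US 0%N; rewrite vw expr0 divr1 /U/= -(w0 i).
    apply: (mvt_unit (dw i) _ (clamp_in t)) => s _.
    apply: le_trans (Mu_le i s C_ge) _.
    by have := le_trans (normr_ge0 (c i)) (C_ge i); lra.
  have := picard_contract (US k.+1) (US k) IH i t.
  by rewrite exprSr invfM mulrA.
(* The margin is the sum of the geometric series that bounds all increments from step [k] on. *)
pose a k i t := U k i t - 2 * C / 2 ^+ k.
pose b k i t := U k i t + 2 * C / 2 ^+ k.
have pS k : C / 2 ^+ k = 2 * (C / 2 ^+ k.+1) by rewrite exprSr; field; rewrite expf_neq0.
have a_nd i t k m : (k <= m)%N -> a k i t <= a m i t.
  move=> km; apply: (@homo_leq _ (fun k => a k i t) (fun x y => x <= y)) km => //.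
    by move=> x y z; exact: le_trans.
  move=> l; have := dU l i t; rewrite ler_norml /a => /andP[H _].
  have := pS l; move: H; rewrite -!mulrA; lra.
have b_ni i t k m : (k <= m)%N -> b m i t <= b k i t.
  move=> km; apply: (@homo_leq _ (fun k => b k i t) (fun x y => y <= x)) km => //.
    by move=> x y z /[swap]; exact: le_trans.
  move=> l; have := dU l i t; rewrite ler_norml /b => /andP[_ H].
  have := pS l; move: H; rewrite -!mulrA; lra.
have C0 : 0 <= C by apply: sumr_ge0.
have ab i t k m : a k i t <= b m i t.
  apply: le_trans (a_nd i t k (maxn k m) (leq_maxl _ _)) _.
  apply: le_trans (b_ni i t m (maxn k m) (leq_maxr _ _)).
  have : 0 <= 2 * C / 2 ^+ maxn k m by rewrite divr_ge0 ?mulr_ge0 ?exprn_ge0 ?C0.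
  by rewrite /a /b; lra.
(* The [a k] increase, the [b k] decrease and [b k - a k] tends to 0: this gives
   the uniform limit without any convergence theorem. *)
pose y i t := sup [set a k i t | k in [set: nat]].
have y_le i t k : `|y i t - U k i t| <= 2 * C / 2 ^+ k.
  have S0 : [set a k i t | k in [set: nat]] !=set0 by exists (a 0%N i t); exists 0%N.
  have h1 : a k i t <= y i t.
    apply: ub_le_sup; last by exists k.
    by exists (b 0%N i t) => _ [m _ <-].
  have h2 : y i t <= b k i t.
    by apply: ge_sup => // _ [m _ <-].
  by rewrite ler_norml; move: h1 h2; rewrite /a /b; lra.
have cy i : continuous (y i).
  move=> t; apply/cvgrPdist_lt => e e0.
  have [k Hk] : exists k, 2 * C / 2 ^+ k < e / 3.
    apply: contrapT => /forallNP H.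
    have : e / 3 <= 0.
      apply: (@le_half_pow _ _ (2 * C)) => k; rewrite add0r leNgt; apply/negP; exact: H.
    by move: e0; lra.
  have e3 : 0 < e / 3 by rewrite divr_gt0.
  have := continuous_eps (cU k i t) e3.
  apply: filterS => s; have := y_le i t k; have := y_le i s k.
  rewrite !ler_norml !ltr_norml; move: Hk; lra.
have [v [cv [w [vw w0 dw]]]] := picard_step cy.
have sv : picard_spec y v by split=> //; exists w.
(* The limit is a fixed point: one more Picard step maps both [y] and its iterate [v] within a
   multiple of [2 ^- k] of the same approximation [U k.+1]. *)
have yv i t : v i t = y i t.
  apply/eqP; rewrite -subr_eq0 -normr_le0; apply: (@le_half_pow _ _ (2 * C)) => k.
  rewrite add0r.
  have := picard_contract sv (US k) (fun i t => y_le i t k) i t.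
  have := y_le i t k.+1; have := pS k; rewrite -!mulrA !ler_norml; lra.
exists w; split=> // i t t01.
have := dw i t t01; congr (is_derive _ _ _ _); apply: eq_bigr => j _.
by rewrite -yv vw clamp_id.
Qed.

End Picard.

(** Continuity gives some initial bound [b], and integrating replaces any bound [B] by [B / 2 + e].
    Iteration gives [2 * e + b / 2 ^ k], which tends to the fixed point [2 * e]. *)
Lemma gronwall_unit n (E D : 'I_n -> R -> R) e :
  (forall i, E i 0 = 0) ->
  (forall i (t : R), t \in `[0, 1] -> is_derive t (1 : R) (E i) (D i t)) ->
  (forall i t B, t \in `[0, 1] -> (forall j, `|E j t| <= B) -> `|D i t| <= B / 2 + e) ->
  forall i t, t \in `[0, 1] -> `|E i t| <= 2 * e.
Proof.
move=> E0 dE DE.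
have /choice[B HB] (i : 'I_n) : exists b : R, forall t : R, t \in `[0, 1] -> `|E i t| <= b.
  have c : {within `[0, 1], continuous (fun t => `|E i t|)}.
    apply: continuous_in_subspaceT => t; rewrite inE => t01.
    apply: (@continuous_comp _ _ _ (E i) Num.norm); last exact: norm_continuous.
    exact: is_derive_continuous (dE i t t01).
  by have [x _ xm] := EVT_max ler01 c; exists `|E i x|.
pose b := \sum_i `|B i|.
have Hb i t : t \in `[0, 1] -> `|E i t| <= b.
  move=> t01; apply: le_trans (HB i t t01) _; apply: le_trans (ler_norm _) _.
  by rewrite /b (bigD1 i)//= lerDl sumr_ge0.
move=> i t t01; apply: (@le_half_pow _ _ b) => k.
elim: k i t t01 => [|k IH] i t t01.
  rewrite expr0 divr1; have := Hb i t t01.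
  have := DE i 0 0 in01_0; rewrite mul0r add0r => H.
  have : 0 <= e.
    by apply: le_trans (H _); [exact: normr_ge0|move=> j; rewrite E0 normr0].
  lra.
have := mvt_unit (dE i) _ t01; rewrite E0 subr0; apply => s s01.
have := DE i s _ s01 (fun j => IH j s s01).
have -> // : (2 * e + b / 2 ^+ k) / 2 + e = 2 * e + b / 2 ^+ k.+1.
by rewrite exprSr; field; rewrite expf_neq0.
Qed.

End ODE.

(** * Flat linear systems of rank three *)

Notation k0 := (@ord0 2).
Notation k1 := (@lift 3 ord0 ord0).
Notation k2 := (@lift 3 ord0 (@lift 2 ord0 ord0)).

Lemma sum3 (V : nmodType) (F : 'I_3 -> V) : \sum_i F i = F k0 + F k1 + F k2.
Proof. by rewrite !big_ord_recl big_ord0 addr0 addrA. Qed.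

Section Frobenius.
Context {R : realType}.
Local Notation plane := 'rV[R]_2.

Lemma near_forall (V : normedModType R) (I : finType) (p : V) (P : I -> V -> Prop) :
  (forall i, \forall q \near p, P i q) -> \forall q \near p, forall i, P i q.
Proof. by move=> H; apply: filter_forall. Qed.

Lemma local_bound (V : normedModType R) (I : finType) (g : I -> V -> R) (p : V) :
  (forall i, {for p, continuous (g i)}) ->
  exists K : R, \forall q \near p, forall i, `|g i q| <= K.
Proof.
move=> cg; exists (1 + \sum_i `|g i p|); apply: near_forall => i.
have := continuous_eps (cg i) ltr01; apply: filterS => q gq.
have : `|g i p| <= \sum_j `|g j p| by rewrite (bigD1 i)//= lerDl sumr_ge0.
have : `|g i q| <= `|g i q - g i p| + `|g i p| by rewrite -{1}(subrK (g i p) (g i q)) ler_normD.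
move: gq; lra.
Qed.

Lemma taylor2 (f : plane -> R) p (r K : R) : 
  smooth [set q : plane | `|q - p| < r] f ->
  (forall q j, `|q - p| < r -> `|pd j f q| <= K) ->
  (forall q i j, `|q - p| < r -> `|pd i (pd j f) q| <= K) ->
  forall q s, `|q - p| < r -> `|q + s - p| < r ->
   `|f (q + s) - f q| <= 2 * K * `|s| /\
   `|f (q + s) - f q - (s 0 i0 * pd i0 f q + s 0 i1 * pd i1 f q)| <= 4 * K * `|s| ^+ 2.
Proof.
move=> sf b1 b2 q s qr qsr.
have K0 : 0 <= K by apply: le_trans (b1 q i0 qr).
have df j x : `|x - p| < r -> differentiable (pd j f) x.
  by move=> xr; exact: smooth_diff (smooth_pd j sf) xr.
have df0 x : `|x - p| < r -> differentiable f x.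
  by move=> xr; exact: smooth_diff sf xr.
split.
  have := @mvt_ball _ f p r K df0 (fun x j => b1 x j) _ _ qsr qr.
  by rewrite [q + s]addrC addrK.
have [|t t01] := @MVT_line _ _ f q s 1 ltr01.
  move=> t t01; apply: df0; have := ball_convex t01 qsr qr.
  by rewrite [q + s]addrC addrK.
rewrite scale1r mul1r => ->.
have {}t01 := subset_itv_oo_cc t01.
have xr : `|q + t *: s - p| < r.
  by have := ball_convex t01 qsr qr; rewrite [q + s]addrC addrK.
rewrite derive_pd; last exact: df0.
have H j : `|pd j f (q + t *: s) - pd j f q| <= 2 * K * `|s|.
  have := @mvt_ball _ (pd j f) p r K (df j) (fun x i => b2 x i j) _ _ xr qr.
  rewrite [q + _]addrC addrK => /le_trans; apply.
  rewrite ler_wpM2l ?mulr_ge0// normrZ.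
  by move: t01; rewrite in_itv/= => /andP[t0 t1]; rewrite ger0_norm// ler_piMl.
have -> : s 0 i0 * pd i0 f (q + t *: s) + s 0 i1 * pd i1 f (q + t *: s) -
   (s 0 i0 * pd i0 f q + s 0 i1 * pd i1 f q) =
   s 0 i0 * (pd i0 f (q + t *: s) - pd i0 f q) + s 0 i1 * (pd i1 f (q + t *: s) - pd i1 f q) by ring.
apply: le_trans (ler_normD _ _) _; rewrite !normrM.
have -> : 4 * K * `|s| ^+ 2 = `|s| * (2 * K * `|s|) + `|s| * (2 * K * `|s|) by ring.
by apply: lerD; apply: ler_pM => //; exact: norm_coord.
Qed.

(** The algebra behind the error estimate for neighbouring rays. [M] and [mp] are the matrix on the
    ray of [x] and a row of it on the ray of [x + h]; [w] is the system contracted with [h], [w']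
    its derivative along the ray, [t * eta] the change of [M] due to moving the point, and [rho] the
    second order remainder. The third hypothesis is flatness contracted with [x] and [h]; it removes
    every term linear in [h] except those containing [E]. *)
Lemma ray_identity (k : 'I_3) (M w : 'I_3 -> 'I_3 -> R) (mp w' eta rho Y E Yp : 'I_3 -> R) (t : R) :
  (forall l, Yp l = E l + Y l + t * \sum_m w l m * Y m) ->
  (forall l, mp l = M k l + w k l + t * eta l + rho l) ->
  (forall m, eta m - w' m + \sum_l (M k l * w l m - w k l * M l m) = 0) ->
  \sum_l mp l * Yp l - \sum_l M k l * Y l - (\sum_l w k l * Y l + t * (\sum_l (w' l * Y l
     + w k l * \sum_m M l m * Y m))) =
  \sum_l mp l * E l + \sum_l rho l * Y l + t * \sum_l (mp l - M k l) * \sum_m w l m * Y m.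
Proof.
move=> H1 H2 H3; apply/eqP; rewrite -subr_eq0; apply/eqP.
transitivity (t * \sum_m (eta m - w' m + \sum_l (M k l * w l m - w k l * M l m)) * Y m).
  by rewrite !sum3 !H1 !H2 !sum3; ring.
by rewrite big1 ?mulr0// => m _; rewrite H3 mul0r.
Qed.

Lemma norm_sum3_le (f : 'I_3 -> R) (b : R) : (forall i, `|f i| <= b) -> `|\sum_i f i| <= 3 * b.
Proof.
move=> fb; rewrite sum3; have := ler_normD (f k0 + f k1) (f k2).
by have := ler_normD (f k0) (f k1); have := fb k0; have := fb k1; have := fb k2; lra.
Qed.

Lemma is_deriveD_fun (f g : R -> R) (t df dg : R) : is_derive t (1 : R) f df ->
  is_derive t (1 : R) g dg -> is_derive t (1 : R) (fun s => f s + g s) (df + dg).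
Proof. by move=> Df Dg; exact: is_deriveD. Qed.

Lemma is_deriveB_fun (f g : R -> R) (t df dg : R) : is_derive t (1 : R) f df ->
  is_derive t (1 : R) g dg -> is_derive t (1 : R) (fun s => f s - g s) (df - dg).
Proof. by move=> Df Dg; exact: is_deriveB. Qed.

Lemma is_deriveM_fun (f g : R -> R) (t df dg : R) : is_derive t (1 : R) f df ->
  is_derive t (1 : R) g dg -> is_derive t (1 : R) (fun s => f s * g s) (df * g t + f t * dg).
Proof.
move=> Df Dg; have := is_deriveM Df Dg; congr (is_derive _ _ _ _).
by rewrite /GRing.scale/= addrC mulrC.
Qed.

Lemma is_derive_cst_fun (u t : R) : is_derive t (1 : R) (fun _ : R => u) 0.
Proof. exact: is_derive_cst. Qed.

Lemma is_derive_eq_val (f : R -> R) (t df df' : R) : is_derive t (1 : R) f df -> df = df' ->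
  is_derive t (1 : R) f df'.
Proof. by move=> D <-. Qed.

(** The Gronwall estimate for [y - c]: where this difference is at most [B], its derivative is at
    most [(B + C) / 2]. *)
Lemma linear_ode_bound n (M : 'I_n -> 'I_n -> R -> R) (c : 'I_n -> R) (y : 'I_n -> R -> R) (C : R) :
  (forall i t, \sum_j `|M i j t| <= 1 / 2) -> (forall i, y i 0 = c i) ->
  (forall i (t : R), t \in `[0, 1] -> is_derive t (1 : R) (y i) (\sum_j M i j t * y j t)) ->
  (forall i, `|c i| <= C) ->
  forall i t, t \in `[0, 1] -> `|y i t| <= 2 * C.
Proof.
move=> Mle y0 dy cC i t t01.
have : `|y i t - c i| <= 2 * (C / 2).
  apply: (@gronwall_unit R n (fun i t => y i t - c i) (fun i t => \sum_j M i j t * y j t)) => //.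
  - by move=> j; rewrite y0 subrr.
  - move=> j s s01; have dc : is_derive s (1 : R) (fun=> c j) 0 by exact: is_derive_cst.
    exact: is_derive_eq_val (is_deriveB_fun (dy j s s01) dc) (subr0 _).
  move=> j s B s01 HB.
  have : `|\sum_l M j l s * y l s| <= (B + C) / 2.
    apply: (@Mu_le R n M Mle (fun l => y l s)) => l.
    have := ler_normD (y l s - c l) (c l); rewrite subrK; have := HB l; have := cC l.
    lra.
  lra.
have := ler_normD (y i t - c i) (c i); rewrite subrK; have := cC i; lra.
Qed.

Section System.
Variables (A : 'I_2 -> 'I_3 -> 'I_3 -> plane -> R) (p : plane) (r K : R) (c : 'I_3 -> R).
Hypotheses (r0 : 0 < r) (r1 : r <= 1) (rK : 6 * r * K <= 1 / 2).
Let B := [set q : plane | `|q - p| < r].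
Hypothesis sA : forall i k l, smooth B (A i k l).
Hypothesis bA0 : forall q i k l, B q -> `|A i k l q| <= K.
Hypothesis bA1 : forall q j i k l, B q -> `|pd j (A i k l) q| <= K.
Hypothesis bA2 : forall q a b i k l, B q -> `|pd a (pd b (A i k l)) q| <= K.
Hypothesis flatA : forall q k l, B q ->
  pd i0 (A i1 k l) q + \sum_m A i1 k m q * A i0 m l q =
  pd i1 (A i0 k l) q + \sum_m A i0 k m q * A i1 m l q.

Let K0 : 0 <= K.
Proof. by apply: le_trans (bA0 i0 k0 k0 (_ : B p)); rewrite ?normr_ge0// /B/= subrr normr0. Qed.

(** The solution at [p + x] will be the value at time one of the ordinary equation along this
    segment, started at [c]. A row of its matrix has three entries of two terms each, which is the 6
    in [6 * r * K <= 1 / 2]. *)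
Let ray (x : plane) (t : R) : plane := p + t *: x.

Let ray_B x t : `|x| < r -> t \in `[0, 1] -> B (ray x t).
Proof.
move=> xr; rewrite in_itv/= => /andP[t0 t1]; rewrite /B/= /ray addrAC subrr add0r normrZ ger0_norm//.
by apply: le_lt_trans xr; rewrite ler_piMl.
Qed.

Let Mx (x : plane) k l t := \sum_i x 0 i * A i k l (ray x t).

Let Mx_le x k t : `|x| < r -> t \in `[0, 1] -> \sum_l `|Mx x k l t| <= 1 / 2.
Proof.
move=> xr t01; apply: le_trans rK.
have H l : `|Mx x k l t| <= 2 * r * K.
  rewrite /Mx sum2; apply: le_trans (ler_normD _ _) _; rewrite !normrM.
  have -> : 2 * r * K = r * K + r * K by ring.
  by apply: lerD; apply: ler_pM => //; [|exact: bA0 (ray_B xr t01)| |exact: bA0 (ray_B xr t01)];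
    exact: le_trans (norm_coord _ _) (ltW xr).
by rewrite sum3; have := H k0; have := H k1; have := H k2; lra.
Qed.

Let Mx_cont x k l : `|x| < r -> continuous (fun t => Mx x k l (clamp t)).
Proof.
move=> xr; apply: (@continuous_sum_fun R 2 (fun i t => x 0 i * A i k l (ray x (clamp t)))) => i.
apply: continuous_mul_fun => [t|t]; first exact: cvg_cst.
apply: (@continuous_comp _ _ _ clamp (fun s => A i k l (ray x s))).
  exact: clamp_continuous.
have Bt := ray_B xr (clamp_in t).
exact: is_derive_continuous (is_derive_line (smooth_diff (sA i k l) Bt)).
Qed.

Let ray_sol x : exists y : 'I_3 -> R -> R, `|x| < r -> (forall k, y k 0 = c k) /\
  forall k (t : R), t \in `[0, 1] -> is_derive t (1 : R) (y k) (\sum_l Mx x k l t * y l t).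
Proof.
(* A dummy value outside the ball lets the solutions be chosen for all [x] at once. *)
have [xr|xr] := pselect (`|x| < r); last by exists (fun _ _ => 0).
have [y [y0 dy]] := @linear_ode_unit R 3 (fun k l t => Mx x k l (clamp t)) c
  (fun k l => @Mx_cont x k l xr) (fun k t => @Mx_le x k _ xr (clamp_in t)).
exists y => _; split=> // k t t01; apply: is_derive_eq_val (dy k t t01) _.
by rewrite clamp_id.
Qed.

Let Y x := sval (cid (ray_sol x)).
Let Y0 x k : `|x| < r -> Y x k 0 = c k.
Proof. by move=> xr; have [H _] := svalP (cid (ray_sol x)) xr; exact: H. Qed.
Let dY x k (t : R) : `|x| < r -> t \in `[0, 1] ->
  is_derive t (1 : R) (Y x k) (\sum_l Mx x k l t * Y x l t).
Proof. by move=> xr; have [_ H] := svalP (cid (ray_sol x)) xr; exact: H. Qed.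

Let C := \sum_k `|c k|.
Let C0 : 0 <= C. Proof. exact: sumr_ge0. Qed.

Let Y_le x k t : `|x| < r -> t \in `[0, 1] -> `|Y x k t| <= 2 * C.
Proof.
move=> xr t01.
apply: (@linear_ode_bound 3 (fun k l t => Mx x k l (clamp t)) c) t01.
- by move=> i s; exact: (@Mx_le x i _ xr (clamp_in s)).
- by move=> i; exact: Y0.
- move=> i s s01; apply: is_derive_eq_val (dY i xr s01) _.
  by rewrite clamp_id.
by move=> i; rewrite /C (bigD1 i)//= lerDl sumr_ge0.
Qed.

(** The two summands bound [rho] against [Y] and the product of the increment of the matrix with
    [w]: [72 = 3 * 12 * 2] and [216 = 3 * 6 * 3 * 2 * 2], where each 3 counts the terms of a sum and
    the last 2 comes from [Y_le]. *)
Let bigK := 72 * K * C + 216 * K ^+ 2 * C.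

Let main x h k : `|x| < r -> `|x + h| < r ->
  `|Y (x + h) k 1 - Y x k 1 - \sum_l (\sum_i h 0 i * A i k l (p + x)) * Y x l 1|
   <= 2 * (bigK * `|h| ^+ 2).
Proof.
move=> xr xhr.
pose w k l t := \sum_i h 0 i * A i k l (ray x t).
pose w' k l t := \sum_i h 0 i * (x 0 i0 * pd i0 (A i k l) (ray x t) + x 0 i1 * pd i1 (A i k l) (ray x t)).
(* [E] is the error of the first order prediction of the solution along the ray of
   [x + h]; by flatness the terms of order one in [h] of its derivative cancel. *)
pose E k t := Y (x + h) k t - Y x k t - t * \sum_l w k l t * Y x l t.
pose D k t := \sum_l Mx (x + h) k l t * Y (x + h) l t - \sum_l Mx x k l t * Y x l t
  - (\sum_l w k l t * Y x l t + t * (\sum_l (w' k l t * Y x l t + w k l t * \sum_m Mx x l m t * Y x m t))).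
have dw a l (t : R) : t \in `[0, 1] -> is_derive t (1 : R) (w a l) (w' a l t).
  move=> t01; apply: is_derive_sum_fun => i.
  have dA := smooth_diff (sA i a l) (ray_B xr t01).
  have Dh := is_deriveM_fun (is_derive_cst_fun (h 0 i) t) (is_derive_line dA).
  by apply: (is_derive_eq_val Dh); rewrite mul0r add0r derive_pd.
have dE a (t : R) : t \in `[0, 1] -> is_derive t (1 : R) (E a) (D a t).
  move=> t01; apply: is_deriveB_fun.
    by apply: is_deriveB_fun; exact: dY.
  have Ds := is_derive_sum_fun (fun l => is_deriveM_fun (dw a l t t01) (dY l xr t01)).
  have Dt := is_deriveM_fun (is_derive_id t (1 : R)) Ds.
  by apply: (is_derive_eq_val Dt); rewrite mul1r.
suff : `|E k 1| <= 2 * (bigK * `|h| ^+ 2).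
  rewrite /E mul1r; congr (`|_ - _| <= _); apply: eq_bigr => l _.
  by rewrite /w /ray scale1r.
apply: (@gronwall_unit R 3 E D) => //; last exact: in01_1.
  by move=> a; rewrite /E !Y0// subrr mul0r subrr.
move=> a t B' t01 HB'.
pose q := ray x t.
have Bq : B q by exact: ray_B.
have qE : ray (x + h) t = q + t *: h by rewrite /q /ray scalerDr addrA.
have Bq' : B (q + t *: h) by rewrite -qE; exact: ray_B.
have th : `|t *: h| <= `|h|.
  by move: t01; rewrite in_itv/= => /andP[t0 t1]; rewrite normrZ ger0_norm// ler_piMl.
have T i l : `|A i a l (q + t *: h) - A i a l q| <= 2 * K * `|h| /\
   `|A i a l (q + t *: h) - A i a l q - t * (h 0 i0 * pd i0 (A i a l) q + h 0 i1 * pd i1 (A i a l) q)|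
     <= 4 * K * `|h| ^+ 2.
  have [T1 T2] := @taylor2 (A i a l) p r K (sA i a l) (fun q j => @bA1 q j i a l)
    (fun q u v => @bA2 q u v i a l) q (t *: h) Bq Bq'.
  split; first by apply: le_trans T1 _; rewrite ler_wpM2l ?mulr_ge0.
  move: T2; rewrite !mxE.
  have -> : t * h 0 i0 * pd i0 (A i a l) q + t * h 0 i1 * pd i1 (A i a l) q =
    t * (h 0 i0 * pd i0 (A i a l) q + h 0 i1 * pd i1 (A i a l) q) by ring.
  move=> /le_trans; apply; rewrite ler_wpM2l ?mulr_ge0//.
  by rewrite lerXn2r// nnegrE.
have hi i : `|h 0 i| <= `|h| by exact: norm_coord.
have xi i : `|x 0 i| <= 1.
  by apply: le_trans (norm_coord _ _) _; apply: le_trans r1; exact: ltW.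
pose eta l := \sum_i x 0 i * (h 0 i0 * pd i0 (A i a l) q + h 0 i1 * pd i1 (A i a l) q).
pose mp l := Mx (x + h) a l t.
pose rho l := mp l - Mx x a l t - w a l t - t * eta l.
have rho_le l : `|rho l| <= 12 * K * `|h| ^+ 2.
  have -> : rho l = \sum_i (h 0 i * (A i a l (q + t *: h) - A i a l q) +
     x 0 i * (A i a l (q + t *: h) - A i a l q - t * (h 0 i0 * pd i0 (A i a l) q + h 0 i1 * pd i1 (A i a l) q))).
    by rewrite /rho /mp /Mx /w /eta qE !sum2 !mxE -/q; ring.
  have H i : `|h 0 i * (A i a l (q + t *: h) - A i a l q) +
     x 0 i * (A i a l (q + t *: h) - A i a l q - t * (h 0 i0 * pd i0 (A i a l) q + h 0 i1 * pd i1 (A i a l) q))|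
      <= 6 * K * `|h| ^+ 2.
    have [T1 T2] := T i l; apply: le_trans (ler_normD _ _) _; rewrite !normrM.
    have -> : 6 * K * `|h| ^+ 2 = `|h| * (2 * K * `|h|) + 1 * (4 * K * `|h| ^+ 2) by ring.
    by apply: lerD; apply: ler_pM.
  by rewrite sum2; apply: le_trans (ler_normD _ _) _; have := H i0; have := H i1; lra.
have w_le b l : `|w b l t| <= 2 * K * `|h|.
  rewrite /w sum2; apply: le_trans (ler_normD _ _) _; rewrite !normrM.
  have -> : 2 * K * `|h| = `|h| * K + `|h| * K by ring.
  by apply: lerD; apply: ler_pM => //; exact: bA0.
have dM_le l : `|mp l - Mx x a l t| <= 6 * K * `|h|.
  have -> : mp l - Mx x a l t = \sum_i (h 0 i * A i a l (q + t *: h) +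
     x 0 i * (A i a l (q + t *: h) - A i a l q)).
    by rewrite /mp /Mx qE !sum2 !mxE -/q; ring.
  have H i : `|h 0 i * A i a l (q + t *: h) + x 0 i * (A i a l (q + t *: h) - A i a l q)|
      <= 3 * K * `|h|.
    have [T1 _] := T i l; apply: le_trans (ler_normD _ _) _; rewrite !normrM.
    have -> : 3 * K * `|h| = `|h| * K + 1 * (2 * K * `|h|) by ring.
    by apply: lerD; apply: ler_pM => //; exact: bA0.
  by rewrite sum2; apply: le_trans (ler_normD _ _) _; have := H i0; have := H i1; lra.
have -> : D a t = \sum_l mp l * E l t + \sum_l rho l * Y x l t +
    t * \sum_l (mp l - Mx x a l t) * \sum_m w l m t * Y x m t.
  apply: (@ray_identity a (fun k l => Mx x k l t) (fun k l => w k l t) mp (w' a ^~ t) eta rho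
    (fun l => Y x l t) (fun l => E l t) (fun l => Y (x + h) l t) t).
  - by move=> l; rewrite /E; ring.
  - by move=> l; rewrite /rho; ring.
  move=> m.
  have FE := flatA a m Bq.
  transitivity ((x 0 i0 * h 0 i1 - x 0 i1 * h 0 i0) *
    ((pd i1 (A i0 a m) q + \sum_l A i0 a l q * A i1 l m q)
     - (pd i0 (A i1 a m) q + \sum_l A i1 a l q * A i0 l m q))).
    by rewrite /eta /w' /w /Mx -/q !sum3 !sum2; ring.
  by rewrite FE subrr mulr0.
have P1 : `|\sum_l mp l * E l t| <= B' / 2.
  apply: (@Mu_le R 3 (fun k l _ => Mx (x + h) k l t) _ (fun l => E l t) B' a t).
    by move=> b _; exact: Mx_le.
  by move=> l; exact: HB'.
have P2 : `|\sum_l rho l * Y x l t| <= 3 * (12 * K * `|h| ^+ 2 * (2 * C)).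
  apply: norm_sum3_le => l; rewrite normrM; apply: ler_pM => //; exact: Y_le.
have P3 : `|t * \sum_l (mp l - Mx x a l t) * \sum_m w l m t * Y x m t| <=
    1 * (3 * (6 * K * `|h| * (3 * (2 * K * `|h| * (2 * C))))).
  rewrite normrM; apply: ler_pM => //.
    by move: t01; rewrite in_itv/= => /andP[t0 t1]; rewrite ger0_norm.
  apply: norm_sum3_le => l; rewrite normrM; apply: ler_pM => //.
  apply: norm_sum3_le => m; rewrite normrM; apply: ler_pM => //; exact: Y_le.
have -> : B' / 2 + bigK * `|h| ^+ 2 = B' / 2 + 3 * (12 * K * `|h| ^+ 2 * (2 * C)) +
    1 * (3 * (6 * K * `|h| * (3 * (2 * K * `|h| * (2 * C))))) by rewrite /bigK; ring.
apply: le_trans (ler_normD _ _) _; apply: lerD => //.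
by apply: le_trans (ler_normD _ _) _; exact: lerD.
Qed.

Lemma linear_system_ball : exists F : 'I_3 -> plane -> R, (forall k, F k p = c k) /\
  forall q k, B q -> differentiable (F k) q /\ forall i, pd i (F k) q = \sum_l A i k l q * F l q.
Proof.
exists (fun k q => Y (q - p) k 1); split.
  move=> k; rewrite subrr.
  have n0 : `|0 : plane| < r by rewrite normr0.
  have D (t : R) : t \in `[0, 1] -> is_derive t (1 : R) (Y 0 k) 0.
    move=> t01; apply: (is_derive_eq_val (dY k n0 t01)).
    rewrite big1// => l _; rewrite /Mx big1 ?mul0r// => i _; by rewrite mxE mul0r.
  have := mvt_unit D (B := 0) _ in01_1; rewrite normr0 Y0// => /(_ (fun _ _ => lexx _)).
  by rewrite normr_le0 subr_eq0 => /eqP.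
move=> q k Bq; pose x := q - p.
have xr : `|x| < r by [].
have px : p + x = q by rewrite /x addrC subrK.
have [|df Df] := @diff_eps2 R (fun q => Y (q - p) k 1) q (\sum_l A i0 k l q * Y x l 1)
    (\sum_l A i1 k l q * Y x l 1).
  move=> e e0.
  have K'0 : 0 <= bigK by rewrite /bigK addr_ge0 ?mulr_ge0 ?exprn_ge0.
  pose L := 2 * bigK + 1.
  have L0 : 0 < L by rewrite /L ltr_wpDl ?mulr_ge0.
  apply/nbhs_normP; exists (Num.min (r - `|x|) (e / L)).
    by rewrite /= lt_min subr_gt0 xr divr_gt0.
  move=> h /=; rewrite sub0r normrN lt_min => /andP[h1 h2].
  have xhr : `|x + h| < r by apply: le_lt_trans (ler_normD _ _) _; rewrite -ltrBrDl.
  have := main k xr xhr; rewrite px.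
  have -> : h + q - p = x + h by rewrite -addrA addrC.
  have -> : \sum_l (\sum_i h 0 i * A i k l q) * Y x l 1 =
      h 0 i0 * (\sum_l A i0 k l q * Y x l 1) + h 0 i1 * (\sum_l A i1 k l q * Y x l 1).
    by rewrite !sum3 !sum2; ring.
  move=> /le_trans; apply; rewrite expr2 mulrA mulrA ler_wpM2r//.
  move: h2; rewrite ltr_pdivlMr// /L; have := normr_ge0 h; lra.
split=> // i; rewrite -pdE Df !mxE/=.
by case: (ord2P i) => -> /=; rewrite ?mul1r ?mul0r ?addr0 ?add0r.
Qed.

End System.

Theorem linear_system_flat (U : set plane) (A : 'I_2 -> 'I_3 -> 'I_3 -> plane -> R) p :
  open U -> U p -> (forall i k l, smooth U (A i k l)) ->
  (forall q k l, U q -> pd i0 (A i1 k l) q + \sum_m A i1 k m q * A i0 m l q =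
     pd i1 (A i0 k l) q + \sum_m A i0 k m q * A i1 m l q) ->
  exists V : set plane, [/\ open V, V p, V `<=` U & forall c : 'I_3 -> R,
    exists F : 'I_3 -> plane -> R, [/\ forall k, F k p = c k, forall k, smooth V (F k) &
     forall q k i, V q -> pd i (F k) q = \sum_l A i k l q * F l q]].
Proof.
move=> oU Up sA flatA.
have [Ka HKa] := @local_bound _ ('I_2 * 'I_3 * 'I_3)%type (fun u q => A u.1.1 u.1.2 u.2 q) p
  (fun u => sA _ _ _ 0%N p Up).
have [Kb HKb] := @local_bound _ ('I_2 * ('I_2 * 'I_3 * 'I_3))%type
  (fun u q => pd u.1 (A u.2.1.1 u.2.1.2 u.2.2) q) p (fun u => smooth_pd _ (sA _ _ _) 0%N p Up).
have [Kc HKc] := @local_bound _ ('I_2 * 'I_2 * ('I_2 * 'I_3 * 'I_3))%type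
  (fun u q => pd u.1.1 (pd u.1.2 (A u.2.1.1 u.2.1.2 u.2.2)) q) p
  (fun u => smooth_pd _ (smooth_pd _ (sA _ _ _)) 0%N p Up).
have [s s0 H] := nbhs_norm_ex (filterI (filterI HKa HKb) (filterI HKc (open_near oU Up))).
pose K := `|Ka| + `|Kb| + `|Kc|.
have K0 : 0 <= K by rewrite /K !addr_ge0.
have [KaK KbK KcK] : [/\ Ka <= K, Kb <= K & Kc <= K].
  have := ler_norm Ka; have := ler_norm Kb; have := ler_norm Kc.
  have := normr_ge0 Ka; have := normr_ge0 Kb; have := normr_ge0 Kc.
  by rewrite /K => *; split; lra.
(* The bound [1 / (12 * (K + 1))] yields [6 * r * K <= 1 / 2], and [r <= 1] bounds the coordinates
   of [x] in the error estimate. *)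
pose r := Num.min s (Num.min 1 (1 / (12 * (K + 1)))).
have K1 : 0 < K + 1 by rewrite ltr_wpDl.
have r0 : 0 < r by rewrite /r !lt_min s0 ltr01 divr_gt0// mulr_gt0.
have rs : r <= s by rewrite /r ge_min lexx.
have r1 : r <= 1 by rewrite /r !ge_min lexx orbT.
have rK : 6 * r * K <= 1 / 2.
  have : r <= 1 / (12 * (K + 1)) by rewrite /r !ge_min lexx !orbT.
  rewrite ler_pdivlMr ?mulr_gt0//; nra.
have sB q : `|q - p| < r -> `|q - p| < s by move=> /lt_le_trans; apply.
have BU : [set q : plane | `|q - p| < r] `<=` U by move=> q /sB/H[_ []].
have oB : open [set q : plane | `|q - p| < r].
  apply: open_normP => x Bx; exists (r - `|x - p|); first by rewrite subr_gt0.
  move=> y xy /=; rewrite -(subrK x y) -addrA; apply: le_lt_trans (ler_normD _ _) _.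
  by rewrite -ltrBrDr.
exists [set q : plane | `|q - p| < r]; split=> //; first by rewrite /= subrr normr0.
move=> c.
have [F [Fp FE]] := @linear_system_ball A p r K c r0 r1 rK (fun i k l => sub_smooth BU (sA i k l))
  (fun q i k l Bq => le_trans ((H q (sB q Bq)).1.1 (i, k, l)) KaK)
  (fun q j i k l Bq => le_trans ((H q (sB q Bq)).1.2 (j, (i, k, l))) KbK)
  (fun q a b i k l Bq => le_trans ((H q (sB q Bq)).2.1 (a, b, (i, k, l))) KcK)
  (fun q k l Bq => flatA q k l (BU q Bq)).
exists F; split=> // [k n|q k i Bq]; last exact: (FE q k Bq).2.
(* Smoothness by bootstrapping: the system expresses the derivatives of [F] linearly by [F]. *)
elim: n k => [|n IH] k.
  by move=> q Bq; exact: differentiable_continuous (FE q k Bq).1.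
split=> [q Bq|v]; first exact: (FE q k Bq).1.
have sAr i k' l := sub_smooth BU (sA i k' l).
have S i : Ck n [set q : plane | `|q - p| < r] (fun q => \sum_l A i k l q * F l q).
  by apply: Ck_sum => // l; apply: CkM => //; exact: sAr.
apply: Ck_eq (CkD oB (CkM oB (Ck_cst n _ (v 0 i0)) (S i0)) (CkM oB (Ck_cst n _ (v 0 i1)) (S i1))) => //.
by move=> q Bq; rewrite (derive_pd _ (FE q k Bq).1) !(FE q k Bq).2.
Qed.

End Frobenius.

(** * Leaves and geodesics *)

Section Curves.
Context {R : realType}.
Local Notation plane := 'rV[R]_2.

Definition cross (u v : plane) := u 0 i0 * v 0 i1 - u 0 i1 * v 0 i0.

Lemma plane_neq0 (v : plane) : v != 0 -> v 0 i0 != 0 \/ v 0 i1 != 0.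
Proof.
move=> v0; have [e0|] := eqVneq (v 0 i0) 0; last by left.
right; apply: contra_neq v0 => e1; apply: plane_eqP; rewrite mxE//.
Qed.

Lemma cross_eq0P (v w : plane) : v != 0 -> (exists c, w = c *: v) <-> cross v w = 0.
Proof.
move=> v0; split=> [[c ->]|]; first by rewrite /cross !mxE; ring.
rewrite /cross => /eqP; rewrite subr_eq0 => /eqP E.
have [n0|n1] := plane_neq0 v0.
  exists (w 0 i0 / v 0 i0); apply: plane_eqP; rewrite !mxE; first by rewrite divfK.
  by apply: (mulfI n0); rewrite E; field.
exists (w 0 i1 / v 0 i1); apply: plane_eqP; rewrite !mxE; last by rewrite divfK.
by apply: (mulfI n1); rewrite -E; field.
Qed.

Lemma cross0_trans (v u w : plane) : v != 0 -> cross v u = 0 -> cross v w = 0 -> cross u w = 0.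
Proof.
move=> v0 /(cross_eq0P _ v0)[a ->] /(cross_eq0P _ v0)[b ->].
by rewrite /cross !mxE; ring.
Qed.

Variables (a b : R) (gamma : R -> plane).
Local Notation I := ([set` `]a, b[] : set R).
Hypothesis sgam : smooth I gamma.

Lemma smooth_derive1 : smooth I (derive1 gamma).
Proof.
have -> : derive1 gamma = 'D_1 gamma by apply/funext => t; rewrite derive1E.
exact: smooth_derive.
Qed.

Lemma is_derive_coord (t : R) k : t \in `]a, b[ ->
  is_derive t (1 : R) (fun s => gamma s 0 k) (derive1 gamma t 0 k).
Proof.
move=> tab; have d : differentiable gamma t by exact: smooth_diff sgam _.
apply: DeriveDef; first exact/diff_derivable/differentiable_coord_fun.
by rewrite derive1E derive_coord//; exact: diff_derivable.
Qed.

Lemma is_derive_comp (U : set plane) (f : plane -> R) (t : R) :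
  smooth U f -> t \in `]a, b[ -> U (gamma t) ->
  is_derive t (1 : R) (fun s => f (gamma s))
   (derive1 gamma t 0 i0 * pd i0 f (gamma t) + derive1 gamma t 0 i1 * pd i1 f (gamma t)).
Proof.
move=> sf tab Ug; have d : differentiable gamma t by exact: smooth_diff sgam _.
have df : differentiable f (gamma t) by exact: smooth_diff sf Ug.
have -> : (fun s => f (gamma s)) = f \o gamma by [].
apply: DeriveDef; first exact/diff_derivable/differentiable_comp.
by rewrite [LHS](derive_comp_diff _ d df) (derive_pd _ df) derive1E.
Qed.

End Curves.

(** * Geodesic equations as binary cubic forms *)

Section Cubic.
Context {R : realType}.
Local Notation plane := 'rV[R]_2.
Implicit Types (g : symbols (R := R)).

Definition quad g k q (v : plane) := \sum_i \sum_j v 0 i * v 0 j * g i j k q.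

(* A curve [c] satisfies the geodesic equation of [g], up to reparametrization, iff
   [cross c' c'' + cubic g c c' = 0]. *)
Definition cubic g q (v : plane) := v 0 i0 * quad g i1 q v - v 0 i1 * quad g i0 q v.

Lemma cubic_thomas g q v : cubic (thomas g) q v = cubic g q v.
Proof.
rewrite /cubic /quad /thomas /tr_symbols !sum2 /=; ring.
Qed.

(** Lagrange interpolation in homogeneous form: multiplied by all the pairwise determinants, [F x y]
    is a combination of the values of [F] at the four given vectors. *)
Lemma cubic_roots (A B C D x1 y1 x2 y2 x3 y3 x4 y4 : R) :
  let F x y := A * x ^+ 3 + B * x ^+ 2 * y + C * x * y ^+ 2 + D * y ^+ 3 in
  x1 * y2 - y1 * x2 != 0 -> x1 * y3 - y1 * x3 != 0 -> x1 * y4 - y1 * x4 != 0 ->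
  x2 * y3 - y2 * x3 != 0 -> x2 * y4 - y2 * x4 != 0 -> x3 * y4 - y3 * x4 != 0 ->
  F x1 y1 = 0 -> F x2 y2 = 0 -> F x3 y3 = 0 -> F x4 y4 = 0 ->
  forall x y, F x y = 0.
Proof.
move=> F n12 n13 n14 n23 n24 n34 f1 f2 f3 f4 x y.
pose d12 := x1 * y2 - y1 * x2. pose d13 := x1 * y3 - y1 * x3.
pose d14 := x1 * y4 - y1 * x4. pose d23 := x2 * y3 - y2 * x3.
pose d24 := x2 * y4 - y2 * x4. pose d34 := x3 * y4 - y3 * x4.
have n : d12 * d13 * d14 * d23 * d24 * d34 != 0 by rewrite !mulf_neq0.
apply: (mulfI n); rewrite mulr0.
transitivity (
   F x1 y1 * (x * y2 - y * x2) * (x * y3 - y * x3) * (x * y4 - y * x4) * d23 * d24 * d34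
 - F x2 y2 * (x * y1 - y * x1) * (x * y3 - y * x3) * (x * y4 - y * x4) * d13 * d14 * d34
 + F x3 y3 * (x * y1 - y * x1) * (x * y2 - y * x2) * (x * y4 - y * x4) * d12 * d14 * d24
 - F x4 y4 * (x * y1 - y * x1) * (x * y2 - y * x2) * (x * y3 - y * x3) * d12 * d13 * d23).
  by rewrite /F /d12 /d13 /d14 /d23 /d24 /d34; ring.
by rewrite f1 f2 f3 f4 !mul0r subrr addr0 subrr.
Qed.

Lemma cubic_unique g g' q (v : 'I_4 -> plane) :
  (forall i j, i != j -> cross (v i) (v j) != 0) ->
  (forall i, cubic g q (v i) = cubic g' q (v i)) ->
  forall w, cubic g q w = cubic g' q w.
Proof.
move=> nv ev w.
pose A := g i0 i0 i1 q - g' i0 i0 i1 q.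
pose B := (g i0 i1 i1 q + g i1 i0 i1 q - g i0 i0 i0 q) - (g' i0 i1 i1 q + g' i1 i0 i1 q - g' i0 i0 i0 q).
pose C := (g i1 i1 i1 q - g i0 i1 i0 q - g i1 i0 i0 q) - (g' i1 i1 i1 q - g' i0 i1 i0 q - g' i1 i0 i0 q).
pose D := - g i1 i1 i0 q + g' i1 i1 i0 q.
have E u : cubic g q u - cubic g' q u = A * u 0 i0 ^+ 3 + B * u 0 i0 ^+ 2 * u 0 i1 +
    C * u 0 i0 * u 0 i1 ^+ 2 + D * u 0 i1 ^+ 3.
  by rewrite /cubic /quad !sum2 /A /B /C /D; ring.
apply/eqP; rewrite -subr_eq0 E; apply/eqP.
pose j0 : 'I_4 := inord 0. pose j1 : 'I_4 := inord 1.
pose j2 : 'I_4 := inord 2. pose j3 : 'I_4 := inord 3.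
have H i : A * (v i) 0 i0 ^+ 3 + B * (v i) 0 i0 ^+ 2 * (v i) 0 i1 +
    C * (v i) 0 i0 * (v i) 0 i1 ^+ 2 + D * (v i) 0 i1 ^+ 3 = 0 by rewrite -E ev subrr.
by apply: (cubic_roots (nv j0 j1 _) (nv j0 j2 _) (nv j0 j3 _) (nv j1 j2 _) (nv j1 j3 _) (nv j2 j3 _)
  (H j0) (H j1) (H j2) (H j3)); rewrite -val_eqE /= !inordK.
Qed.

(** Symmetric trace-free symbols in the plane have four free entries, as many as a binary cubic has
    coefficients. The values at four pairwise independent vectors give linear equations that
    determine them. *)
Lemma thomas_unique g g' q : (forall i j k, g i j k q = g j i k q) ->
  (forall i j k, g' i j k q = g' j i k q) ->
  (forall w, cubic g q w = cubic g' q w) -> forall i j k, thomas g i j k q = thomas g' i j k q.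
Proof.
move=> sg sg' E i j k.
have := E (mk2 1 0); have := E (mk2 0 1); have := E (mk2 1 1); have := E (mk2 1 (-1)).
rewrite /cubic /quad !sum2 !mk2_0 !mk2_1.
rewrite /thomas /tr_symbols !sum2 !(sg i1 i0) !(sg' i1 i0).
case: (ord2P i) => ->; case: (ord2P j) => ->; case: (ord2P k) => -> /=;
rewrite ?(sg i1 i0) ?(sg' i1 i0); lra.
Qed.

End Cubic.

Section Foliations.
Context {R : realType}.
Local Notation plane := 'rV[R]_2.
Implicit Types (U V : set plane) (T : plane -> set plane) (g : symbols (R := R)).

Lemma sub_foliation U V T : open V -> V `<=` U -> foliation U T -> foliation V T.
Proof.
move=> oV VU fT p Vp; have [V0 [u [[oV0 V0p] V0U su uT]]] := fT p (VU p Vp).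
exists (V0 `&` V), u; split.
- by split; [exact: openI|].
- by move=> q [].
- by apply: sub_smooth su => q [].
- by move=> q [/uT].
Qed.

Lemma foliation_tangent U T p : foliation U T -> U p ->
  exists2 w : plane, w != 0 & forall v, T p v <-> cross w v = 0.
Proof.
move=> fT Up; have [V [u [[oV Vp] VU su uT]]] := fT p Up.
have [[v Dv] ->] := uT p Vp; have du := smooth_diff su Vp.
exists (mk2 (- pd i1 u p) (pd i0 u p)).
  apply: contra_neq Dv => /rowP w0; rewrite derive_pd//.
  have := w0 i0; have := w0 i1; rewrite mk2_0 mk2_1 !mxE => -> /eqP.
  by rewrite oppr_eq0 => /eqP ->; rewrite !mulr0 addr0.
move=> x /=; rewrite derive_pd// /cross mk2_0 mk2_1.
have -> : - pd i1 u p * x 0 i1 - pd i0 u p * x 0 i0 = - (x 0 i0 * pd i0 u p + x 0 i1 * pd i1 u p) by ring.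
by split=> [->|/eqP]; rewrite ?oppr0// oppr_eq0 => /eqP.
Qed.

(** Being geodesic constrains only those leaf curves that exist, so each point needs one. The local
    submersion [u] is completed to a chart [phi = (l, u)], and the inverse chart maps a horizontal
    line to a leaf. The linear form [l] is chosen so that the Jacobian at [p] is the squared length
    of the gradient of [u]. *)
Lemma leaf_curve_exists U T p : foliation U T -> U p ->
  exists a b gamma t, [/\ leaf_curve U T a b gamma, t \in `]a, b[ & gamma t = p].
Proof.
move=> fT Up; have [V [u [[oV Vp] VU su uT]]] := fT p Up.
pose u0 := pd i0 u p; pose u1 := pd i1 u p.
pose l (q : plane) := u1 * q 0 i0 - u0 * q 0 i1.
have sx i : smooth V (fun q : plane => q 0 i) by exact: smooth_coordinate.
have sl : smooth V l by rewrite /l; smt.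
pose phi q := mk2 (l q) (u q).
have sphi : smooth V phi.
  apply: smooth_row => // j; case: (ord2P j) => ->.
    by apply: (smooth_eq oV) sl => q _; rewrite mk2_0.
  by apply: (smooth_eq oV) su => q _; rewrite mk2_1.
have dl i q : V q -> pd i l q = u1 * (i0 == i)%:R - u0 * (i1 == i)%:R.
  move=> Vq; rewrite /l; erewrite is_pd_val; last first.
    by apply: is_pdD; [|apply: is_pdN]; apply: is_pdM;
      [exact: is_pd_cst|exact: is_pd_smooth Vq (sx _)|exact: is_pd_cst|exact: is_pd_smooth Vq (sx _)].
  by cbv beta; rewrite !pd_coordinate; ring.
have [[w Dw] _] := uT p Vp.
have J : jac (fun q => phi q 0 i0) (fun q => phi q 0 i1) p != 0.
  rewrite (_ : (fun q => phi q 0 i0) = l); last by apply/funext => q; rewrite mk2_0.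
  rewrite (_ : (fun q => phi q 0 i1) = u); last by apply/funext => q; rewrite mk2_1.
  rewrite /jac !dl//= -/u0 -/u1.
  have -> : (u1 * 1 - u0 * 0) * u1 - (u1 * 0 - u0 * 1) * u0 = u1 ^+ 2 + u0 ^+ 2 by ring.
  apply: contra_neq Dw; move=> /eqP; rewrite paddr_eq0 ?sqr_ge0// !sqrf_eq0 => /andP[/eqP e1 /eqP e0].
  have dup := smooth_diff su Vp.
  by rewrite derive_pd// [pd i0 u p]e0 [pd i1 u p]e1 !mulr0 addr0.
have [X [X' [Xp XV [oX oX' [psi [_ spsi phiK psiK]]]]]] := inverse_function oV Vp sphi J.
have [X'p _] := phiK p Xp.
pose line (t : R) : plane := phi p + t *: mk2 1 0.
have line0 : line 0 = phi p by rewrite /line scale0r addr0.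
have [e e0 He] := nbhs_norm_ex (open_near oX' X'p).
pose I := [set` `](-e), e[] : set R.
have lineX' t : I t -> X' (line t).
  rewrite /I/= in_itv/= => /andP[t1 t2]; apply: He.
  rewrite /line addrAC subrr add0r normrZ; apply: le_lt_trans (_ : `|t| * 1 < e); last first.
    by rewrite mulr1 ltr_norml t1 t2.
  by rewrite ler_wpM2l//; apply: norm_plane_le; rewrite ?mk2_0 ?mk2_1 ?normr1 ?normr0.
have oI : open I by exact: interval_open.
have sid : smooth I (fun t : R => t) by exact: smooth_id.
have sline : smooth I line.
  apply: smooth_row => // j.
  have H : smooth I (fun t : R => phi p 0 j + t * (mk2 1 0 : plane) 0 j).
    by apply: smoothD => //; [exact: smooth_cst|apply: smoothM => //; exact: smooth_cst].
  by apply: smooth_eq oI _ H => t _; rewrite !mxE.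
pose gamma := psi \o line.
have sg : smooth I gamma by exact: (smooth_comp_row oI oX' lineX' sline spsi).
have Xg t : I t -> X (gamma t) by move=> It; have [] := psiK _ (lineX' t It).
have phig t : I t -> phi (gamma t) = line t by move=> It; have [] := psiK _ (lineX' t It).
(* Along [gamma], [l] grows at unit rate, so the velocity is nonzero, and [u] is constant, so the
   velocity is tangent. *)
have dphi t : I t -> (u1 * derive1 gamma t 0 i0 - u0 * derive1 gamma t 0 i1 = 1) /\
   'D_(derive1 gamma t) u (gamma t) = 0.
  move=> It; have Vg := XV _ (Xg t It).
  have nI : \forall s \near t, I s by exact: open_near.
  split.
    have := is_derive_comp sg sl It Vg; rewrite !dl//= !mulr0 !mulr1 subr0 sub0r => -[_].
    rewrite (near_eq_derive (g := fun s : R => l p + s)); last first.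
      by apply: filterS nI => s Is; have /rowP/(_ i0) := phig s Is; rewrite !mxE/= mulr1.
    rewrite derive_val add0r mul1r => E; apply: (etrans _ (esym E)); ring.
  have := is_derive_comp sg su It Vg => -[_].
  rewrite (near_eq_derive (g := fun s : R => u p)); last first.
    by apply: filterS nI => s Is; have /rowP/(_ i1) := phig s Is; rewrite !mxE/= mulr0 addr0.
  rewrite derive_cst => E; rewrite derive_pd; last exact: smooth_diff su Vg.
  exact: esym E.
have I0 : I 0 by rewrite /I/= in_itv/= oppr_lt0 e0.
exists (- e), e, gamma, 0; split=> //; last first.
  by rewrite /gamma/= line0; have [_] := phiK p Xp.
split.
  split=> // t It; split; first by apply: VU; apply: XV; exact: Xg.
  have [E _] := dphi t It; apply/eqP => g0; move: E; rewrite g0 !mxE !mulr0 subrr => /eqP.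
  by rewrite eq_sym oner_eq0.
move=> t It; have [_ ->] := uT _ (XV _ (Xg t It)).
by have [] := dphi t It.
Qed.

Lemma geodesic_cubic (G : connection R) a b gamma t : t \in `]a, b[ -> derive1 gamma t != 0 ->
  (exists c, acceleration G gamma t = c *: derive1 gamma t) <->
  cross (derive1 gamma t) (derive1 (derive1 gamma) t) +
    cubic (christoffel G) (gamma t) (derive1 gamma t) = 0.
Proof.
move=> tab g0; rewrite cross_eq0P//.
suff -> : cross (derive1 gamma t) (acceleration G gamma t) =
  cross (derive1 gamma t) (derive1 (derive1 gamma) t) +
    cubic (christoffel G) (gamma t) (derive1 gamma t) by [].
have accE k : acceleration G gamma t 0 k = derive1 (derive1 gamma) t 0 k +
    quad (christoffel G) k (gamma t) (derive1 gamma t).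
  rewrite /acceleration mxE summxE; congr (_ + _); apply: eq_bigr => i _.
  by rewrite summxE; apply: eq_bigr => j _; rewrite mxE.
by rewrite /cross /cubic !accE; ring.
Qed.

Lemma sub_leaf_curve U V T a b gamma : V `<=` U -> leaf_curve V T a b gamma -> leaf_curve U T a b gamma.
Proof.
move=> VU [[sg rg] Tg]; split=> //; split=> // t /rg[Vg g0]; split=> //; exact: VU.
Qed.

Definition cubic_geodesic V T g := forall a b gamma, leaf_curve V T a b gamma ->
  forall t, t \in `]a, b[ ->
  cross (derive1 gamma t) (derive1 (derive1 gamma) t) + cubic g (gamma t) (derive1 gamma t) = 0.

Lemma sub_cubic_geodesic U V T g : V `<=` U -> cubic_geodesic U T g -> cubic_geodesic V T g.
Proof. by move=> VU cg a b gamma lg; apply: cg; exact: sub_leaf_curve lg. Qed.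

Lemma geodesic_forP d U (W : web R d) (G : connection R) :
  geodesic_for U W G <-> forall i, cubic_geodesic U (W i) (christoffel G).
Proof.
split=> H i a b gamma lg t tab; have [[_ rg] _] := lg; have [_ g0] := rg t tab.
  by apply/(geodesic_cubic _ tab g0); exact: H lg t tab.
by apply/(geodesic_cubic _ tab g0); exact: H lg t tab.
Qed.

(** Along a leaf both geodesic equations contain the same term in the second derivative, so the two
    cubics agree at its velocity. The four directions at [q] are pairwise independent, which is
    enough for cubics. *)
Lemma web4_cubic_unique U (W : web R 4) g g' q : open U -> is_web U W -> U q ->
  (forall i, cubic_geodesic U (W i) g) -> (forall i, cubic_geodesic U (W i) g') ->
  forall v, cubic g q v = cubic g' q v.
Proof.
move=> oU [fW dW] Uq gW g'W.
have H i : exists v : plane, [/\ W i q v, v != 0 & cubic g q v = cubic g' q v].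
  have [a [b [gamma [t [lg tab gt]]]]] := leaf_curve_exists (fW i) Uq.
  have := gW i _ _ _ lg t tab; have := g'W i _ _ _ lg t tab; rewrite gt => E1 E2.
  have [[_ rg] Tg] := lg; exists (derive1 gamma t); split.
  - by rewrite -gt; exact: Tg.
  - by have [] := rg t tab.
  by apply: (addrI (cross (derive1 gamma t) (derive1 (derive1 gamma) t))); rewrite E1 E2.
have [v Hv] := choice H.
apply: (@cubic_unique _ _ _ _ v) => [i j ij|i]; last by have [] := Hv i.
apply/eqP => c0; have [vi vi0 _] := Hv i; have [vj vj0 _] := Hv j.
apply: (dW i j q ij Uq); apply/funext => x; apply/propext.
have [w w0 Ww] := foliation_tangent (fW i) Uq.
have [w' w'0 Ww'] := foliation_tangent (fW j) Uq.
rewrite Ww Ww'.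
have wi : cross w (v i) = 0 by exact/Ww.
have wj : cross w' (v j) = 0 by exact/Ww'.
have crossC (y z : plane) : cross y z = 0 -> cross z y = 0.
  by rewrite /cross => E; rewrite -[RHS]oppr0 -E; ring.
have c0' := crossC _ _ c0.
split=> C.
  have h1 := cross0_trans w0 wi C.
  have h2 : cross (v j) x = 0 := cross0_trans vi0 c0 h1.
  exact: cross0_trans vj0 (crossC _ _ wj) h2.
have h1 := cross0_trans w'0 wj C.
have h2 : cross (v i) x = 0 := cross0_trans vj0 c0' h1.
exact: cross0_trans vi0 (crossC _ _ wi) h2.
Qed.

Lemma sub_web d U V (W : web R d) : open V -> V `<=` U -> is_web U W -> is_web V W.
Proof.
move=> oV VU [fW dW]; split=> [i|i j p ij /VU]; first exact: sub_foliation (fW i).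
exact: dW.
Qed.

Lemma subweb_web d U (W : web R d) (s : 'I_4 -> 'I_d) : injective s -> is_web U W ->
  is_web U (subweb W s).
Proof.
move=> si [fW dW]; split=> [i|i j p ij]; first exact: fW.
by apply: dW; rewrite (inj_eq si).
Qed.

End Foliations.

Section TorsionFree.
Context {R : realType}.
Local Notation plane := 'rV[R]_2.

Lemma torsion_free_sym (U : set plane) (G : connection R) : torsion_free_connection U G ->
  forall i j k q, U q -> christoffel G i j k q = christoffel G j i k q.
Proof.
move=> [sG tG] i j k q Uq.
have se l : smooth U (cst (delta_mx 0 l) : plane -> plane) by exact: smooth_cst.
have := tG _ _ (se i) (se j) q Uq.
rewrite /nabla /lie_bracket !derive_cst subrr !add0r => /eqP; rewrite subr_eq0 => /eqP/rowP/(_ k).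
rewrite !sum2 !mxE /christoffel.
by case: (ord2P i) => ->; case: (ord2P j) => -> /=;
rewrite !(mul0r, mul1r, mulr0, mulr1, add0r, addr0).
Qed.

Lemma sym_torsion_free (U : set plane) (G : connection R) : (forall i j, smooth U (G i j)) ->
  (forall i j q, U q -> G i j q = G j i q) -> torsion_free_connection U G.
Proof.
move=> sG tG; split=> // X Y sX sY p Up; rewrite /nabla /lie_bracket opprD addrACA.
rewrite -[RHS]addr0; congr (_ + _); rewrite !sum2 (tG i1 i0)//.
apply/rowP => k; rewrite !mxE; ring.
Qed.

End TorsionFree.

(** * Projectively flat connections are linearizable *)

Section Tractor.
Context {R : realType}.
Local Notation plane := 'rV[R]_2.

Lemma tr_thomas (g : symbols (R := R)) j q : tr_symbols (thomas g) j q = 0.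
Proof.
rewrite /tr_symbols sum2 /thomas /tr_symbols !sum2 /=.
by case: (ord2P j) => -> /=; field.
Qed.

Lemma thomas_sym (g : symbols (R := R)) i j k q : g i j k q = g j i k q ->
  thomas g i j k q = thomas g j i k q.
Proof. by rewrite /thomas => ->; ring. Qed.

Variables (U : set plane) (g : symbols (R := R)).
Hypotheses (oU : open U) (sg : forall i j k, smooth U (g i j k)).
Hypothesis symg : forall i j k q, U q -> g i j k q = g j i k q.
Hypothesis trg : forall j q, U q -> tr_symbols g j q = 0.
Hypothesis Lg : forall l q, U q -> Lv g l q = 0.

Let trg' j q : U q -> g i1 j i1 q = - g i0 j i0 q.
Proof. by move=> Uq; apply/eqP; rewrite -addr_eq0 addrC -[X in X == 0](sum2 (fun l => g l j l q)); apply/eqP; exact: trg. Qed.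

Let dtrg a j q : U q -> pd a (g i1 j i1) q = - pd a (g i0 j i0) q.
Proof.
move=> Uq; rewrite (pd_eq a oU Uq (fun q => @trg' j q)).
by apply: is_pd_val; apply: is_pdN; exact: is_pd_smooth Uq (sg _ _ _).
Qed.

Let dsym a k q : U q -> pd a (g i1 i0 k) q = pd a (g i0 i1 k) q.
Proof. by move=> Uq; apply: (pd_eq a oU Uq) => r Ur; exact: symg. Qed.

(** For symmetric symbols the antisymmetric part of the Ricci tensor is, up to a factor, the
    exterior derivative of the trace, which vanishes here. *)
Lemma Ric_sym j l q : U q -> Ric g j l q = Ric g l j q.
Proof.
move=> Uq.
suff H : Ric g i0 i1 q = Ric g i1 i0 q by case: (ord2P j) => ->; case: (ord2P l) => ->.
rewrite /Ric /Rm !sum2 -!(dsym _ _ Uq) !(dtrg _ _ Uq) -!(dsym _ _ Uq).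
rewrite !(@symg i0 i1 _ q Uq) !(trg' _ Uq) !(@symg i0 i1 _ q Uq).
ring.
Qed.

Lemma Sch_Ric j l q : U q -> Sch g j l q = Ric g j l q.
Proof. by move=> Uq; rewrite /Sch (Ric_sym l j Uq); field. Qed.

(** In dimension two the Ricci tensor determines the whole curvature, so no Weyl part remains. *)
Lemma curvature_plane k m q : U q ->
  Rm g i0 i1 k m q = Sch g i1 k q * (i0 == m)%:R - Sch g i0 k q * (i1 == m)%:R.
Proof.
move=> Uq; rewrite !Sch_Ric// /Ric !sum2 /Rm !sum2.
by case: (ord2P m) => -> /=; ring.
Qed.

(* The rank three linear system satisfied by [s] and its two partial derivatives:
   [d_i d_j s = g_ij^k d_k s - Sch_ij s]. *)
Definition tractor (i : 'I_2) (k l : 'I_3) (q : plane) : R :=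
  match unlift ord0 k, unlift ord0 l with
  | None, None => 0
  | None, Some m => (i == m)%:R
  | Some j, None => - Sch g i j q
  | Some j, Some m => g i j m q
  end.

Lemma smooth_tractor i k l : smooth U (tractor i k l).
Proof.
rewrite /tractor; case: unliftP => [j _|_]; case: unliftP => [m _|_].
- exact: sg.
- by apply: smoothN => //; rewrite /Sch /Ric /Rm; smt.
- exact: smooth_cst.
- exact: smooth_cst.
Qed.

(** The four blocks of the curvature of the system vanish for different reasons: [curvature_plane]
    for two derivative indices, the Liouville tensor for a derivative row and the column of [s],
    symmetry of [g] and symmetry of the Ricci tensor for the row of [s]. *)
Lemma tractor_flat q k l : U q ->
  pd i0 (tractor i1 k l) q + \sum_m tractor i1 k m q * tractor i0 m l q =
  pd i1 (tractor i0 k l) q + \sum_m tractor i0 k m q * tractor i1 m l q.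
Proof.
move=> Uq.
have sum3' (F : 'I_3 -> R) : \sum_i F i = F ord0 + F (lift ord0 i0) + F (lift ord0 i1).
  exact: sum3.
have sS a b : smooth U (Sch g a b) by rewrite /Sch /Ric /Rm; smt.
have pdS a b c : pd a (fun q => - Sch g b c q) q = - pd a (Sch g b c) q.
  by apply: is_pd_val; apply: is_pdN; exact: is_pd_smooth Uq (sS _ _).
have pdc a (u : R) : pd a (fun _ => u) q = 0 by have [] := is_pd_cst a q u.
rewrite !sum3' /tractor.
case: (unliftP ord0 k) => [j _|_]; case: (unliftP ord0 l) => [m _|_];
  rewrite ?liftK ?unlift_none.
- have := curvature_plane j m Uq; rewrite /Rm !sum2 => E.
  apply/eqP; rewrite -subr_eq0; apply/eqP.
  transitivity ((pd i0 (g i1 j m) q - pd i1 (g i0 j m) q +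
   (g i1 j i0 q * g i0 i0 m q - g i0 j i0 q * g i1 i0 m q +
   (g i1 j i1 q * g i0 i1 m q - g i0 j i1 q * g i1 i1 m q))) -
   (Sch g i1 j q * (i0 == m)%:R - Sch g i0 j q * (i1 == m)%:R)); first by ring.
  by rewrite E subrr.
- rewrite !pdS; have E := Lg j Uq.
  apply/eqP; rewrite -subr_eq0; apply/eqP.
  transitivity (- Lv g j q); first by rewrite /Lv !sum2; ring.
  by rewrite E oppr0.
- rewrite !pdc; case: (ord2P m) => -> /=; rewrite ?(@symg i0 i1 _ q Uq); ring.
- rewrite !pdc /= !Sch_Ric// (Ric_sym i0 i1 Uq); ring.
Qed.

(** The three solutions whose initial values are the standard basis. They will be homogeneous
    coordinates in which geodesics become lines. *)
Lemma projective_coordinates p : U p -> exists (V : set plane) (s : 'I_3 -> plane -> R),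
  [/\ open V, V p, V `<=` U, forall m, smooth V (s m) & 
   [/\ forall m q i j, V q -> pd i (pd j (s m)) q = \sum_k g i j k q * pd k (s m) q - Sch g i j q * s m q,
   forall m, s m p = (m == ord0)%:R & forall m i, pd i (s m) p = (m == lift ord0 i)%:R]].
Proof.
move=> Up.
have [V [oV Vp VU HV]] := linear_system_flat oU Up smooth_tractor tractor_flat.
have [F HF] := choice (fun m : 'I_3 => HV (fun k => (m == k)%:R)).
exists V, (fun m => F m ord0).
have Fp m k : F m k p = (m == k)%:R by have [] := HF m.
have sF m k : smooth V (F m k) by have [] := HF m.
have pF m i q : V q -> pd i (F m ord0) q = F m (lift ord0 i) q.
  move=> Vq; have [_ _ ->//] := HF m; rewrite (sum3 (fun l => tractor i ord0 l q * F m l q)).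
  rewrite /tractor unlift_none -[k1]/(lift ord0 i0) -[k2]/(lift ord0 i1) !liftK.
  by case: (ord2P i) => -> /=; rewrite !(mul0r, mul1r, add0r, addr0).
split=> //; split=> [m q i j Vq|m|m i]; last 2 first.
- exact: Fp.
- by rewrite pF.
rewrite (pd_eq i oV Vq (fun q => @pF m j q)); have [_ _ ->//] := HF m.
rewrite (sum3 (fun l => tractor i (lift ord0 j) l q * F m l q)).
rewrite /tractor unlift_none -[k1]/(lift ord0 i0) -[k2]/(lift ord0 i1) !liftK.
rewrite sum2 !pF//; ring.
Qed.

End Tractor.

(** * Scalar linear equations on an open interval *)

Section ScalarODE.
Context {R : realType}.

Lemma in_oo_sub (a b s t u : R) : s \in `]a, b[ -> t \in `]a, b[ -> u \in `[s, t] -> u \in `]a, b[.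
Proof.
rewrite !in_itv/= => /andP[s1 _] /andP[_ t2] /andP[u1 u2].
by rewrite (lt_le_trans s1 u1) (le_lt_trans u2 t2).
Qed.

Lemma is_derive_uniq (f g : R -> R) (t a b : R) : is_derive t (1 : R) f a ->
  is_derive t (1 : R) g b -> f =1 g -> a = b.
Proof. by move=> [_ <-] [_ <-] /funext ->. Qed.

Lemma derive0_cst (f : R -> R) (a b : R) :
  (forall t : R, t \in `]a, b[ -> is_derive t (1 : R) f 0) ->
  forall s t, s \in `]a, b[ -> t \in `]a, b[ -> f s = f t.
Proof.
move=> D; have H (s t : R) : s \in `]a, b[ -> t \in `]a, b[ -> s < t -> f s = f t.
  move=> sab tab st.
  have [c _] := MVT_cc st (fun u (uu : u \in `[s, t]) => D u (in_oo_sub sab tab uu)).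
  by rewrite mul0r => /eqP; rewrite subr_eq0 => /eqP.
move=> s t sab tab; have [st|ts|->//] := ltgtP s t; first exact: H.
by apply/esym; exact: H.
Qed.

(** Integrating factor: [z] times the exponential of minus a primitive of [c] is constant. *)
Lemma linear_ode_zero (c z : R -> R) (a b t0 : R) :
  (forall t, t \in `]a, b[ -> {for t, continuous c}) ->
  (forall t : R, t \in `]a, b[ -> is_derive t (1 : R) z (c t * z t)) ->
  t0 \in `]a, b[ -> z t0 = 0 -> forall t, t \in `]a, b[ -> z t = 0.
Proof.
move=> cc dz t0ab z0 t tab.
(* [c] is continuous only inside the interval. Between [l] and [r], which enclose [t0] and [t], it
   coincides with [c \o k], continuous on the line and hence with a primitive. *)
pose l := (a + Num.min t0 t) / 2; pose r := (b + Num.max t0 t) / 2.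
have [[lt0 lt] [rt0 rt]] : (l < t0 /\ l < t) /\ (t0 < r /\ t < r).
  move: t0ab tab; rewrite /l /r !in_itv/= => /andP[? ?] /andP[? ?].
  by case: (ltP t0 t) => ?; lra.
have [al rb] : a < l /\ r < b.
  move: t0ab tab; rewrite /l /r !in_itv/= => /andP[? ?] /andP[? ?].
  by case: (ltP t0 t) => ?; lra.
pose k s := Num.max l (Num.min s r).
have kab s : k s \in `]a, b[.
  rewrite in_itv/= /k lt_max al/= gt_max ; apply/andP; split; first by lra.
  by rewrite gt_min rb orbT.
have kid s : s \in `]l, r[ -> k s = s.
  by rewrite in_itv/= /k => /andP[/ltW s1 /ltW s2]; rewrite (min_idPl s2) (max_idPr s1).
have ck : continuous k.
  move=> s; rewrite (_ : k = ((cst l : R -> R^o) \max ((id : R -> R^o) \min (cst r : R -> R^o))))//.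
  have c0 : {for s, continuous (cst l : R -> R^o)} by exact: cvg_cst.
  have c1 : {for s, continuous (cst r : R -> R^o)} by exact: cvg_cst.
  have ci : {for s, continuous (id : R -> R^o)} by exact: cvg_id.
  exact: continuous_max c0 (continuous_min ci c1).
have cck : continuous (c \o k).
  by move=> s; apply: continuous_comp; [exact: ck|exact/cc/kab].
have [F dF] := antiderivative l r cck.
have sub (s : R) : s \in `]l, r[ -> s \in `]a, b[ by move=> sl; rewrite -(kid s sl); exact: kab.
have dw (s : R) : s \in `]l, r[ -> is_derive s (1 : R) (fun u => z u * expR (- F u)) 0.
  move=> sl.
  have dF' : is_derive s (1 : R) (fun u => - F u) (- c s).
    by have := dF s sl; rewrite /= kid// => dFs; exact: is_deriveN.
  have de : is_derive s (1 : R) (fun u => expR (- F u)) (- c s * expR (- F s)).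
    have H := @is_derive1_comp R expR (fun u => - F u) s _ _ (is_derive_expR (- F s)) dF'.
    by apply: (is_derive_eq_val H); rewrite mulrC.
  by apply: (is_derive_eq_val (is_deriveM_fun (dz s (sub s sl)) de)); ring.
have t0l : t0 \in `]l, r[ by rewrite in_itv/= lt0 rt0.
have tl : t \in `]l, r[ by rewrite in_itv/= lt rt.
have := derive0_cst dw tl t0l; rewrite z0 mul0r => /eqP.
by rewrite mulf_eq0 => /orP[/eqP//|]; rewrite gt_eqF// expR_gt0.
Qed.

End ScalarODE.

(** * Quotients of solutions straighten geodesics *)

Section Straightening.
Context {R : realType}.
Local Notation plane := 'rV[R]_2.
Variables (V : set plane) (g : symbols (R := R)) (P : 'I_2 -> 'I_2 -> plane -> R).
Variable s : 'I_3 -> plane -> R.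
Hypotheses (oV : open V) (sg : forall i j k, smooth V (g i j k)).
Hypothesis ss : forall m, smooth V (s m).
Hypothesis Es : forall m q i j, V q ->
  pd i (pd j (s m)) q = \sum_k g i j k q * pd k (s m) q - P i j q * s m q.
Hypothesis s0 : forall q, V q -> s ord0 q != 0.

Definition ratio_map (q : plane) : plane := mk2 (s k1 q / s k0 q) (s k2 q / s k0 q).

Lemma smooth_ratio_map : smooth V ratio_map.
Proof.
have sV : smooth V (fun q => (s k0 q)^-1) by apply: smoothV => //; exact: s0.
apply: smooth_row => // j; case: (ord2P j) => ->.
  have H : smooth V (fun q => s k1 q * (s k0 q)^-1) by smt.
  by apply: smooth_eq oV _ H => q _; rewrite mk2_0.
have H : smooth V (fun q => s k2 q * (s k0 q)^-1) by smt.
by apply: smooth_eq oV _ H => q _; rewrite mk2_1.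
Qed.

Variables (a b : R) (gamma : R -> plane).
Local Notation I := ([set` `]a, b[] : set R).
Hypotheses (sgam : smooth I gamma) (Vgam : forall t, t \in `]a, b[ -> V (gamma t)).
Hypothesis dgam : forall t, t \in `]a, b[ -> derive1 gamma t != 0.
Hypothesis geo : forall t, t \in `]a, b[ ->
  cross (derive1 gamma t) (derive1 (derive1 gamma) t) + cubic g (gamma t) (derive1 gamma t) = 0.

Let v i t := derive1 gamma t 0 i.
Let v' i t := derive1 (derive1 gamma) t 0 i.
Let acc k t := v' k t + quad g k (gamma t) (derive1 gamma t).
(** The geodesic equation makes the acceleration a multiple of the velocity at each time; this
    quotient of inner products is a formula for the factor that shows its continuity. *)
Let c t := (acc i0 t * v i0 t + acc i1 t * v i1 t) / (v i0 t ^+ 2 + v i1 t ^+ 2).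

Let nv t : t \in `]a, b[ -> v i0 t ^+ 2 + v i1 t ^+ 2 != 0.
Proof.
move=> /dgam; apply: contra_neq => /eqP; rewrite paddr_eq0 ?sqr_ge0// !sqrf_eq0 => /andP[/eqP e0 /eqP e1].
by apply: plane_eqP; rewrite mxE.
Qed.

Let acc_parallel k t : t \in `]a, b[ -> acc k t = c t * v k t.
Proof.
move=> tab.
have E : v i0 t * acc i1 t = v i1 t * acc i0 t.
  apply/eqP; rewrite -subr_eq0; apply/eqP; rewrite -(geo tab) /cross /cubic /acc -/(v i0 t) -/(v i1 t).
  by rewrite -/(v' i0 t) -/(v' i1 t); ring.
apply: (mulIf (nv tab)); rewrite /c.
have n := nv tab.
have -> : forall x y z : R, z != 0 -> x / z * y * z = x * y by move=> x y z z0; field.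
  case: (ord2P k) => ->.
    transitivity (acc i0 t * v i0 t * v i0 t + v i1 t * (v i1 t * acc i0 t)); first by ring.
    by rewrite -E; ring.
  transitivity (acc i1 t * v i1 t * v i1 t + v i0 t * (v i0 t * acc i1 t)); first by ring.
  by rewrite E; ring.
exact: n.
Qed.

Let oI : open I. Proof. exact: interval_open. Qed.
Let sv i : smooth I (v i).
Proof. by apply: smooth_coord => //; exact: smooth_derive1. Qed.
Let sv' i : smooth I (v' i).
Proof. by apply: smooth_coord => //; apply: smooth_derive1; exact: smooth_derive1. Qed.

Let c_continuous t : t \in `]a, b[ -> {for t, continuous c}.
Proof.
have sgg i j k : smooth I (fun t => g i j k (gamma t)).
  exact: (smooth_comp oI oV Vgam sgam (sg i j k)).
have sn : smooth I (fun t => (v i0 t * v i0 t + v i1 t * v i1 t)^-1).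
  apply: (smoothV oI); last exact: smoothD oI (smoothM oI (sv i0) (sv i0)) (smoothM oI (sv i1) (sv i1)).
  by move=> u uab; rewrite -!expr2; exact: nv.
have sq k : smooth I (fun t => quad g k (gamma t) (derive1 gamma t)).
  apply: (smooth_sum oI) => i; apply: (smooth_sum oI) => j.
  exact: smoothM oI (smoothM oI (sv i) (sv j)) (sgg i j k).
have sc : smooth I c.
  have H : smooth I (fun t => ((v' i0 t + quad g i0 (gamma t) (derive1 gamma t)) * v i0 t
    + (v' i1 t + quad g i1 (gamma t) (derive1 gamma t)) * v i1 t) *
     (v i0 t * v i0 t + v i1 t * v i1 t)^-1).
    have sa k := smoothD oI (sv' k) (sq k).
    exact: smoothM oI (smoothD oI (smoothM oI (sa i0) (sv i0)) (smoothM oI (sa i1) (sv i1))) sn.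
  by apply: smooth_eq oI _ H => u _; rewrite /c /acc !expr2.
by move=> tab; exact: (sc 0%N t tab).
Qed.

Let S m t := s m (gamma t).
Let S' m t := v i0 t * pd i0 (s m) (gamma t) + v i1 t * pd i1 (s m) (gamma t).
Let rho t := \sum_i \sum_j v i t * v j t * P i j (gamma t).

Let dS m (t : R) : t \in `]a, b[ -> is_derive t (1 : R) (S m) (S' m t).
Proof. by move=> tab; exact: (is_derive_eq_val (is_derive_comp sgam (ss m) tab (Vgam tab))). Qed.

(** The second derivatives of [s] are replaced by the linear system; its first order terms complete
    the acceleration, which is [c] times the velocity. As [c] and [rho] are the same for all [m],
    Wronskians lose the term in [rho]. *)
Let dS' m (t : R) : t \in `]a, b[ -> is_derive t (1 : R) (S' m) (c t * S' m t - rho t * S m t).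
Proof.
move=> tab.
have dv i : is_derive t (1 : R) (v i) (v' i t).
  exact: (is_derive_coord (smooth_derive1 sgam) i tab).
have dp i := is_derive_comp sgam (smooth_pd i (ss m)) tab (Vgam tab).
have D := is_deriveD_fun (is_deriveM_fun (dv i0) (dp i0)) (is_deriveM_fun (dv i1) (dp i1)).
apply: (is_derive_eq_val D).
have -> : c t * S' m t = (c t * v i0 t) * pd i0 (s m) (gamma t) + (c t * v i1 t) * pd i1 (s m) (gamma t).
  by rewrite /S'; ring.
rewrite -!acc_parallel// /acc /rho /quad /S -/(v i0 t) -/(v i1 t) !sum2 !Es ?sum2; try exact: Vgam.
rewrite -/(v i0 t) -/(v i1 t); ring.
Qed.

Let w m t := S' m t * S k0 t - S m t * S' k0 t.

Let dw m (t : R) : t \in `]a, b[ -> is_derive t (1 : R) (w m) (c t * w m t).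
Proof.
move=> tab; apply: (is_derive_eq_val (is_deriveB_fun (is_deriveM_fun (dS' m tab) (dS k0 tab))
  (is_deriveM_fun (dS m tab) (dS' k0 tab)))).
by rewrite /w; ring.
Qed.

Let dratio m (t : R) : t \in `]a, b[ -> is_derive t (1 : R) (fun u => S m u / S k0 u) (w m t / S k0 t ^+ 2).
Proof.
move=> tab; have n0 : S k0 t != 0 by exact/s0/Vgam.
have [dd DD] := dS k0 tab.
have dV : is_derive t (1 : R) (fun u => (S k0 u)^-1) (- S' k0 t / S k0 t ^+ 2).
  apply: DeriveDef; first exact: derivableV.
  by rewrite deriveV// DD /GRing.scale/= mulrC mulrN mulNr.
apply: (is_derive_eq_val (is_deriveM_fun (dS m tab) dV)).
by rewrite /w; field.
Qed.

Lemma ratio_map_straight t0 t : t0 \in `]a, b[ -> t \in `]a, b[ ->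
  cross (derive1 (ratio_map \o gamma) t0) (ratio_map (gamma t) - ratio_map (gamma t0)) = 0.
Proof.
move=> t0ab tab.
(* The Wronskians [w] all satisfy [w' = c w], hence stay proportional. *)
pose z u := w k1 t0 * w k2 u - w k2 t0 * w k1 u.
have zt0 : z t0 = 0 by rewrite /z mulrC subrr.
have dz (u : R) : u \in `]a, b[ -> is_derive u (1 : R) z (c u * z u).
  move=> uab; have D := is_deriveB_fun
    (is_deriveM_fun (is_derive_cst_fun (w k1 t0) u) (dw k2 uab))
    (is_deriveM_fun (is_derive_cst_fun (w k2 t0) u) (dw k1 uab)).
  by apply: (is_derive_eq_val D); rewrite /z; ring.
have z_0 := linear_ode_zero c_continuous dz t0ab zt0.
have dr (u : R) : u \in `]a, b[ ->
    is_derive u (1 : R) (fun x => w k1 t0 * (S k2 x / S k0 x) - w k2 t0 * (S k1 x / S k0 x)) 0.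
  move=> uab; have D := is_deriveB_fun
    (is_deriveM_fun (is_derive_cst_fun (w k1 t0) u) (dratio k2 uab))
    (is_deriveM_fun (is_derive_cst_fun (w k2 t0) u) (dratio k1 uab)).
  apply: (is_derive_eq_val D).
  transitivity (z u / S k0 u ^+ 2); last by rewrite z_0// mul0r.
  by rewrite /z; ring.
have E := derive0_cst dr tab t0ab.
have sr := smooth_comp_row oI oV Vgam sgam smooth_ratio_map.
have d0 : derive1 (ratio_map \o gamma) t0 0 i0 = w k1 t0 / S k0 t0 ^+ 2.
  by apply: is_derive_uniq (is_derive_coord sr i0 t0ab) (dratio k1 t0ab) _ => u; exact: mk2_0.
have d1 : derive1 (ratio_map \o gamma) t0 0 i1 = w k2 t0 / S k0 t0 ^+ 2.
  by apply: is_derive_uniq (is_derive_coord sr i1 t0ab) (dratio k2 t0ab) _ => u; exact: mk2_1.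
have rowB' (x y : plane) k : (x - y) 0 k = x 0 k - y 0 k by rewrite !mxE.
rewrite /cross d0 d1 !rowB' !mk2_0 !mk2_1.
transitivity ((w k1 t0 * (S k2 t / S k0 t) - w k2 t0 * (S k1 t / S k0 t)
  - (w k1 t0 * (S k2 t0 / S k0 t0) - w k2 t0 * (S k1 t0 / S k0 t0))) / S k0 t0 ^+ 2).
  by rewrite /S; ring.
by rewrite E subrr mul0r.
Qed.

End Straightening.

(** * Image of a web under a diffeomorphism *)

Section Pushforward.
Context {R : realType}.
Local Notation plane := 'rV[R]_2.

Lemma derive_inverse (V V' : set plane) (phi psi : plane -> plane) p v : open V -> V p ->
  smooth V phi -> smooth V' psi -> (forall q, V q -> V' (phi q) /\ psi (phi q) = q) ->
  'D_('D_v phi p) psi (phi p) = v.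
Proof.
move=> oV Vp sphi spsi K; have [V'p _] := K p Vp.
rewrite -derive_comp_diff; [|exact: smooth_diff sphi Vp|exact: smooth_diff spsi V'p].
rewrite (near_eq_derive (g := id)) ?derive_id//.
by apply: filterS (open_near oV Vp) => q /K[].
Qed.

Lemma open_preimage (V0 W0 : normedModType R) (V : set V0) (W : set W0) (f : V0 -> W0) :
  open V -> open W -> smooth V f -> open [set q | V q /\ W (f q)].
Proof.
move=> oV oW sf; rewrite openE => q [Vq Wq].
have := sf 0%N q Vq (W); move=> /(_ (open_near oW Wq)) H.
by apply: filterS (filterI (open_near oV Vq) H) => x [].
Qed.

Variables (d : nat) (U V V' : set plane) (W : web R d) (phi psi : plane -> plane).
Hypotheses (oV : open V) (oV' : open V') (VU : V `<=` U) (hW : is_web U W).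
Hypotheses (sphi : smooth V phi) (spsi : smooth V' psi).
Hypothesis phiK : forall p, V p -> V' (phi p) /\ psi (phi p) = p.
Hypothesis psiK : forall q, V' q -> V (psi q) /\ phi (psi q) = q.

Definition push_web : web R d := fun i q => [set 'D_v phi (psi q) | v in W i (psi q)].

Let pullK q v : V' q -> 'D_('D_v phi (psi q)) psi q = v.
Proof.
move=> V'q; have [Vq phiq] := psiK V'q.
by have := derive_inverse v oV Vq sphi spsi phiK; rewrite phiq.
Qed.

Lemma push_webE i q w : V' q -> push_web i q w <-> W i (psi q) ('D_w psi q).
Proof.
move=> V'q; split=> [[v Wv <-]|Ww]; first by rewrite pullK.
exists ('D_w psi q) => //; exact: (derive_inverse w oV' V'q spsi sphi psiK).
Qed.

Lemma push_web_web : is_web V' push_web.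
Proof.
have [fW dW] := hW; split=> [i q V'q|i j q ij V'q].
  have [Vq phiq] := psiK V'q.
  have [V0 [u [[oV0 V0q] V0U su uT]]] := fW i _ (VU Vq).
  exists [set x | V' x /\ V0 (psi x)], (u \o psi).
  have oX := open_preimage oV' oV0 spsi.
  have sX : smooth [set x | V' x /\ V0 (psi x)] psi by apply: sub_smooth spsi => x [].
  split; [by split|by move=> x []| |].
    by apply: (smooth_comp oX oV0 _ sX su) => x [].
  move=> x [V'x V0x]; have [Vx phix] := psiK V'x.
  have dpsi := smooth_diff spsi V'x; have du := smooth_diff su V0x.
  have [[v Dv] Tx] := uT _ V0x; split.
    exists ('D_v phi (psi x)); rewrite (derive_comp_diff _ dpsi du).
    by rewrite pullK.
  apply/funext => w; apply/propext; rewrite (push_webE _ _ V'x) Tx /=.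
  by rewrite (derive_comp_diff w dpsi du).
move=> E; have [Vq phiq] := psiK V'q; apply: (dW i j _ ij (VU Vq)).
have H k v : W k (psi q) v <-> push_web k q ('D_v phi (psi q)).
  by rewrite push_webE// pullK.
by apply/funext => v; apply/propext; rewrite !H E.
Qed.

Lemma maps_push_web : maps_web V W push_web phi.
Proof.
by exists 1%g => i p Vp; rewrite perm1 /push_web; have [_ ->] := phiK Vp.
Qed.

End Pushforward.

Section Linearizable.
Context {R : realType}.
Local Notation plane := 'rV[R]_2.

Lemma liouville_Lv (U : set plane) (G : connection R) : open U -> torsion_free_connection U G ->
  (forall X Y Z : plane -> plane, smooth U X -> smooth U Y -> smooth U Z ->
    forall p, U p -> liouville G X Y Z p = 0) ->
  forall l q, U q -> Lv (christoffel G) l q = 0.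
Proof.
move=> oU tG LG l q Uq.
have se i : smooth U (cst (delta_mx 0 i) : plane -> plane) by exact: smooth_cst.
have := LG _ _ _ (se i0) (se i1) (se l) q Uq.
rewrite (liouvilleE oU tG.1 (torsion_free_sym tG) Uq (se i0) (se i1) (se l)) !sum2 !mxE /=.
by case: (ord2P l) => -> /=; rewrite !(mul0r, mul1r, mulr0, subr0, addr0, add0r).
Qed.

Lemma flat_linearizable d (U : set plane) (W : web R d) (g : symbols (R := R)) : open U ->
  is_web U W -> (forall i j k, smooth U (g i j k)) ->
  (forall i j k q, U q -> g i j k q = g j i k q) ->
  (forall l q, U q -> Lv g l q = 0) ->
  (forall i, cubic_geodesic U (W i) g) -> linearizable U W.
Proof.
move=> oU hW sg symg Lg geo p Up.
have st := smooth_thomas oU sg.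
have symt i j k q : U q -> thomas g i j k q = thomas g j i k q.
  by move=> Uq; apply: thomas_sym; exact: symg.
have Lt l q : U q -> Lv (thomas g) l q = 0.
  by move=> Uq; rewrite (Lv_thomas oU Uq sg symg); exact: Lg.
have [V0 [s [oV0 V0p V0U ss [Es sp dsp]]]] := projective_coordinates oU st symt
  (fun j q _ => tr_thomas g j q) Lt Up.
have oN : open [set x : R | x != 0].
  rewrite (_ : [set x : R | x != 0] = ~` [set 0]); last first.
    by apply/funext => x; apply/propext; split=> [/eqP|/eqP].
  by apply: closed_openC; exact: closed_eq.
(* The quotients by [s ord0] are defined where it does not vanish, which includes [p] because its
   value there is 1. *)
pose V1 := [set q | V0 q /\ [set x : R | x != 0] (s ord0 q)].
have oV1 : open V1 by exact: (@open_preimage R plane R V0 _ (s ord0) oV0 oN (ss ord0)).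
have V1V0 : V1 `<=` V0 by move=> q [].
have V1U : V1 `<=` U by move=> q /V1V0/V0U.
have V1p : V1 p by split=> //=; rewrite sp oner_eq0.
have ss1 m : smooth V1 (s m) by exact: sub_smooth V1V0 (ss m).
have s01 q : V1 q -> s ord0 q != 0 by case.
pose phi := ratio_map s.
have sphi : smooth V1 phi by exact: smooth_ratio_map.
have J : jac (fun q => phi q 0 i0) (fun q => phi q 0 i1) p != 0.
  (* At [p] the denominator is 1 and its differential is 0, so the Jacobian matrix of [phi] is the
     identity. *)
  have dr m i : m != ord0 -> pd i (fun q => s m q / s ord0 q) p = (m == lift ord0 i)%:R.
    move=> m0.
    have dV : is_pd i p (fun q => (s ord0 q)^-1) (- (s ord0 p) ^- 2 * pd i (s ord0) p).
      have dd := smooth_diff (ss1 ord0) V1p; split.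
        by apply: differentiableV => //; exact: s01.
      by rewrite -pdE deriveV ?pdE//; [exact: s01|exact: diff_derivable].
    rewrite (is_pd_val (is_pdM (is_pd_smooth i V1p (ss1 m)) dV)) !sp !dsp (negbTE m0) eqxx.
    by rewrite mul0r addr0 invr1 mulr1.
  rewrite (_ : (fun q => phi q 0 i0) = (fun q => s k1 q / s ord0 q)); last first.
    by apply/funext => q; rewrite mk2_0.
  rewrite (_ : (fun q => phi q 0 i1) = (fun q => s k2 q / s ord0 q)); last first.
    by apply/funext => q; rewrite mk2_1.
  by rewrite /jac !dr//= mulr0 subr0 mulr1 oner_eq0.
have [V [V' [Vp VV1 dphi]]] := inverse_function oV1 V1p sphi J.
have [oV oV' [psi [sphiV spsi phiK psiK]]] := dphi.
have VU : V `<=` U by exact: subset_trans V1U.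
exists V, V', phi, (push_web W phi psi); split=> //.
- exact: (push_web_web oV oV' VU hW sphiV spsi phiK psiK).
- move=> i q V'q.
  have hW' := push_web_web oV oV' VU hW sphiV spsi phiK psiK.
  have [v v0 Tv] := foliation_tangent (hW'.1 i) V'q.
  exists v => // q' [a [b [del [s1 [s2 [[[sdel rdel] Tdel] s1ab s2ab e1 e2]]]]]].
  have oI : open ([set` `]a, b[] : set R) by exact: interval_open.
  (* A leaf of the image web is pulled back to a leaf of [W], a geodesic, whose image under [phi]
     lies on its tangent line. *)
  pose gam := psi \o del.
  have V'del t : t \in `]a, b[ -> V' (del t) by move=> /rdel[].
  have sgam : smooth [set` `]a, b[] gam by exact: (smooth_comp_row oI oV' V'del sdel spsi).
  have Vgam t : t \in `]a, b[ -> V (gam t) by move=> /V'del/psiK[].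
  have dgamE t : t \in `]a, b[ -> derive1 gam t = 'D_(derive1 del t) psi (del t).
    move=> tab; rewrite !derive1E derive_comp_diff//; first exact: smooth_diff sdel _.
    exact: smooth_diff spsi (V'del t tab).
  have lgam : leaf_curve U (W i) a b gam.
    split; first (split; [exact: sgam|move=> t tab]).
      split; first exact/VU/Vgam.
      rewrite dgamE//; have [_] := rdel t tab; apply: contra_neq => E.
      rewrite -(derive_inverse (derive1 del t) oV' (V'del t tab) spsi sphiV psiK) E.
      by rewrite derive0.
    move=> t tab; rewrite dgamE//.
    by apply/(push_webE W oV oV' sphiV spsi phiK psiK i _ (V'del t tab)); exact: Tdel.
  have geot t : t \in `]a, b[ -> cross (derive1 gam t) (derive1 (derive1 gam) t) +
      cubic (thomas g) (gam t) (derive1 gam t) = 0.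
    by move=> tab; rewrite cubic_thomas; exact: geo lgam t tab.
  have V1gam t : t \in `]a, b[ -> V1 (gam t) by move=> /Vgam/VV1.
  have st1 i' j k : smooth V1 (thomas g i' j k) by exact: sub_smooth V1U (st i' j k).
  have phigam t : t \in `]a, b[ -> phi (gam t) = del t by move=> /V'del/psiK[].
  have := ratio_map_straight oV1 st1 ss1 (fun m q i j V1q => Es m q i j (V1V0 q V1q)) s01
    sgam V1gam (fun t tab => (lgam.1.2 t tab).2) geot s1ab s2ab.
  rewrite -/phi !phigam// e1 e2.
  have -> : derive1 (phi \o gam) s1 = derive1 del s1.
    rewrite !derive1E; apply: near_eq_derive.
    by apply: filterS (open_near oI s1ab) => t tab; exact: phigam.
  have [_ ds1] := rdel s1 s1ab.
  have c1 : cross v (derive1 del s1) = 0 by apply/Tv; have := Tdel s1 s1ab; rewrite e1.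
  move=> c2; have c3 : cross (derive1 del s1) v = 0.
    by move: c1; rewrite /cross => c1; rewrite -[RHS]oppr0 -c1; ring.
  have /(cross_eq0P _ v0)[c E] := cross0_trans ds1 c3 c2.
  by exists c => //; rewrite -E addrC subrK.
- exact: (maps_push_web W phiK).
Qed.

(** The hypotheses concern two connections: [G] has all leaves as geodesics, while [G0] has
    vanishing Liouville tensor but is tied only to the four chosen foliations. Their cubics coincide
    by uniqueness for that subweb, so all [d] foliations are geodesic for [G0]. *)
Lemma liouville_linearizable d (U : set plane) (W : web R d) : open U -> is_web U W ->
  geodesic_web U W ->
  (exists2 s : 'I_4 -> 'I_d, injective s & liouville_tensor_vanishes U (subweb W s)) ->
  linearizable U W.
Proof.
move=> oU hW [G tG gG] [s si [Pi [G0 [[[G1 tG1 ->] gPi] [tG0 sG0] LG0]]]].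
have g0 := gPi G0 (conj tG0 sG0).
have geoG := (geodesic_forP U W G).1 gG.
have geoG0 := (geodesic_forP U (subweb W s) G0).1 g0.
apply: (flat_linearizable oU hW (smooth_christoffel oU tG0.1) (torsion_free_sym tG0)
  (liouville_Lv oU tG0 LG0)).
move=> i a b gam lgam t tab.
have Ug : U (gam t) by have [[_ /(_ t tab)[]]] := lgam.
rewrite -(web4_cubic_unique oU (subweb_web si hW) Ug (fun k => geoG (s k)) geoG0).
exact: geoG lgam t tab.
Qed.

End Linearizable.

(** * Linearizable webs are projectively flat *)

(** Commuting third derivatives: if the covariant Hessian of [u] vanishes, the curvature is
    annihilated by the differential of [u]. Two functions with independent differentials then force
    flatness. *)
Lemma hessian_Rm (R : realType) (V : set 'rV[R]_2) (g : symbols) (u : 'rV[R]_2 -> R) : open V ->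
  (forall i j k, smooth V (g i j k)) -> smooth V u ->
  (forall i j q, V q -> pd i (pd j u) q = \sum_k g i j k q * pd k u q) ->
  forall i j l q, V q -> Rm g i j l i0 q * pd i0 u q + Rm g i j l i1 q * pd i1 u q = 0.
Proof.
move=> oV sg su Hu i j l q Vq.
have D a b : pd a (pd b (pd l u)) q =
    \sum_k (pd a (g b l k) q * pd k u q + g b l k q * \sum_m g a k m q * pd m u q).
  rewrite (pd_eq a oV Vq (fun q => Hu b l q)); erewrite is_pd_val; last by pdt.
  by cbv beta; rewrite !Hu// !sum2.
have C : pd i (pd j (pd l u)) q = pd j (pd i (pd l u)) q.
  exact: pdC oV Vq (smooth_pd l su).
transitivity (pd i (pd j (pd l u)) q - pd j (pd i (pd l u)) q); last by rewrite C subrr.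
by rewrite !D /Rm !sum2; ring.
Qed.

Section FlatSymbols.
Context {R : realType}.
Local Notation plane := 'rV[R]_2.
Variables (V : set plane) (f h : plane -> R).
Hypotheses (oV : open V) (sf : smooth V f) (sh : smooth V h).
Hypothesis J0 : forall q, V q -> jac f h q != 0.

(* The flat connection whose affine functions are spanned by [1], [f] and [h]. *)
Definition pullback_symbols : symbols (R := R) := fun i j k q =>
  if k == i0 then (pd i (pd j f) q * pd i1 h q - pd i (pd j h) q * pd i1 f q) * (jac f h q)^-1
  else (pd i (pd j h) q * pd i0 f q - pd i (pd j f) q * pd i0 h q) * (jac f h q)^-1.
Local Notation g := pullback_symbols.

Lemma smooth_pullback i j k : smooth V (g i j k).
Proof.
have sJ : smooth V (fun q => (jac f h q)^-1).
  exact: smoothV oV J0 (smooth_jac oV sf sh).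
by rewrite /g; case: (ord2P k) => -> /=; smt.
Qed.

Lemma pullback_sym i j k q : V q -> g i j k q = g j i k q.
Proof. by move=> Vq; rewrite /g (pdC i j oV Vq sf) (pdC i j oV Vq sh). Qed.

Lemma pullback_hess i j q : V q ->
  pd i (pd j f) q = \sum_k g i j k q * pd k f q /\
  pd i (pd j h) q = \sum_k g i j k q * pd k h q.
Proof.
move=> Vq; have := J0 Vq; rewrite !sum2 /g /= /jac => n0; split; field; exact: n0.
Qed.

Lemma pullback_flat i j l k q : V q -> Rm g i j l k q = 0.
Proof.
move=> Vq.
have Hf := hessian_Rm oV smooth_pullback sf (fun i j q Vq => (pullback_hess i j Vq).1) i j l Vq.
have Hh := hessian_Rm oV smooth_pullback sh (fun i j q Vq => (pullback_hess i j Vq).2) i j l Vq.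
have n0 := J0 Vq.
case: (ord2P k) => ->; apply: (mulIf n0); rewrite mul0r /jac.
  transitivity ((Rm g i j l i0 q * pd i0 f q + Rm g i j l i1 q * pd i1 f q) * pd i1 h q -
    (Rm g i j l i0 q * pd i0 h q + Rm g i j l i1 q * pd i1 h q) * pd i1 f q); first by ring.
  by rewrite Hf Hh !mul0r subrr.
transitivity ((Rm g i j l i0 q * pd i0 h q + Rm g i j l i1 q * pd i1 h q) * pd i0 f q -
  (Rm g i j l i0 q * pd i0 f q + Rm g i j l i1 q * pd i1 f q) * pd i0 h q); first by ring.
by rewrite Hf Hh !mul0r subrr.
Qed.

Lemma pullback_Lv l q : V q -> Lv g l q = 0.
Proof.
have S0 i j x : V x -> Sch g i j x = 0.
  by move=> Vx; rewrite /Sch /Ric !sum2 !pullback_flat// !addr0 !mulr0 addr0.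
move=> Vq; have dS a i j : pd a (Sch g i j) q = 0.
  rewrite (pd_eq a oV Vq (fun x => @S0 i j x)).
  by apply: is_pd_val; exact: is_pd_cst.
by rewrite /Lv !sum2 !dS !S0// !mulr0 !addr0 !subr0.
Qed.

(** The components [al] of the form [v0 dh - v1 df] annihilate the velocity, since its potential is
    constant along the curve. The form is parallel for the pullback connection, so differentiating
    shows that it annihilates the covariant acceleration too. It is nonzero, hence velocity and
    acceleration are parallel. *)
Lemma pullback_geodesic (a b : R) (gamma : R -> plane) (v0 v1 : R) : 
  smooth [set` `]a, b[] gamma -> (forall t, t \in `]a, b[ -> V (gamma t)) ->
  v0 != 0 \/ v1 != 0 ->
  (forall s t, s \in `]a, b[ -> t \in `]a, b[ ->
     v0 * h (gamma s) - v1 * f (gamma s) = v0 * h (gamma t) - v1 * f (gamma t)) ->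
  forall t, t \in `]a, b[ ->
  cross (derive1 gamma t) (derive1 (derive1 gamma) t) + cubic g (gamma t) (derive1 gamma t) = 0.
Proof.
move=> sg Vg v_neq0 line t tab.
pose c i s := derive1 gamma s 0 i.
have oI : open ([set` `]a, b[] : set R) by exact: interval_open.
have dd (u : plane -> R) (s : R) : smooth V u -> s \in `]a, b[ ->
    is_derive s (1 : R) (fun s => u (gamma s)) (c i0 s * pd i0 u (gamma s) + c i1 s * pd i1 u (gamma s)).
  by move=> su sab; exact: (is_derive_eq_val (is_derive_comp sg su sab (Vg s sab))).
pose al i s := v0 * pd i h (gamma s) - v1 * pd i f (gamma s).
have first (s : R) : s \in `]a, b[ -> c i0 s * al i0 s + c i1 s * al i1 s = 0.
  move=> sab.
  have D := is_deriveB_fun (is_deriveM_fun (is_derive_cst_fun v0 s) (dd h s sh sab))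
    (is_deriveM_fun (is_derive_cst_fun v1 s) (dd f s sf sab)).
  have [_ E] := D; move: E.
  rewrite (near_eq_derive (g := cst (v0 * h (gamma s) - v1 * f (gamma s)))); last first.
    by apply: filterS (open_near oI sab) => x xab; exact: line.
  by rewrite derive_cst /al => E; rewrite [RHS]E; ring.
have dc i : is_derive t (1 : R) (c i) (derive1 (derive1 gamma) t 0 i).
  exact: (is_derive_coord (smooth_derive1 sg) i tab).
have second : (derive1 (derive1 gamma) t 0 i0 + quad g i0 (gamma t) (derive1 gamma t)) * al i0 t +
    (derive1 (derive1 gamma) t 0 i1 + quad g i1 (gamma t) (derive1 gamma t)) * al i1 t = 0.
  have dal i : is_derive t (1 : R) (al i) (v0 * (c i0 t * pd i0 (pd i h) (gamma t) + c i1 t * pd i1 (pd i h) (gamma t))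
     - v1 * (c i0 t * pd i0 (pd i f) (gamma t) + c i1 t * pd i1 (pd i f) (gamma t))).
    have D := is_deriveB_fun (is_deriveM_fun (is_derive_cst_fun v0 t) (dd _ t (smooth_pd i sh) tab))
     (is_deriveM_fun (is_derive_cst_fun v1 t) (dd _ t (smooth_pd i sf) tab)).
    by apply: (is_derive_eq_val D); ring.
  have [_ E] := is_deriveD_fun (is_deriveM_fun (dc i0) (dal i0)) (is_deriveM_fun (dc i1) (dal i1)).
  move: E; rewrite (near_eq_derive (g := cst 0)); last first.
    by apply: filterS (open_near oI tab) => x xab; exact: first.
  rewrite derive_cst => E; apply: (etrans _ (esym E)).
  have Hf i j := (pullback_hess i j (Vg t tab)).1.
  have Hh i j := (pullback_hess i j (Vg t tab)).2.
  rewrite !Hf !Hh !sum2; transitivity ((derive1 (derive1 gamma) t 0 i0 +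
    \sum_i \sum_j c i t * c j t * g i j i0 (gamma t)) * al i0 t +
    (derive1 (derive1 gamma) t 0 i1 + \sum_i \sum_j c i t * c j t * g i j i1 (gamma t)) * al i1 t).
    by [].
  by rewrite /al !sum2; ring.
have first_t := first t tab.
have n0 : al i0 t != 0 \/ al i1 t != 0.
  have [a0|] := eqVneq (al i0 t) 0; last by left.
  right; apply/eqP => a1.
  have := J0 (Vg t tab); rewrite /jac => jn.
  have E0 : v0 * (pd i0 f (gamma t) * pd i1 h (gamma t) - pd i1 f (gamma t) * pd i0 h (gamma t)) = 0.
    transitivity (al i1 t * pd i0 f (gamma t) - al i0 t * pd i1 f (gamma t)); first by rewrite /al; ring.
    by rewrite a0 a1 !mul0r subrr.
  have E1 : v1 * (pd i0 f (gamma t) * pd i1 h (gamma t) - pd i1 f (gamma t) * pd i0 h (gamma t)) = 0.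
    transitivity (al i1 t * pd i0 h (gamma t) - al i0 t * pd i1 h (gamma t)); first by rewrite /al; ring.
    by rewrite a0 a1 !mul0r subrr.
  move: E0 E1 v_neq0 => /eqP; rewrite mulf_eq0 (negbTE jn) orbF => /eqP -> /eqP.
  by rewrite mulf_eq0 (negbTE jn) orbF => /eqP ->; rewrite eqxx => -[].
rewrite /cross /cubic -/(c i0 t) -/(c i1 t).
pose a0 := derive1 (derive1 gamma) t 0 i0 + quad g i0 (gamma t) (derive1 gamma t).
pose a1 := derive1 (derive1 gamma) t 0 i1 + quad g i1 (gamma t) (derive1 gamma t).
have E0 : al i0 t * (c i0 t * a1 - c i1 t * a0) = 0.
  transitivity ((c i0 t * al i0 t + c i1 t * al i1 t) * a1 - c i1 t * (a0 * al i0 t + a1 * al i1 t)).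
    by ring.
  by rewrite first_t /a0 /a1 second mul0r mulr0 subrr.
have E1 : al i1 t * (c i0 t * a1 - c i1 t * a0) = 0.
  transitivity (c i0 t * (a0 * al i0 t + a1 * al i1 t) - (c i0 t * al i0 t + c i1 t * al i1 t) * a0).
    by ring.
  by rewrite first_t /a0 /a1 second mul0r mulr0 subrr.
transitivity (c i0 t * a1 - c i1 t * a0); first by rewrite /a0 /a1; ring.
by case: n0 => n; apply: (mulfI n); rewrite mulr0.
Qed.

End FlatSymbols.

Section Local.
Context {R : realType}.
Local Notation plane := 'rV[R]_2.

Lemma Ck_local (V0 W0 : normedModType R) n (U : set V0) (f : V0 -> W0) :
  (forall p, U p -> exists V : set V0, [/\ open V, V p & Ck n V f]) -> Ck n U f.
Proof.
elim: n f => [|n IH] f H; first by move=> p /H[V [_ Vp]]; exact.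
split=> [p /H[V [_ Vp [df _]]]|v]; first exact: df.
by apply: IH => p /H[V [oV Vp [_ cf]]]; exists V; split=> //; exact: cf.
Qed.

Lemma smooth_local (V0 W0 : normedModType R) (U : set V0) (f : V0 -> W0) :
  (forall p, U p -> exists V : set V0, [/\ open V, V p & smooth V f]) -> smooth U f.
Proof.
by move=> H n; apply: Ck_local => p /H[V [oV Vp sf]]; exists V; split=> //; exact: sf.
Qed.

Lemma eq_Lv (V : set plane) (g g' : symbols (R := R)) l q : open V ->
  (forall i j k x, V x -> g i j k x = g' i j k x) -> V q -> Lv g l q = Lv g' l q.
Proof.
move=> oV E.
have ES i j x : V x -> Sch g i j x = Sch g' i j x.
  move=> Vx.
  have Ep a b c e : pd a (g b c e) x = pd a (g' b c e) x.
    by apply: (pd_eq a oV Vx) => y; exact: E.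
  have ER a b c e : Rm g a b c e x = Rm g' a b c e x by rewrite /Rm !sum2 !Ep !E.
  by rewrite /Sch /Ric !sum2 !ER.
move=> Vq; have ESp a b c : pd a (Sch g b c) q = pd a (Sch g' b c) q.
  by apply: (pd_eq a oV Vq) => y; exact: ES.
by rewrite /Lv !sum2 !ESp !ES// !E.
Qed.

Lemma eq_cubic (g g' : symbols (R := R)) q v : (forall i j k, g i j k q = g' i j k q) ->
  cubic g q v = cubic g' q v.
Proof. by move=> E; rewrite /cubic /quad !sum2 !E. Qed.

Lemma det2_inverse (a b c d x y z w : R) : a * x + c * y = 1 -> a * z + c * w = 0 ->
  b * x + d * y = 0 -> b * z + d * w = 1 -> (a * d - b * c) * (x * w - z * y) = 1.
Proof.
move=> H00 H01 H10 H11.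
transitivity ((a * x + c * y) * (b * z + d * w) - (a * z + c * w) * (b * x + d * y)); first by ring.
by rewrite H00 H01 H10 H11 mulr1 mulr0 subr0.
Qed.

Lemma diffeomorphism_jac (V V' : set plane) phi : diffeomorphism V V' phi ->
  forall q, V q -> jac (fun x => phi x 0 i0) (fun x => phi x 0 i1) q != 0.
Proof.
move=> [oV oV' [psi [sphi spsi phiK _]]] q Vq; have [V'q _] := phiK q Vq.
have H i k : pd i (fun x => phi x 0 i0) q * pd i0 (fun x => psi x 0 k) (phi q) +
    pd i (fun x => phi x 0 i1) q * pd i1 (fun x => psi x 0 k) (phi q) = (k == i)%:R.
  have /rowP/(_ k) := derive_inverse (delta_mx 0 i) oV Vq sphi spsi phiK.
  rewrite (derive_row _ _ (smooth_diff spsi V'q)) sum2 !(derive_row _ _ (smooth_diff sphi Vq)) !sum2 !mxE/=.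
  by move=> <-; case: (ord2P i) => -> /=; rewrite !(mul0r, mul1r, addr0, add0r).
apply/eqP => J0; have := det2_inverse (H i0 i0) (H i0 i1) (H i1 i0) (H i1 i1).
by rewrite [_ - _]J0 mul0r => /eqP; rewrite eq_sym oner_eq0.
Qed.

Lemma linearizable_local d (U : set plane) (W : web R d) r : linearizable U W -> U r ->
  exists (V : set plane) (g : symbols (R := R)), [/\ open V, V r, V `<=` U &
   [/\ forall i j k, smooth V (g i j k), forall i j k q, V q -> g i j k q = g j i k q,
     forall l q, V q -> Lv g l q = 0 & forall i, cubic_geodesic V (W i) g]].
Proof.
move=> lW Ur; have [V [V' [phi [W' [[Vr VU] dphi hW' sW' [s mW]]]]]] := lW r Ur.
have J := diffeomorphism_jac dphi.
have [oV oV' [psi [sphi spsi phiK psiK]]] := dphi.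
pose f x := phi x 0 i0; pose h x := phi x 0 i1.
have sf : smooth V f by exact: smooth_coord.
have sh : smooth V h by exact: smooth_coord.
exists V, (pullback_symbols f h); split=> //; split.
- exact: (smooth_pullback oV sf sh J).
- exact: (pullback_sym oV sf sh).
- exact: (pullback_Lv oV sf sh J).
move=> i a b gam [[sg rg] Tg] t tab.
have Vg u : u \in `]a, b[ -> V (gam u) by move=> /rg[].
have oI : open ([set` `]a, b[] : set R) by exact: interval_open.
pose del := phi \o gam.
have sdel : smooth [set` `]a, b[] del by exact: (smooth_comp_row oI oV Vg sg sphi).
have ddel u : u \in `]a, b[ -> derive1 del u = 'D_(derive1 gam u) phi (gam u).
  move=> uab; rewrite !derive1E.
  have dgu : differentiable gam u by exact: smooth_diff sg _.
  have dphiu := smooth_diff sphi (Vg u uab).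
  by rewrite [LHS](derive_comp_diff _ dgu dphiu).
have ldel : leaf_curve V' (W' (s i)) a b del.
  split; first (split; [exact: sdel|move=> u uab]).
    split; first by have [] := phiK _ (Vg u uab).
    rewrite ddel//; have [_] := rg u uab; apply: contra_neq => E.
    rewrite -(derive_inverse (derive1 gam u) oV (Vg u uab) sphi spsi phiK) E.
    by rewrite derive0.
  move=> u uab; rewrite ddel// -(mW i _ (Vg u uab)).
  by exists (derive1 gam u) => //; exact: Tg.
have V't : V' (del t) by have [] := phiK _ (Vg t tab).
have [v v0 Hv] := sW' (s i) (del t) V't.
have line u : u \in `]a, b[ -> v 0 i0 * h (gam u) - v 0 i1 * f (gam u) =
    v 0 i0 * h (gam t) - v 0 i1 * f (gam t).
  move=> uab; have [|c _ E] := Hv (del u); first by exists a, b, del, t, u.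
  have E0 : f (gam u) = f (gam t) + c * v 0 i0 by rewrite /f -[phi (gam u)]E !mxE.
  have E1 : h (gam u) = h (gam t) + c * v 0 i1 by rewrite /h -[phi (gam u)]E !mxE.
  by rewrite E0 E1; ring.
have L x y : x \in `]a, b[ -> y \in `]a, b[ -> v 0 i0 * h (gam x) - v 0 i1 * f (gam x) =
    v 0 i0 * h (gam y) - v 0 i1 * f (gam y) by move=> xab yab; rewrite (line x xab) (line y yab).
exact: (pullback_geodesic sf sh J sg Vg (plane_neq0 v0) L tab).
Qed.

Lemma sub_interval_leaf (U V : set plane) T a b gam t : open V -> leaf_curve U T a b gam ->
  t \in `]a, b[ -> V (gam t) ->
  exists a1 b1, (t \in `]a1, b1[)%R /\ leaf_curve V T a1 b1 gam.
Proof.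
move=> oV [[sg rg] Tg] tab Vt.
have oI : open ([set` `]a, b[] : set R) by exact: interval_open.
have oX := open_preimage oI oV sg.
have [e e0 He] := nbhs_norm_ex (open_near oX (conj tab Vt)).
have sub u : u \in `](t - e), (t + e)[ -> (u \in `]a, b[)%R /\ V (gam u).
  move=> ue; have [] := He u; last by split.
  by move: ue; rewrite in_itv/= ltr_norml => /andP[? ?]; lra.
exists (t - e), (t + e); split; first by rewrite in_itv/= ltrBlDr ltrDl e0.
split; last by move=> u /sub[uab _]; exact: Tg.
split; first by apply: sub_smooth sg => u /sub[].
by move=> u /sub[uab Vu]; split=> //; have [] := rg u uab.
Qed.

Lemma linearizable_geodesic d (U : set plane) (W : web R d) (s : 'I_4 -> 'I_d) : open U ->
  is_web U W -> injective s -> linearizable U W ->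
  exists G, [/\ torsion_free_connection U G, geodesic_for U W G &
    forall l q, U q -> Lv (christoffel G) l q = 0].
Proof.
move=> oU hW si lW.
have H r : exists Vg : set plane * symbols (R := R), U r -> [/\ open Vg.1, Vg.1 r, Vg.1 `<=` U &
   [/\ forall i j k, smooth Vg.1 (Vg.2 i j k), forall i j k q, Vg.1 q -> Vg.2 i j k q = Vg.2 j i k q,
     forall l q, Vg.1 q -> Lv Vg.2 l q = 0 & forall i, cubic_geodesic Vg.1 (W i) Vg.2]].
  have [Ur|nUr] := pselect (U r); last by exists (set0, fun _ _ _ _ => 0).
  by have [V [g HVg]] := linearizable_local lW Ur; exists (V, g).
have [Vg {}H] := choice H.
pose V r := (Vg r).1; pose g r := (Vg r).2.
(* At each point the symbols selected for that very point are used, with no compatibility in the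
   choice. [GE] shows that on the whole neighbourhood of [r] the result equals the smooth symbols
   selected for [r], because on overlaps both are determined by the same four foliations. *)
pose G : connection R := fun i j q => mk2 (thomas (g q) i j i0 q) (thomas (g q) i j i1 q).
have GE r i j k q : U r -> V r q -> christoffel G i j k q = thomas (g r) i j k q.
  move=> Ur Vq; have [oVr Vrr VrU [sr yr _ gr]] := H r Ur.
  have Uq := VrU q Vq; have [oVq Vqq VqU [sq yq _ gq]] := H q Uq.
  have -> : christoffel G i j k q = thomas (g q) i j k q.
    by rewrite /christoffel /G; case: (ord2P k) => ->; rewrite ?mk2_0 ?mk2_1.
  have oX : open (V q `&` V r) by exact: openI.
  have XU : V q `&` V r `<=` U by move=> x [/VqU].
  apply: thomas_unique => [a b c|a b c|]; [exact: yq|exact: yr|].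
  apply: (web4_cubic_unique oX (subweb_web si (sub_web oX XU hW)) (conj Vqq Vq)) => a.
    by apply: sub_cubic_geodesic (gq (s a)) => x [].
  by apply: sub_cubic_geodesic (gr (s a)) => x [].
have sG i j : smooth U (G i j).
  apply: smooth_local => r Ur; have [oVr Vrr VrU [sr yr _ _]] := H r Ur.
  exists (V r); split=> //; apply: smooth_row => // k.
  by apply: smooth_eq oVr _ (smooth_thomas oVr sr i j k) => q Vq; rewrite -(GE r).
have symG i j q : U q -> G i j q = G j i q.
  move=> Uq; have [oVr Vrr VrU [sr yr _ _]] := H q Uq.
  by rewrite /G !(thomas_sym (yr i j _ q Vrr)).
exists G; split; first exact: sym_torsion_free.
- apply/geodesic_forP => i a b gam lg t tab.
  have Ut : U (gam t) by have [[_ /(_ t tab)[]]] := lg.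
  have [oVr Vrr VrU [_ _ _ gr]] := H _ Ut.
  have [a1 [b1 [tab1 lg1]]] := sub_interval_leaf oVr lg tab Vrr.
  rewrite (eq_cubic _ (fun i j k => GE (gam t) i j k (gam t) Ut Vrr)) cubic_thomas.
  exact: gr lg1 t tab1.
move=> l q Uq; have [oVr Vrr VrU [sr yr Lr _]] := H q Uq.
by rewrite (eq_Lv l oVr (fun i j k x => GE q i j k x Uq) Vrr) (Lv_thomas oVr Vrr sr yr) Lr.
Qed.

End Local.

Theorem theorem9 (R : realType) (d : nat) (U : set 'rV[R]_2) (W : web R d)
    (hd : (4 <= d)%N) (hU : plane_domain U) (hW : is_web U W) :
  linearizable U W <->
  geodesic_web U W /\
  exists2 s : 'I_4 -> 'I_d, injective s & liouville_tensor_vanishes U (subweb W s).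
Proof.
have [oU _ _] := hU; split=> [lW|[gW LW]]; last exact: liouville_linearizable.
(* The subweb of the first four foliations is taken; the connection obtained from it is geodesic for
   the whole web, and its projective class is the canonical structure. *)
pose s : 'I_4 -> 'I_d := widen_ord hd.
have si : injective s by move=> i j /(congr1 val) /= ij; exact: val_inj.
have [G [tG gG LG]] := linearizable_geodesic oU hW si lW.
split; first by exists G.
exists s => //.
exists [set G' | torsion_free_connection U G' /\ same_geodesics U G G'], G; split.
- split; first by exists G.
  move=> G' [_ GG'] i a b gam lg; apply/(GG' a b gam lg.1).
  exact: gG lg.
- by split=> // a b gam _.
move=> X Y Z sX sY sZ p Up.
by rewrite (liouvilleE oU tG.1 (torsion_free_sym tG) Up sX sY sZ) sum2 !LG// !mulr0 addr0 mulr0.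
Qed.
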